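(* (McKean-Singer) Let $D$ be an unbounded self-adjoint operator affiliated to the semifinite von Neumann algebra $\mathcal N$ (with faithful normal semifinite trace $\tau$). Let $\gamma$ be a self-adjoint unitary in $\mathcal N$ which anticommutes with $D$. Let $f$ be a continuous even function on $\mathbb R$ with $f(0)\ne0$ and $f(D)$ trace-class (with respect to $\tau$). Let $D^+=P^\perp DP$ where $P=(\gamma+1)/2$ and $P^\perp=1-P$. Then, as an operator affiliated to $P^\perp\mathcal NP$, $D^+$ is $(P^\perp\cdot P)$-Fredholm and $$Ind(D^+)=\frac1{f(0)}\tau(\gamma f(D)).$$
   Context: Let $P,Q$ be projections in $\mathcal N$ (acting on $\mathcal H$). A closed, densely defined operator $T$ affiliated to $P\mathcal NQ$ (i.e. $T$ is affiliated to $\mathcal N$ and $T=PTQ$, so $T$ is regarded as an operator from $Q\mathcal H$ to $P\mathcal H$) is called $(P\cdot Q)$-Fredholm if (1) $\tau(N_T^Q)<\infty$ and $\tau(N_{T^*}^P)<\infty$, where $N_T^Q$ is the projection onto $\ker(T)\cap Q\mathcal H$ and $N_{T^*}^P$ the projection onto $\ker(T^* )\cap P\mathcal H$; and (2) there is a $\tau$-finite projection $E\le P$ with $\mathrm{range}(P-E)\subseteq\mathrm{range}(T)$. Its $(P\cdot Q)$-index is $Ind(T)=\tau(N_T^Q)-\tau(N_{T^*}^P)$. In the claim the index of $D^+$ is the $(P^\perp\cdot P)$-index. *)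

(* Defs.v *)
From HB Require Import structures.
From mathcomp Require Import all_boot all_order all_algebra sesquilinear.
From mathcomp.real_closed Require Export complex.
From mathcomp Require Import all_classical all_reals all_analysis.

Set Implicit Arguments.
Unset Strict Implicit.
Unset Printing Implicit Defensive.

Import Order.TTheory GRing.Theory Num.Theory.
Import numFieldNormedType.Exports.

Local Open Scope classical_set_scope.
Local Open Scope ring_scope.
Local Open Scope complex_scope.

(* A complex Hilbert space.  The library's forms [{dot _ for _}] are linear in
   the first variable and conjugate-linear in the second one. *)
Record hilbertSpace (R : realType) := HilbertSpace {
  hcarrier :> completeNormedModType R[i];
  inner : {dot hcarrier for Num.conj};
  inner_norm : forall x : hcarrier, `|x| ^+ 2 = inner x x }.

Notation "''[' x | y ]" := (inner _ x y)
  (at level 0, x, y at level 90, format "''[' x  |  y ]") : ring_scope.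

Section Bounded.
Context (R : realType) (H : hilbertSpace R).
Implicit Types (a b p u : H -> H) (N : set (H -> H)).

Definition bounded_op a : Prop := linear a /\ continuous a.

Definition is_adjoint a b : Prop := forall x y, '[a x | y] = '[x | b y].

Definition unitary u : Prop :=
  bounded_op u /\
  exists v, [/\ is_adjoint u v, u \o v = id & v \o u = id].

Definition orthoproj p : Prop := [/\ bounded_op p, p \o p = p & is_adjoint p p].

(* The order of R[i] is used here: z <= w means that w - z is real and
   nonnegative. *)
Definition positive_op a : Prop := bounded_op a /\ forall x, 0 <= '[a x | x].

Definition op_le a b : Prop := forall x, '[a x | x] <= '[b x | x].

Definition commutant N : set (H -> H) :=
  [set a | bounded_op a /\ forall b, N b -> a \o b = b \o a].

Definition von_neumann N : Prop :=
  [/\ N `<=` bounded_op,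
      forall a, N a -> exists2 b, is_adjoint a b & N b &
      N = commutant (commutant N)].

(* The orthogonal projection with range V, for V a closed subspace
   (0 by default). *)
Definition proj_onto (V : set H) : H -> H :=
  xget (fun=> 0) [set p | orthoproj p /\ range p = V].

End Bounded.

Section Trace.
Context (R : realType) (H : hilbertSpace R).
Implicit Types (a b : H -> H) (N S : set (H -> H)) (tau : (H -> H) -> \bar R).

Definition pos_cone N : set (H -> H) := [set a | N a /\ positive_op a].

Definition directed_up S : Prop :=
  S !=set0 /\
  forall a b, S a -> S b -> exists c, [/\ S c, op_le a c & op_le b c].

Definition lub_in N S a : Prop :=
  [/\ pos_cone N a, forall b, S b -> op_le b a &
      forall c, pos_cone N c -> (forall b, S b -> op_le b c) -> op_le a c].

(* Only the values of tau on the positive cone of N are meaningful. *)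
Definition is_trace N tau : Prop :=
  [/\ forall a, pos_cone N a -> (0 <= tau a)%E,
      forall a b, pos_cone N a -> pos_cone N b ->
        tau (fun x => a x + b x) = (tau a + tau b)%E,
      forall (c : R) a, 0 <= c -> pos_cone N a ->
        tau (fun x => c%:C *: a x) = (c%:E * tau a)%E &
      forall a b, N a -> is_adjoint a b -> tau (b \o a) = tau (a \o b)].

Definition trace_faithful N tau : Prop :=
  forall a, pos_cone N a -> tau a = 0%E -> a = (fun=> 0).

Definition trace_normal N tau : Prop :=
  forall S a, S `<=` pos_cone N -> directed_up S -> lub_in N S a ->
    tau a = ereal_sup [set tau b | b in S].

Definition trace_semifinite N tau : Prop :=
  forall a, pos_cone N a -> a <> (fun=> 0) ->
    exists b, [/\ pos_cone N b, b <> (fun=> 0), op_le b a & (tau b < +oo)%E].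

Definition fns_trace N tau : Prop :=
  [/\ is_trace N tau, trace_faithful N tau, trace_normal N tau &
      trace_semifinite N tau].

Definition is_abs a b : Prop :=
  positive_op b /\ exists2 c, is_adjoint a c & b \o b = c \o a.

Definition trace_class N tau a : Prop :=
  N a /\ exists b, [/\ N b, is_abs a b & (tau b < +oo)%E].

Definition fin_cone N tau : set (H -> H) :=
  [set a | pos_cone N a /\ (tau a < +oo)%E].

(* The linear extension of tau to the trace-class operators, which are exactly
   the linear combinations of positive operators of finite trace. *)
Definition tr N tau a : R[i] :=
  xget 0 [set c | exists a0 a1 a2 a3,
    [/\ [/\ fin_cone N tau a0, fin_cone N tau a1,
            fin_cone N tau a2 & fin_cone N tau a3],
        a = (fun x => a0 x - a1 x + 'i%C *: (a2 x - a3 x)) &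
        c = (fine (tau a0) - fine (tau a1)) +i*
            (fine (tau a2) - fine (tau a3))]].

End Trace.

(* Unbounded operators are represented by their graphs. *)
Section Unbounded.
Context (R : realType) (H : hilbertSpace R).
Implicit Types (S T D : set (H * H)) (a : H -> H) (N : set (H -> H)).

Definition graph a : set (H * H) := [set p | p.2 = a p.1].
Definition dom T : set H := [set p.1 | p in T].
Definition ran T : set H := [set p.2 | p in T].
Definition ker T : set H := [set x | T (x, 0)].
Definition oppop T : set (H * H) := [set p | T (p.1, - p.2)].

(* compop S T is the product S T (first T, then S) on its natural domain. *)
Definition compop S T : set (H * H) :=
  [set p | exists2 w, T (p.1, w) & S (w, p.2)].

Definition adjop T : set (H * H) :=
  [set p | forall q, T q -> '[q.2 | p.1] = '[q.1 | p.2]].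

Definition densely_defined_op T : Prop :=
  [/\ forall (c : R[i]) p q, T p -> T q -> T (c *: p + q),
      forall x y z, T (x, y) -> T (x, z) -> y = z &
      dense (dom T)].

Definition closed_op T : Prop := densely_defined_op T /\ closed T.

Definition selfadjoint_op D : Prop := densely_defined_op D /\ adjop D = D.

Definition affiliated N T : Prop :=
  forall u, commutant N u -> unitary u ->
    forall x y, T (x, y) -> T (u x, u y).

Definition anticommutes a D : Prop :=
  compop (graph a) D = oppop (compop D (graph a)).

End Unbounded.

Section SpectralCalculus.
Context (R : realType) (H : hilbertSpace R).

(* Projection-valued measures on the Borel sets of the line; for a measurable
   set A, |E(A) x|^2 = <E(A) x, x>. *)
Record pvm := Pvm {
  pvm_fun :> set (measurableTypeR R) -> H -> H;
  pvm_proj : forall A, measurable A -> orthoproj (pvm_fun A);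
  pvm_set0 : pvm_fun set0 = (fun=> 0);
  pvm_setT : pvm_fun setT = id;
  pvm_setI : forall A B, measurable A -> measurable B ->
    pvm_fun (A `&` B) = pvm_fun A \o pvm_fun B;
  pvm_sigma : forall x,
    semi_sigma_additive (fun A => ((complex.Re `|pvm_fun A x|) ^+ 2)%:E) }.

Definition pvm_at (E : pvm) (x : H) (A : set (measurableTypeR R)) : \bar R :=
  ((complex.Re `|E A x|) ^+ 2)%:E.

Section PvmAt.
Context (E : pvm) (x : H).

Let pvm_at0 : pvm_at E x set0 = 0%E.
Proof. by rewrite /pvm_at pvm_set0 normr0 /= expr0n. Qed.

Let pvm_at_ge0 A : (0 <= pvm_at E x A)%E.
Proof. by rewrite lee_fin sqr_ge0. Qed.

HB.instance Definition _ := isMeasure.Build _ _ _ (pvm_at E x)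
  pvm_at0 pvm_at_ge0 (@pvm_sigma E x).

End PvmAt.

Definition cintegral (mu : {measure set (measurableTypeR R) -> \bar R})
    (g : R -> R[i]) : R[i] :=
  (\int[mu]_t complex.Re (g t)) +i* (\int[mu]_t complex.Im (g t)).

Definition square_int (E : pvm) (g : R -> R[i]) (x : H) : Prop :=
  (\int[pvm_at E x]_t ((complex.Re `|g t|) ^+ 2)%:E < +oo)%E.

(* The operator int g dE with its natural domain; the right-hand side is
   int g d<E x, z>, the complex measure <E x, z> being expressed by
   polarization through the measures <E v, v>. *)
Definition spectral_integral (E : pvm) (g : R -> R[i]) : set (H * H) :=
  [set p | square_int E g p.1 /\ forall z, square_int E g z ->
    '[p.2 | z] = 4%:R^-1 *
      \sum_(k < 4) 'i%C ^+ k * cintegral (pvm_at E (p.1 + 'i%C ^+ k *: z)) g].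

Definition is_spectral_measure (D : set (H * H)) (E : pvm) : Prop :=
  spectral_integral E (fun t => t%:C) = D.

(* f(D), for D self-adjoint, whose spectral measure exists and is unique. *)
Definition fcalc (D : set (H * H)) (f : R -> R[i]) : set (H * H) :=
  [set p | exists2 E, is_spectral_measure D E & spectral_integral E f p].

End SpectralCalculus.

Section Fredholm.
Context (R : realType) (H : hilbertSpace R).
Context (N : set (H -> H)) (tau : (H -> H) -> \bar R).
Implicit Types (P Q E : H -> H) (T : set (H * H)).

Definition ker_proj Q T : H -> H := proj_onto (ker T `&` range Q).

Definition affiliated_corner P Q T : Prop :=
  [/\ closed_op T, affiliated N T & T = compop (graph P) (compop T (graph Q))].

Definition corner_fredholm P Q T : Prop :=
  [/\ N P /\ orthoproj P, N Q /\ orthoproj Q, affiliated_corner P Q T,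
      (tau (ker_proj Q T) < +oo)%E /\ (tau (ker_proj P (adjop T)) < +oo)%E &
      exists E, [/\ N E, orthoproj E, op_le E P, (tau E < +oo)%E &
                    range (fun x => P x - E x) `<=` ran T]].

Definition corner_index P Q T : R :=
  fine (tau (ker_proj Q T)) - fine (tau (ker_proj P (adjop T))).

End Fredholm.

Section Grading.
Context (R : realType) (H : hilbertSpace R).
Implicit Types (gamma P : H -> H) (D : set (H * H)).

Definition grading_proj gamma : H -> H := fun x => 2%:R^-1 *: (gamma x + x).

Definition perp P : H -> H := fun x => x - P x.

Definition Dplus gamma D : set (H * H) :=
  compop (graph (perp (grading_proj gamma)))
         (compop D (graph (grading_proj gamma))).

End Grading.

(* Main.v *)
From HB Require Import structures.
From mathcomp Require Import all_boot all_order all_algebra sesquilinear.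
From mathcomp.real_closed Require Import complex.
From mathcomp Require Import all_classical all_reals all_analysis.
From mathcomp Require Import measurable_realfun.
From mathcomp Require Import ring lra.
Require Import Defs.

(* Let E be the spectral measure of D (its existence is part of the meaning of
   f(D)).  A vector x lies in the range of E [c - r, c + r] as soon as
   |(D - c)^n x| <= C r^n for all n, so an isometry V with V D = s D V, s = 1
   or -1, maps E A to E (s A) for intervals, hence for all Borel sets A.  With
   s = 1 this gives uniqueness of E and, the elements of the commutant N' being
   controlled by its unitaries through the Cayley transform, E A in N; with
   s = -1 and V = gamma it gives gamma E A = E (- A) gamma.
   Since f is bounded below by a positive constant near 0 and positive square
   roots are operator monotone, E [- d, d] is tau-finite for some d > 0; D is
   bounded below, hence onto, on the range of its complement, so that D^+ is
   Fredholm, with kernel and cokernel projections P E{0} and P^perp E{0}.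
   If U is the sign of D, then U gamma = - gamma U, so tau (P E A) =
   tau (P^perp E A) for symmetric Borel sets A not containing 0 by the trace
   property.  Approximating by step functions and using normality,
   gamma f(D) (1 - E{0}) has trace 0, while gamma f(D) E{0} = f(0) gamma E{0}
   has trace f(0) times the index. *)

Set Implicit Arguments.
Unset Strict Implicit.
Unset Printing Implicit Defensive.

Import Order.TTheory GRing.Theory Num.Theory.
Import numFieldNormedType.Exports.

Local Open Scope classical_set_scope.
Local Open Scope ring_scope.
Local Open Scope complex_scope.

(** What is given about [E] is only the sesquilinear identity that defines [spectral_integral];
    multiplicativity of the calculus is not built in. Hence the estimates are drawn from one
    inequality: a pointwise lower bound of Re (w f) on A bounds the quadratic form on the range of
    [E A]; powers of D - c then stand in for functions of D. The trace-class hypothesis is equally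
    indirect: it supplies a positive [b] of finite trace with |b x| = |f(D) x|, whereas the trace is
    monotone for the order of forms. Operator monotonicity of the square root bridges the two: every
    positive p in N with |p x| <= |f(D) x| has finite trace. Since f is complex-valued, this is
    applied to real parts of w f(D) with |w| = 1; that their norm at x is at most |f(D) x| rests on
    the normality of f(D). The sets where Re (w f) has a given sign are symmetric because f is even,
    so their spectral projections commute with gamma. *)

Local Notation Re := complex.Re.
Local Notation Im := complex.Im.

(** * Hilbert spaces and bounded operators *)

Section InnerProduct.
Context (R : realType) (H : hilbertSpace R).
Implicit Types (x y z : H) (c : R[i]) (r : R).

(** [ri] and [nr] bring the form and the norm, both valued in R[i], down to R, where order and field
    tactics apply; [inner_ri] recovers the complex form. *)
Definition ri x y : R := Re '[x | y].
Definition nr x : R := Re `|x|.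

Lemma innerDl x y z : '[x + y | z] = '[x | z] + '[y | z].
Proof. exact: linearDl. Qed.
Lemma innerDr x y z : '[z | x + y] = '[z | x] + '[z | y].
Proof. exact: linearDr. Qed.
Lemma innerZl c x y : '[c *: x | y] = c * '[x | y].
Proof. by rewrite linearZl_LR. Qed.
Lemma innerC x y : '[x | y] = ('[y | x])^*%C.
Proof. by rewrite hermC expr0 mul1r. Qed.
Lemma innerZr c x y : '[x | c *: y] = c^*%C * '[x | y].
Proof. by rewrite innerC innerZl rmorphM /= -innerC. Qed.
Lemma innerNl x y : '[- x | y] = - '[x | y].
Proof. by rewrite linearNl. Qed.
Lemma innerNr x y : '[x | - y] = - '[x | y].
Proof. by rewrite linearNr. Qed.
Lemma innerBl x y z : '[x - y | z] = '[x | z] - '[y | z].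
Proof. by rewrite innerDl innerNl. Qed.
Lemma innerBr x y z : '[z | x - y] = '[z | x] - '[z | y].
Proof. by rewrite innerDr innerNr. Qed.
Lemma inner0l x : '[0 | x] = 0.
Proof. by rewrite linear0l. Qed.
Lemma inner0r x : '[x | 0] = 0.
Proof. by rewrite linear0r. Qed.

Lemma nrE x : `|x| = (nr x)%:C.
Proof. by rewrite /nr RRe_real // ger0_real. Qed.
Lemma inner_nr x : '[x | x] = (nr x ^+ 2)%:C.
Proof. by rewrite -inner_norm nrE -rmorphXn. Qed.
Lemma nr_sqr x : nr x ^+ 2 = ri x x.
Proof. by rewrite /ri inner_nr. Qed.
Lemma nr_ge0 x : 0 <= nr x.
Proof. by rewrite -ler0c -nrE. Qed.
Lemma nr_eq0 x : nr x = 0 -> x = 0.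
Proof. by move=> h; apply/eqP; rewrite -normr_eq0 nrE h. Qed.
Lemma nr0 : nr (0 : H) = 0. Proof. by rewrite /nr normr0. Qed.
Lemma nr_gt0 x : x != 0 -> 0 < nr x.
Proof.
move=> x0; rewrite lt_def nr_ge0 andbT; apply: contra_neq x0; exact: nr_eq0.
Qed.
Lemma nrD x y : nr (x + y) <= nr x + nr y.
Proof. by rewrite -lecR rmorphD /= -!nrE ler_normD. Qed.
Lemma nrN x : nr (- x) = nr x. Proof. by rewrite /nr normrN. Qed.
Lemma nrBC x y : nr (x - y) = nr (y - x). Proof. by rewrite -nrN opprB. Qed.
Lemma nrZ c x : nr (c *: x) = Re `|c| * nr x.
Proof.
apply: complexI; rewrite rmorphM -!nrE normrZ; congr (_ * _).
by apply/esym/RRe_real/ger0_real.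
Qed.
Lemma Re_norm_real r : Re `|r%:C| = `|r|.
Proof. by rewrite normc_def /= expr0n addr0 sqrtr_sqr. Qed.
Lemma nrZr r x : nr (r%:C *: x) = `|r| * nr x.
Proof. by rewrite nrZ Re_norm_real. Qed.
Lemma Re_norm_i : Re `|'i%C : R[i]| = 1.
Proof. by rewrite normc_def /= expr0n expr1n add0r sqrtr1. Qed.

Lemma riDl x y z : ri (x + y) z = ri x z + ri y z.
Proof. by rewrite /ri innerDl raddfD. Qed.
Lemma riDr x y z : ri z (x + y) = ri z x + ri z y.
Proof. by rewrite /ri innerDr raddfD. Qed.
Lemma riNl x y : ri (- x) y = - ri x y.
Proof. by rewrite /ri innerNl raddfN. Qed.
Lemma riNr x y : ri x (- y) = - ri x y.
Proof. by rewrite /ri innerNr raddfN. Qed.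
Lemma riBl x y z : ri (x - y) z = ri x z - ri y z.
Proof. by rewrite riDl riNl. Qed.
Lemma riBr x y z : ri z (x - y) = ri z x - ri z y.
Proof. by rewrite riDr riNr. Qed.
Lemma riC x y : ri x y = ri y x.
Proof. by rewrite /ri innerC; case: '[y | x]. Qed.
Lemma riZl r x y : ri (r%:C *: x) y = r * ri x y.
Proof. by rewrite /ri innerZl; case: '[x | y] => u v /=; rewrite mul0r subr0. Qed.
Lemma riZr r x y : ri x (r%:C *: y) = r * ri x y.
Proof. by rewrite riC riZl riC. Qed.
Lemma ri0l x : ri 0 x = 0. Proof. by rewrite /ri inner0l. Qed.
Lemma ri0r x : ri x 0 = 0. Proof. by rewrite /ri inner0r. Qed.
Lemma ri_iZl x y : ri ('i%C *: x) y = - Im '[x | y].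
Proof. by rewrite /ri innerZl mulrC ReiNIm. Qed.
Lemma inner_ri x y : '[x | y] = ri x y +i* - ri ('i%C *: x) y.
Proof. by rewrite ri_iZl opprK /ri; case: '[x | y]. Qed.

Lemma nr_sqrD x y : nr (x + y) ^+ 2 = nr x ^+ 2 + 2 * ri x y + nr y ^+ 2.
Proof. by rewrite !nr_sqr riDl !riDr (riC y x); ring. Qed.
Lemma nr_sqrB x y : nr (x - y) ^+ 2 = nr x ^+ 2 - 2 * ri x y + nr y ^+ 2.
Proof. by rewrite nr_sqrD riNr nrN; ring. Qed.

Lemma quadratic_ge0_eq0 (b q : R) : 0 <= q ->
  (forall t, 0 <= 2 * t * b + t ^+ 2 * q) -> b = 0.
Proof.
move=> q0 h; apply/eqP/negPn/negP => b0.
have q1 : 0 < q + 1 by lra.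
(* The minimiser would be - b / q; dividing by q + 1 keeps the test value meaningful when q = 0. *)
have := h (- b / (q + 1)).
have -> : 2 * (- b / (q + 1)) * b + (- b / (q + 1)) ^+ 2 * q
   = - (b ^+ 2 * (q + 2) / (q + 1) ^+ 2) by field; lra.
rewrite oppr_ge0 leNgt divr_gt0 // ?exprn_gt0 // mulr_gt0 //; last by lra.
by rewrite exprn_even_gt0.
Qed.

Lemma ri_le x y : ri x y <= nr x * nr y.
Proof.
have [->|y0] := eqVneq y 0; first by rewrite ri0r nr0 mulr0.
have [->|x0] := eqVneq x 0; first by rewrite ri0l nr0 mul0r.
have ny := nr_gt0 y0.
have nx := nr_gt0 x0.
(* Cauchy-Schwarz: expanding this square leaves 2 |x| |y| (|x| |y| - ri x y), and the positive
   factor |x| |y| cancels. *)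
have : 0 <= nr ((nr y)%:C *: x - (nr x)%:C *: y) ^+ 2 by exact: sqr_ge0.
rewrite nr_sqrB riZl riZr !nrZr !exprMn !(ger0_norm (nr_ge0 _)).
move=> h.
have : 0 <= (nr x * nr y) * (2 * (nr x * nr y - ri x y)) by nra.
rewrite pmulr_rge0 ?mulr_gt0 //; lra.
Qed.

Lemma ri_le_norm x y : `|ri x y| <= nr x * nr y.
Proof.
by rewrite ler_norml ri_le andbT lerNl -riNl (le_trans (ri_le _ _)) // nrN.
Qed.

(** Rotating c onto the positive half-line turns a modulus into a real part: this carries
    Cauchy-Schwarz over from [ri] to the complex form, and later makes w f(0) positive. *)
Lemma unit_phase c : exists2 w : R[i], Re `|w| = 1 & Re (w * c) = Re `|c|.
Proof.
have [->|c0] := eqVneq c 0; first by exists 1; rewrite ?normr1 // mulr0 normr0.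
exists (`|c| / c); last by rewrite mulfVK.
by rewrite normrM normr_id normfV mulfV // normr_eq0.
Qed.

Lemma inner_le x y : Re `|'[x | y]| <= nr x * nr y.
Proof.
have [w w1 <-] := unit_phase '[x | y].
by rewrite -innerZl (le_trans (ri_le _ _)) // nrZ w1 mul1r.
Qed.

Lemma ler_eps (a b K : R) : (forall e, 0 < e -> a <= b + e * K) -> a <= b.
Proof.
move=> h; apply/ler_addgt0Pr => e e0.
have K1 : 0 < `|K| + 1 by rewrite ltr_wpDl.
have := h (e / (`|K| + 1)) (divr_gt0 e0 K1).
move=> /le_trans; apply; rewrite lerD2l -mulrA ger_pMr //.
rewrite mulrC ler_pdivrMr // mul1r (le_trans (ler_norm _)) //; lra.
Qed.

Definition nrcvg (u : nat -> H) x :=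
  forall e : R, 0 < e -> exists n, forall m, (n <= m)%N -> nr (u m - x) < e.

Lemma posC (e : R[i]) : 0 < e -> e = (Re e)%:C /\ 0 < Re e.
Proof. by case: e => a b; rewrite ltcE /= => /andP[/eqP-> ->]. Qed.

Lemma nr_complete (u : nat -> H) :
  (forall e : R, 0 < e ->
    exists n, forall m k, (n <= m)%N -> (n <= k)%N -> nr (u m - u k) < e) ->
  exists x, nrcvg u x.
Proof.
move=> hu; have : cvg (u @ \oo).
  apply/cauchy_cvgP/cauchyP => e /posC[-> e0].
  have [n hn] := hu _ e0; exists (u n); exists n => // m /= nm.
  by rewrite -ball_normE /ball_ /= nrE ltcR hn.
move=> /cvgrPdist_lt hl; exists (lim (u @ \oo)) => e e0.
have [|n _ hn] := hl e%:C; first by rewrite ltcR.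
by exists n => m nm; move: (hn m nm); rewrite nrE ltcR nrBC.
Qed.

Lemma dense_nr (A : set H) : dense A <->
  forall x (e : R), 0 < e -> exists2 y, A y & nr (x - y) < e.
Proof.
split=> [dA x e e0|h O [x Ox] oO].
  have [||y [yx Ay]] := dA (ball x e%:C).
  - by exists x; apply: ballxx; rewrite ltcR.
  - by apply: ball_open; rewrite ltcR.
  by exists y => //; move: yx; rewrite -ball_normE /ball_ /= nrE ltcR.
have /nbhs_ballP[e /= /posC[-> e0] eO] : nbhs x O by exact: open_nbhs_nbhs.
have [y Ay xy] := h x _ e0; exists y; split=> //; apply: eO.
by rewrite -ball_normE /ball_ /= nrE ltcR.
Qed.

Lemma closure_nr2 (A : set (H * H)) p : closure A p ->
  forall e : R, 0 < e ->
  exists2 q, A q & nr (p.1 - q.1) < e /\ nr (p.2 - q.2) < e.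
Proof.
move=> cx e e0.
have [|q [Ay [yx yx']]] := cx (ball p e%:C); first by apply: nbhsx_ballx; rewrite ltcR.
by exists q => //; move: yx yx'; rewrite -!ball_normE /ball_ /= !nrE !ltcR.
Qed.

End InnerProduct.

(** * Linear operators, adjoints and the Riesz representation *)

Section Operators.
Context (R : realType) (H : hilbertSpace R).
Implicit Types (x y z : H) (c : R[i]) (r : R) (a b p q u v : H -> H).

Lemma Re_realM r c : Re (r%:C * c) = r * Re c.
Proof. by case: c => u v /=; rewrite mul0r subr0. Qed.
Lemma ReD c c' : Re (c + c') = Re c + Re c'.
Proof. by rewrite raddfD. Qed.
Lemma linopD a x y : linear a -> a (x + y) = a x + a y.
Proof. by move=> la; rewrite -{1}[x]scale1r la scale1r. Qed.
Lemma linop0 a : linear a -> a 0 = 0.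
Proof. by move=> la; apply: (addrI (a 0)); rewrite -linopD // !addr0. Qed.
Lemma linopZ a c x : linear a -> a (c *: x) = c *: a x.
Proof. by move=> la; rewrite -[c *: x]addr0 la linop0 // addr0. Qed.
Lemma linopN a x : linear a -> a (- x) = - a x.
Proof. by move=> la; rewrite -scaleN1r linopZ // scaleN1r. Qed.
Lemma linopB a x y : linear a -> a (x - y) = a x - a y.
Proof. by move=> la; rewrite linopD // linopN. Qed.

Lemma linop_comp a b : linear a -> linear b -> linear (a \o b).
Proof. by move=> la lb c x y /=; rewrite lb la. Qed.
Lemma linop_add a b : linear a -> linear b -> linear (fun x => a x + b x).
Proof. by move=> la lb c x y /=; rewrite lb la scalerDr addrACA. Qed.
Lemma linop_scale a c : linear a -> linear (fun x => c *: a x).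
Proof.
by move=> la d x y /=; rewrite la scalerDr !scalerA mulrC.
Qed.

Lemma bounded_nr a : bounded_op a ->
  linear a /\ exists2 C : R, 0 < C & forall x, nr (a x) <= C * nr x.
Proof.
move=> [la ca]; split=> //.
have := ca 0; rewrite /continuous_at linop0 // => /cvgrPdist_lt /(_ 1 ltr01).
move=> /nbhs_ballP[e /= /posC[-> e0] he].
exists (2 / Re e); first by rewrite divr_gt0.
move=> x; have [->|x0] := eqVneq x 0; first by rewrite linop0 // nr0 mulr0.
have nx := nr_gt0 x0.
pose t := Re e / (2 * nr x).
have t0 : 0 < t by rewrite divr_gt0 // mulr_gt0.
have /he : ball (0 : H) (Re e)%:C (t%:C *: x).
  rewrite -ball_normE /ball_ /= sub0r normrN nrE ltcR nrZr gtr0_norm //.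
  rewrite /t invfM mulrA divfK ?gt_eqF //; lra.
rewrite /= sub0r normrN nrE linopZ // nrZr gtr0_norm // => /ltW.
rewrite -[1]/(1%:C) lecR -ler_pdivlMl // mulr1 => /le_trans; apply.
by rewrite /t invf_div mulrAC.
Qed.

Lemma nr_bounded a (C : R) :
  linear a -> (forall x, nr (a x) <= C * nr x) -> bounded_op a.
Proof.
move=> la hC; split=> // x; apply/cvgrPdist_lt => e /posC[-> e0].
have C1 : 0 < `|C| + 1 by rewrite ltr_wpDl.
apply/nbhs_ballP; exists (Re e / (`|C| + 1))%:C => /=; first by rewrite ltcR divr_gt0.
move=> y; rewrite -ball_normE /ball_ /= !nrE !ltcR -linopB // ltr_pdivlMr // => h.
apply: le_lt_trans (hC _) _; apply: le_lt_trans h.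
by rewrite mulrC ler_wpM2l ?nr_ge0 // (le_trans (ler_norm _)) // lerDl.
Qed.

Lemma bounded_id : bounded_op (id : H -> H).
Proof. by apply: (@nr_bounded _ 1) => // x; rewrite mul1r. Qed.

Lemma bounded_comp a b : bounded_op a -> bounded_op b -> bounded_op (a \o b).
Proof.
move=> [la ca] [lb cb]; split; first exact: linop_comp.
by move=> x; apply: continuous_comp; [exact: cb|exact: ca].
Qed.

Lemma bounded_add a b : bounded_op a -> bounded_op b ->
  bounded_op (fun x => a x + b x).
Proof.
move=> [la ca] [lb cb]; split; first exact: linop_add.
by move=> x; apply: cvgD; [exact: ca|exact: cb].
Qed.

Lemma bounded_scale a c : bounded_op a -> bounded_op (fun x => c *: a x).
Proof.
move=> /bounded_nr[la [C C0 hC]].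
apply: (@nr_bounded _ (Re `|c| * C)); first exact: linop_scale.
move=> x; rewrite nrZ -mulrA ler_wpM2l //.
by have := normr_ge0 c; rewrite lecE => /andP[].
Qed.

Lemma inner_inj x y : (forall z, '[x | z] = '[y | z]) -> x = y.
Proof.
move=> h; apply/eqP; rewrite -subr_eq0; apply/eqP/nr_eq0/eqP.
by rewrite -sqrf_eq0 nr_sqr /ri innerBl h subrr.
Qed.

Lemma inner_injr x y : (forall z, '[z | x] = '[z | y]) -> x = y.
Proof. by move=> h; apply: inner_inj => z; rewrite innerC h -innerC. Qed.

Lemma adjointC a b : is_adjoint a b -> is_adjoint b a.
Proof. by move=> h x y; rewrite innerC -h -innerC. Qed.

Lemma adjoint_uniq a b b' : is_adjoint a b -> is_adjoint a b' -> b = b'.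
Proof.
by move=> h h'; apply/funext => y; apply: inner_injr => x; rewrite -h h'.
Qed.

Lemma adjoint_comp a a' b b' : is_adjoint a a' -> is_adjoint b b' ->
  is_adjoint (a \o b) (b' \o a').
Proof. by move=> ha hb x y /=; rewrite ha hb. Qed.

Lemma adjoint_linear a b : is_adjoint a b -> linear b.
Proof.
move=> h c x y; apply: inner_injr => z.
by rewrite -h !(innerDr, innerZr) !h.
Qed.

Lemma adjoint_bounded a b : bounded_op a -> is_adjoint a b -> bounded_op b.
Proof.
move=> /bounded_nr[la [C C0 hC]] h.
apply: (@nr_bounded _ C); first exact: adjoint_linear h.
move=> x; have [->|x0] := eqVneq (b x) 0; first by rewrite nr0 mulr_ge0 ?nr_ge0 ?ltW.
rewrite -(ler_pM2l (nr_gt0 x0)) -expr2 nr_sqr /ri -h.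
apply: le_trans (ri_le _ _) _.
apply: le_trans (ler_wpM2r (nr_ge0 _) (hC _)) _.
by rewrite mulrCA mulrA.
Qed.

(** Complex polarisation: the form of a - b vanishes at x + y and at x + i y, which kills the sum
    and the difference of the two cross terms. Operator identities are deduced in this way from
    identities between spectral measures. *)
Lemma op_eq a b : linear a -> linear b ->
  (forall x, '[a x | x] = '[b x | x]) -> a = b.
Proof.
move=> la lb h; apply/funext => x; apply: inner_inj => y.
have h1 : forall z, '[a z - b z | z] = 0 by move=> z; rewrite innerBl h subrr.
pose t z := a z - b z.
have lt : linear t.
  by move=> c z z'; rewrite /t la lb scalerBr opprD addrACA.
have e1 : '[t x | y] + '[t y | x] = 0.
  have := h1 (x + y); rewrite -/(t _) linopD // innerDl !innerDr.
  by rewrite (h1 x) (h1 y) add0r addr0.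
have e2 : - 'i%C * '[t x | y] + 'i%C * '[t y | x] = 0.
  have := h1 (x + 'i%C *: y); rewrite -/(t _) linopD // linopZ // innerDl !innerDr.
  rewrite !innerZl !innerZr (h1 x) (h1 y) !mulr0 add0r addr0.
  by move <-; congr (_ * _ + _); apply/eqP; rewrite eq_complex /= oppr0 !eqxx.
have i0 : 'i%C != 0 :> R[i] by rewrite eq_complex /= oner_eq0 andbF.
have e3 : '[t x | y] = '[t y | x].
  by apply: (mulfI i0); apply/eqP; rewrite eq_sym -subr_eq0 addrC -mulNr e2.
apply/eqP; rewrite -subr_eq0 -innerBl -/(t x).
move/eqP: e1; rewrite -e3 -mulr2n mulrn_eq0 /=.
by [].
Qed.

(* Minimise |w|^2 - 2 Re c over the pairs (w, c) of G. *)
Lemma riesz_graph (G : H -> R[i] -> Prop) (C : R) :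
  G 0 0 ->
  (forall d w c w' c', G w c -> G w' c' -> G (d *: w + w') (d * c + c')) ->
  (forall w c, G w c -> Re `|c| <= C * nr w) ->
  exists x, forall w c, G w c -> c = '[w | x].
Proof.
move=> G0 Glin GC.
pose J (w : H) c : R := nr w ^+ 2 - 2 * Re c.
pose A : set R := [set s | exists w c, G w c /\ s = J w c].
have Re_le c : Re c <= Re `|c|.
  by have := normc_ge_Re c; rewrite lecE /= => /andP[_]; apply: le_trans; exact: ler_norm.
have Alb : has_lbound A.
  exists (- C ^+ 2) => _ [w [c [Gw ->]]].
  have := GC _ _ Gw; have := Re_le c; have := sqr_ge0 (nr w - C).
  rewrite /J; nra.
have A0 : A !=set0 by exists (J 0 0), 0, 0.
have Ainf : has_inf A by [].
have Jge w c : G w c -> inf A <= J w c.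
  by move=> Gw; apply: ge_inf => //; exists w, c.
have Jex (n : nat) : exists wc : H * R[i], G wc.1 wc.2 /\ J wc.1 wc.2 < inf A + n.+1%:R^-1.
  have [] := @inf_adherent _ A n.+1%:R^-1 _ Ainf; first by rewrite invr_gt0.
  by move=> _ [w [c [Gw ->]]] hs; exists (w, c).
have {Jex} [wc hwc] := choice Jex.
pose w n := (wc n).1.
(* Parallelogram identity: the midpoint of two approximate minimisers is again in G, so its J is at
   least the infimum, and this forces the two to be close. *)
have Jmid n m : nr (w n - w m) ^+ 2 <= 2 * (n.+1%:R^-1 + m.+1%:R^-1).
  have [Gn Jn] := hwc n; have [Gm Jm] := hwc m.
  have := Glin (2^-1)%:C _ _ _ _ Gn (Glin ((2^-1)%:C) _ _ _ _ Gm G0).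
  move=> /Jge; rewrite /J !addr0 !ReD !Re_realM.
  rewrite -/(w n) -/(w m) nr_sqrB nr_sqrD riZl riZr !nrZr !exprMn.
  rewrite (@ger0_norm _ (2^-1)) ?invr_ge0 //.
  move: Jn Jm; rewrite /J -/(w n) -/(w m).
  set r1 := n.+1%:R^-1; set r2 := m.+1%:R^-1; set i := inf A.
  have -> : (2^-1 : R) ^+ 2 = 4^-1 by field.
  lra.
have harm (e : R) : 0 < e -> exists n, forall m, (n <= m)%N -> m.+1%:R^-1 < e.
  move=> e0; have [n _ hn] := near_infty_natSinv_lt (PosNum e0).
  by exists n => m nm; exact: hn.
have [x hx] : exists x, nrcvg w x.
  apply: nr_complete => e e0.
  have [|n hn] := harm (e ^+ 2 / 4); first by rewrite divr_gt0 // exprn_gt0.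
  exists n => m k nm nk.
  rewrite -(ltr_pXn2r (n:=2)) // ?nnegrE ?nr_ge0 // ?ltW //.
  have := Jmid m k; have := hn _ nm; have := hn _ nk.
  set r1 := m.+1%:R^-1; set r2 := k.+1%:R^-1; set r3 := nr _ ^+ 2.
  lra.
(* First variation: J at w k + t v is at least inf J, hence at least J (w k) minus 1 / (k + 1); in
   the limit 2 t (ri x v - Re d) + t^2 |v|^2 is nonnegative for all t. *)
have key (v : H) d : G v d -> ri x v = Re d.
  move=> Gv; apply/eqP; rewrite -subr_eq0; apply/eqP.
  apply: (@quadratic_ge0_eq0 _ _ (nr v ^+ 2)); first exact: sqr_ge0.
  move=> t; rewrite -[leRHS]addr0.
  apply: (@ler_eps _ _ _ (1 + 2 * `|t| * nr v)) => e e0.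
  have [n hn] := hx _ e0; have [m hm] := harm _ e0.
  pose k := maxn n m.
  have [Gk Jk] := hwc k.
  have hk : nr (w k - x) < e by apply: hn; rewrite leq_maxl.
  have hk' : k.+1%:R^-1 < e by apply: hm; rewrite leq_maxr.
  have := Jge _ _ (Glin t%:C _ _ _ _ Gv Gk).
  rewrite /J !ReD Re_realM nr_sqrD riZl nrZr exprMn real_normK ?num_real //.
  move: Jk; rewrite /J -/(w k) => Jk Jk'.
  have : t * ri v (w k - x) <= `|t| * nr v * e.
    apply: le_trans (ler_norm _) _; rewrite normrM -mulrA ler_wpM2l //.
    apply: le_trans (ri_le_norm _ _) _; rewrite ler_wpM2l ?nr_ge0 //; exact: ltW.
  rewrite riBr (riC x); set s := k.+1%:R^-1 in Jk hk'.
  move=> h3; rewrite addr0; lra.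
exists x => v d Gv.
rewrite inner_ri riC (key _ _ Gv).
(* The pair multiplied by i yields the imaginary part. *)
have := Glin 'i%C _ _ _ _ Gv G0; rewrite !addr0 => /key; rewrite riC => ->.
by rewrite mulrC ReiNIm opprK; case: d {Gv}.
Qed.

Lemma adjoint_exists a : bounded_op a -> exists2 b, is_adjoint a b & bounded_op b.
Proof.
move=> ba; have [la [C C0 hC]] := bounded_nr ba.
have : forall y, exists z, forall x, '[a x | y] = '[x | z].
  move=> y.
  have [| | |z hz] := @riesz_graph (fun w c => c = '[a w | y]) (C * nr y).
  - by rewrite linop0 // inner0l.
  - by move=> d w _ w' _ -> ->; rewrite la innerDl innerZl.
  - move=> w _ ->; apply: le_trans (inner_le _ _) _.
    by rewrite mulrAC ler_wpM2r ?nr_ge0.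
  - by exists z => x; exact: hz.
move=> /choice[b hb]; exists b; first by move=> x y; exact: hb.
by apply: adjoint_bounded ba _ => x y; exact: hb.
Qed.

End Operators.

(** * The Cayley transform and operator monotonicity of the square root *)

Section Cayley.
Context (R : realType) (H : hilbertSpace R).
Implicit Types (x y z : H) (c : R[i]) (r : R) (a b p q u v : H -> H).

Lemma conj_i : ('i%C : R[i])^*%C = - 'i%C.
Proof. by apply/eqP; rewrite eq_complex /= oppr0 !eqxx. Qed.
Lemma conj_Ni : (- 'i%C : R[i])^*%C = - - 'i%C.
Proof. by apply/eqP; rewrite eq_complex /= !oppr0 !eqxx. Qed.
Lemma i_neq0 : 'i%C != 0 :> R[i].
Proof. by rewrite eq_complex /= oner_eq0 andbF. Qed.

Lemma selfadj_inner_real a x : is_adjoint a a -> '[a x | x] = (ri (a x) x)%:C.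
Proof.
by move=> sa; rewrite /ri; have := sa x x; rewrite innerC; case: '[x | a x] => s t /= [] h; apply/eqP; rewrite eq_complex /= eqxx /=; apply/eqP; lra.
Qed.

(** As a is self-adjoint, the cross term is a purely imaginary number times a real one, so its real
    part vanishes; in particular 1 + c a is bounded below by 1. *)
Lemma nr_sqr_imag a c x : is_adjoint a a -> c^*%C = - c -> `|c| = 1 ->
  nr (x + c *: a x) ^+ 2 = nr x ^+ 2 + nr (a x) ^+ 2.
Proof.
move=> sa cc c1; rewrite nr_sqrD nrZ c1 mul1r.
have -> : ri x (c *: a x) = 0; last by rewrite mulr0 addr0.
rewrite riC /ri innerZl selfadj_inner_real //.
by case: c cc {c1} => s t [] h /=; rewrite mulr0 subr0 (_ : s = 0) ?mul0r //; lra.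
Qed.

(** The adjoint 1 - c a of 1 + c a is bounded below by 1, so (1 - c a) z -> <z, y> is a bounded
    functional on its range; the vector that represents it solves x + c a x = y. Injectivity is the
    same bound for 1 + c a. *)
Lemma selfadj_resolvent a c : bounded_op a -> is_adjoint a a ->
  c^*%C = - c -> `|c| = 1 ->
  exists w, (forall y, w y + c *: a (w y) = y) /\ (forall x, w (x + c *: a x) = x).
Proof.
move=> ba sa cc c1; have [la _] := ba.
have cc' : (- c)^*%C = - - c by rewrite rmorphN /= cc.
have c1' : `|- c| = 1 by rewrite normrN.
have surj y : exists x, x + c *: a x = y.
  have [| | |x hx] := @riesz_graph _ _
      (fun (v : H) d => exists z, v = z + (- c) *: a z /\ d = '[z | y]) (nr y).
  - by exists 0; rewrite linop0 // scaler0 addr0 inner0l.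
  - move=> d v e v' e' [z [-> ->]] [z' [-> ->]]; exists (d *: z + z').
    split; last by rewrite innerDl innerZl.
    by rewrite la !scalerDr !scalerA (mulrC d) addrACA.
  - move=> v d [z [-> ->]]; apply: le_trans (inner_le _ _) _.
    rewrite mulrC ler_wpM2l ?nr_ge0 // -(ler_pXn2r (n:=2)) ?nnegrE ?nr_ge0 //.
    by rewrite nr_sqr_imag // lerDl sqr_ge0.
  - exists x; apply: inner_injr => z.
    rewrite (hx (z + (- c) *: a z) '[z | y]); last by exists z.
    by rewrite innerDl innerDr innerZl innerZr cc sa.
have [w hw] := choice surj; exists w; split=> // x.
apply/eqP; rewrite -subr_eq0; apply/eqP/nr_eq0/eqP; rewrite -sqrf_eq0.
have := nr_sqr_imag (w (x + c *: a x) - x) sa cc c1.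
rewrite linopB // scalerBr addrACA -opprD hw subrr nr0 expr0n /=.
have := sqr_ge0 (nr (w (x + c *: a x) - x)).
have := sqr_ge0 (nr (a (w (x + c *: a x)) - a x)).
by move=> *; apply/eqP; lra.
Qed.

Lemma resolvent_linear a c w : linear a ->
  (forall y, w y + c *: a (w y) = y) -> (forall x, w (x + c *: a x) = x) ->
  linear w.
Proof.
move=> la h1 h2 d x y; rewrite -{1}(h1 x) -{1}(h1 y) -[RHS]h2; congr (w _).
by rewrite la !scalerDr !scalerA (mulrC d) addrACA.
Qed.

(* The Cayley transform of a self-adjoint element of the commutant is a
   unitary of the commutant, from which the element can be recovered. *)
Lemma comm_selfadj (S : set (H -> H)) T a : S `<=` @bounded_op R H -> linear T ->
  (forall u, commutant S u -> unitary u -> forall x, T (u x) = u (T x)) ->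
  commutant S a -> is_adjoint a a -> forall x, T (a x) = a (T x).
Proof.
move=> Sb lT hT [ba ca] sa; have [la _] := ba.
have n1 : `|'i%C : R[i]| = 1 by rewrite normc_def /= expr0n expr1n add0r sqrtr1.
have c1 := conj_Ni.
have [w [w1 w2]] := selfadj_resolvent ba sa conj_i n1.
have [|w' [w1' w2']] := selfadj_resolvent ba sa c1; first by rewrite normrN.
have lw := resolvent_linear la w1 w2.
have lw' := resolvent_linear la w1' w2'.
have aw : is_adjoint w w'.
  move=> x y; rewrite -{2}(w1 x) -{1}(w1' y).
  by rewrite innerDl innerDr innerZl innerZr c1 opprK sa.
have bw : bounded_op w.
  apply: (@nr_bounded _ _ _ 1) => // x; rewrite mul1r.
  rewrite -(ler_pXn2r (n:=2)) ?nnegrE ?nr_ge0 // -{2}(w1 x) nr_sqr_imag //.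
    by rewrite lerDl sqr_ge0.
  exact: conj_i.
(* u = 2 w - 1 = (1 - i a) (1 + i a)^-1 is the Cayley transform of a, and v is built alike with - i
   for i. *)
pose u x := 2%:R *: w x + (-1) *: x.
pose v x := 2%:R *: w' x + (-1) *: x.
have ue x : u x = w x - 'i%C *: a (w x).
  rewrite /u -{2}(w1 x) scalerDr !scaleN1r addrA; congr (_ - _).
  by rewrite scaler_nat mulr2n addrK.
have ve x : v x = w' x + 'i%C *: a (w' x).
  rewrite /v -{2}(w1' x) scalerDr !scaleN1r addrA scaleNr opprK; congr (_ + _).
  by rewrite scaler_nat mulr2n addrK.
have bu : bounded_op u.
  by apply: bounded_add; [exact: bounded_scale|apply: bounded_scale; exact: bounded_id].
have uu : unitary u.
  split=> //; exists v; split.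
  - move=> x y; rewrite /u /v innerDl innerDr !innerZl !innerZr aw.
    by rewrite rmorph_nat rmorphN1.
  - apply/funext => x /=; rewrite ue ve w2.
    by have := w1' x; rewrite scaleNr.
  - by apply/funext => x /=; rewrite ve ue -scaleNr w2' w1.
have uS : commutant S u.
  split=> // b Sb'; have [lb _] := Sb _ Sb'.
  have ab := ca _ Sb'.
  have wb x : w (b x) = b (w x).
    rewrite -{1}(w1 x) linopD // linopZ //.
    by have /= <- := congr1 (fun g => g (w x)) ab; rewrite w2.
  by apply/funext => x /=; rewrite /u wb (linopD _ _ lb) !(linopZ _ _ lb).
have Tw x : T (w x) = w (T x).
  have := hT _ uS uu x; rewrite /u (linopD _ _ lT) !(linopZ _ _ lT) => /addIr.
  by move/(scalerI _); apply; rewrite pnatr_eq0.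
(* Commuting with w means commuting with its inverse 1 + i a, from which i a and then a are peeled
   off. *)
move=> x; have := congr1 (fun y => y + 'i%C *: a y) (Tw (x + 'i%C *: a x)).
rewrite w2 w1 (linopD _ _ lT) (linopZ _ _ lT) => /addrI /(scalerI _) h.
by rewrite h // i_neq0.
Qed.

(** Splits a into the self-adjoint operators a + b and i (a - b), where b is its adjoint; b lies in
    the commutant because S is closed under adjoints. *)
Lemma comm_commutant (S : set (H -> H)) T : S `<=` @bounded_op R H ->
  (forall a, S a -> exists2 b, is_adjoint a b & S b) -> linear T ->
  (forall u, commutant S u -> unitary u -> forall x, T (u x) = u (T x)) ->
  forall a, commutant S a -> forall x, T (a x) = a (T x).
Proof.
move=> Sb Sadj lT hT a [ba ca] x.
have [b ab bb] := adjoint_exists ba.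
have cb s : S s -> b \o s = s \o b.
  move=> Ss; have [s' ss' Ss'] := Sadj _ Ss.
  apply: (@adjoint_uniq _ _ (s' \o a)); last first.
    by rewrite -ca //; apply: adjoint_comp => //; exact: adjointC.
  by apply: adjoint_comp => //; exact: adjointC.
have comb c d : commutant S (fun y => c *: a y + d *: b y).
  split; first by apply: bounded_add; exact: bounded_scale.
  move=> s Ss; apply/funext => y /=.
  have [ls _] := Sb _ Ss; rewrite (linopD _ _ ls) !(linopZ _ _ ls).
  have /= -> := congr1 (fun g => g y) (ca _ Ss).
  by have /= -> := congr1 (fun g => g y) (cb _ Ss).
have la := bb.1; have lb := ba.1.
have h1 := comm_selfadj Sb lT hT (comb 1 1) _ x.
have h2 := comm_selfadj Sb lT hT (comb 'i%C (- 'i%C)) _ x.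
have {}h1 : T (a x) + T (b x) = a (T x) + b (T x).
  have := h1; rewrite !scale1r (linopD _ _ lT); apply => y z.
  by rewrite !scale1r innerDl innerDr ab (adjointC ab) addrC.
have {}h2 : T (a x) - T (b x) = a (T x) - b (T x).
  apply: (scalerI i_neq0); rewrite !scalerBr -!scaleNr -!(linopZ _ _ lT) -(linopD _ _ lT).
  apply: h2 => y z.
  rewrite innerDl innerDr !innerZl !innerZr ab (adjointC ab) addrC.
  by rewrite conj_Ni conj_i opprK.
apply: (scalerI (_ : 2%:R != 0)); first by rewrite pnatr_eq0.
rewrite !scaler_nat !mulr2n.
have := congr2 +%R h1 h2; rewrite addrACA subrr addr0 => ->.
by rewrite addrACA subrr addr0.
Qed.

End Cayley.

Section OpMono.
Context (R : realType) (H : hilbertSpace R).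
Implicit Types (x y z : H) (c : R[i]) (r : R) (a b p q u v : H -> H).

Lemma positive_ri p x : positive_op p -> '[p x | x] = (ri (p x) x)%:C.
Proof. by move=> [_ /(_ x) h]; rewrite /ri RRe_real // ger0_real. Qed.

Lemma positive_ri_ge0 p x : positive_op p -> 0 <= ri (p x) x.
Proof. by move=> pp; have [_ /(_ x)] := pp; rewrite (positive_ri _ pp) ler0c. Qed.

Lemma positive_selfadj p : positive_op p -> is_adjoint p p.
Proof.
move=> pp; have [bp _] := pp; have [q pq bq] := adjoint_exists bp.
have e : p = q; last by move: pq; rewrite -e.
apply: op_eq; [exact: bp.1|exact: bq.1|move=> x].
by rewrite [RHS](adjointC pq) [RHS]innerC positive_ri // conjc_real.
Qed.

Lemma op_leP p q : positive_op p -> positive_op q ->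
  op_le p q <-> forall x, ri (p x) x <= ri (q x) x.
Proof.
by move=> pp qq; split=> h x; have := h x; rewrite !positive_ri // lecR.
Qed.

Lemma positive_op_eq p q : positive_op p -> positive_op q ->
  (forall x, ri (p x) x = ri (q x) x) -> p = q.
Proof.
move=> pp qq h; apply: op_eq; [exact: pp.1.1|exact: qq.1.1|move=> x].
by rewrite !positive_ri // h.
Qed.

(* If S = b - p were not positive, let m < 0 be the infimum of its quadratic
   form on the unit sphere; near-minimisers x satisfy S x ~ m x, and
   |b x|^2 - |p x|^2 = Re <S x | (b + p) x> ~ m <x | (b + p) x> <= - m^2 < 0. *)
Lemma op_monotone_sqrt p b : positive_op p -> positive_op b ->
  (forall x, nr (p x) <= nr (b x)) -> op_le p b.
Proof.
move=> pp pb hpb; apply/op_leP => // x0; rewrite leNgt; apply/negP => hx0.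
have [lp [K1 K10 hK1]] := bounded_nr pp.1.
have [lb [K2 K20 hK2]] := bounded_nr pb.1.
have sp := positive_selfadj pp; have sb := positive_selfadj pb.
pose S x := b x - p x.
have rS x : ri (S x) x = ri (b x) x - ri (p x) x by rewrite riBl.
pose L := K1 + K2.
have L0 : 0 < L by rewrite addr_gt0.
have hS x : nr (S x) <= L * nr x.
  apply: le_trans (nrD _ _) _; rewrite nrN /L.
  by have := hK1 x; have := hK2 x; lra.
pose A : set R := [set s | exists x, nr x = 1 /\ s = ri (S x) x].
have Alb : has_lbound A.
  exists (- L) => _ [x [x1 ->]].
  have := ri_le_norm (S x) x; have := hS x; rewrite x1 !mulr1 => h1 h2.
  by have := ler_norml (ri (S x) x) (nr (S x)); rewrite h2 => /esym/andP[]; lra.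
have x00 : x0 != 0.
  by apply: contraTneq hx0 => ->; rewrite !linop0 // ri0l ltxx.
have nx0 := nr_gt0 x00.
have unitA x : x != 0 -> A ((nr x)^-1 ^+ 2 * ri (S x) x).
  move=> x'; exists ((nr x)^-1%:C *: x); split.
    by rewrite nrZr gtr0_norm ?invr_gt0 ?nr_gt0 // mulVf // gt_eqF // nr_gt0.
  by rewrite !rS !linopZ // !riZl !riZr; ring.
have A0 : A !=set0 by exists ((nr x0)^-1 ^+ 2 * ri (S x0) x0); exact: unitA.
have Ainf : has_inf A by [].
pose m := inf A.
have m0 : m < 0.
  apply: le_lt_trans (ge_inf Alb (unitA _ x00)) _.
  by rewrite nmulr_llt0 ?rS ?subr_lt0 // exprn_gt0 // invr_gt0.
pose T x := S x - m%:C *: x.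
have Tx x : ri (T x) x = ri (S x) x - m * nr x ^+ 2.
  by rewrite riBl riZl nr_sqr.
have Tpos x : 0 <= ri (T x) x.
  have [->|x'] := eqVneq x 0; first by rewrite ri0r.
  rewrite Tx subr_ge0.
  have n0 : 0 < nr x ^+ 2 by rewrite exprn_gt0 // nr_gt0.
  have := ge_inf Alb (unitA _ x').
  by rewrite exprVn mulrC ler_pdivlMr.
pose K := L - m.
have K0 : 0 < K by rewrite /K; lra.
have hT x : nr (T x) <= K * nr x.
  apply: le_trans (nrD _ _) _; rewrite nrN nrZr ltr0_norm // /K.
  by have := hS x; lra.
have sT x y : ri (T x) y = ri x (T y).
  rewrite /T /S !riBl !riBr riZl riZr; congr (_ - _ - _).
    by rewrite /ri sb.
  by rewrite /ri sp.
have lT x y t : T (x - t%:C *: y) = T x - t%:C *: T y.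
  have lT' : linear T.
    have l0 : linear (fun z => b z + (-1) *: p z + (- m%:C) *: z).
      by apply: linop_add; [apply: linop_add => //|]; exact: linop_scale.
    by move=> c z z'; have := l0 c z z'; rewrite !scaleN1r !scaleNr.
  by rewrite linopB // linopZ.
(* Cauchy-Schwarz for the positive form of T, in the guise of 0 <= <T z, z> at z = x - T x / K: a
   small form value forces T x to be small. *)
have TT x : nr (T x) ^+ 2 <= K * ri (T x) x.
  have := Tpos (x - (K^-1)%:C *: T x).
  rewrite lT riBl !riBr !riZl !riZr -nr_sqr (sT (T x) x) -nr_sqr.
  have : ri (T (T x)) (T x) <= K * nr (T x) ^+ 2.
    apply: le_trans (ri_le _ _) _.
    by rewrite expr2 mulrA ler_wpM2r ?nr_ge0.
  set s := ri _ _; set n := nr _ ^+ 2; set q := ri (T x) x => h1 h2.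
  have : K^-1 * (K^-1 * s) <= K^-1 * n.
    by rewrite ler_pM2l ?invr_gt0 // mulrC ler_pdivrMr // mulrC.
  move=> h3; have : K^-1 * n <= q by lra.
  by rewrite mulrC ler_pdivrMr // mulrC.
have fin x : nr x = 1 -> ri (T x) x < - m / 2 -> nr (T x) * L < m ^+ 2 / 2 -> False.
  move=> x1 h1 h2.
  have e1 : 0 <= nr (b x) ^+ 2 - nr (p x) ^+ 2.
    by rewrite subr_ge0 ler_pXn2r ?nnegrE ?nr_ge0.
  have : nr (b x) ^+ 2 - nr (p x) ^+ 2 = ri (S x) (b x + p x).
    by rewrite !nr_sqr riBl !riDr (riC (p x) (b x)); ring.
  have -> : S x = m%:C *: x + T x by rewrite /T addrC subrK.
  rewrite riDl riZl.
  have : ri (T x) (b x + p x) <= nr (T x) * L.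
    apply: le_trans (ri_le _ _) _; rewrite ler_wpM2l ?nr_ge0 //.
    apply: le_trans (nrD _ _) _; rewrite /L.
    by have := hK1 x; have := hK2 x; rewrite x1; lra.
  have : - ri (S x) x <= ri x (b x + p x).
    rewrite rS riDr (riC x (b x)) (riC x (p x)).
    by have := positive_ri_ge0 x pb; have := positive_ri_ge0 x pp; lra.
  have := Tx x; rewrite x1 expr1n mulr1.
  move: h1 h2 e1; set t := nr (T x) * L; set n := _ - _.
  set q := ri x _; set w := ri _ (b x + p x).
  move=> h1 h2 e1 h3 h4 h5 h6.
  have : 0 < (q + m / 2) * (- m) by rewrite mulr_gt0 //; lra.
  by lra.
(* The two bounds feed the hypotheses of [fin]; through [TT] the second one becomes |T x| < m^2 / (2
   L). *)
have e0 : 0 < Num.min (- m / 2) ((m ^+ 2 / 2 / L) ^+ 2 / K).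
  rewrite lt_min; apply/andP; split; first by lra.
  by rewrite divr_gt0 // exprn_gt0 // divr_gt0 // divr_gt0 // exprn_even_gt0 //= lt_eqF.
have [_ [x [x1 ->]] hx] := inf_adherent e0 Ainf.
have : ri (T x) x < Num.min (- m / 2) ((m ^+ 2 / 2 / L) ^+ 2 / K).
  by rewrite Tx x1 expr1n mulr1 ltrBlDl.
rewrite lt_min => /andP[g1 g2]; apply: (fin x) => //.
rewrite -ltr_pdivlMr // -(ltr_pXn2r (n:=2)) ?nnegrE ?nr_ge0 //; last first.
  by rewrite divr_ge0 ?(ltW L0) // divr_ge0 // sqr_ge0.
apply: le_lt_trans (TT x) _.
by rewrite mulrC -ltr_pdivlMr.
Qed.

End OpMono.

(** * Spectral measures and spectral integrals *)

Section Pvm.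
Context (R : realType) (H : hilbertSpace R) (E : pvm H).
Local Notation T := (measurableTypeR R).
Implicit Types (x y z : H) (c w : R[i]) (A B : set T) (g : R -> R[i]).

Lemma pvm_lin A : measurable A -> linear (E A).
Proof. by move=> /(pvm_proj E)[[]]. Qed.

Lemma pvm_bounded A : measurable A -> bounded_op (E A).
Proof. by move=> /(pvm_proj E)[]. Qed.

Lemma pvmK A x : measurable A -> E A (E A x) = E A x.
Proof. by move=> /(pvm_proj E)[_ h _]; have /= := congr1 (@^~ x) h. Qed.

Lemma pvm_adj A : measurable A -> is_adjoint (E A) (E A).
Proof. by move=> /(pvm_proj E)[]. Qed.

Lemma pvmI A B x : measurable A -> measurable B -> E (A `&` B) x = E A (E B x).
Proof. by move=> mA mB; rewrite pvm_setI. Qed.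

Lemma pvm_comm A B x : measurable A -> measurable B -> E A (E B x) = E B (E A x).
Proof. by move=> mA mB; rewrite -!pvmI // setIC. Qed.

Lemma pvm_atE x A : pvm_at E x A = (nr (E A x) ^+ 2)%:E.
Proof. by []. Qed.

Lemma pvm_nr A x : measurable A -> nr (E A x) ^+ 2 = ri (E A x) x.
Proof. by move=> mA; rewrite nr_sqr /ri pvm_adj // pvmK // -pvm_adj. Qed.

Lemma pvm_nr_le A x : measurable A -> nr (E A x) <= nr x.
Proof.
move=> mA; have [->|h] := eqVneq (E A x) 0; first by rewrite nr0 nr_ge0.
rewrite -(ler_pM2l (nr_gt0 h)) -expr2 pvm_nr //; exact: ri_le.
Qed.

Lemma pvm0 A : measurable A -> E A 0 = 0.
Proof. by move=> /pvm_lin/linop0. Qed.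

Lemma pvmD A x y : measurable A -> E A (x + y) = E A x + E A y.
Proof. by move=> /pvm_lin/linopD. Qed.

Lemma pvmB A x y : measurable A -> E A (x - y) = E A x - E A y.
Proof. by move=> /pvm_lin/linopB. Qed.

Lemma pvmZ A c x : measurable A -> E A (c *: x) = c *: E A x.
Proof. by move=> /pvm_lin/linopZ. Qed.

(** The record states additivity only for the measures |E A x|^2; equality of quadratic forms
    promotes it to the operators. *)
Lemma pvmU A B x : measurable A -> measurable B -> [disjoint A & B] ->
  E (A `|` B) x = E A x + E B x.
Proof.
move=> mA mB AB; have mAB := measurableU _ _ mA mB.
suff : E (A `|` B) = (fun x => E A x + E B x) by move=> ->.
apply: op_eq => [||{}x]; first exact: pvm_lin.
  by apply: linop_add; exact: pvm_lin.
have : (pvm_at E x (A `|` B) = pvm_at E x A + pvm_at E x B)%E.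
  by apply: measureU => //; apply/eqP; rewrite -disj_set2E.
rewrite !pvm_atE => -[].
rewrite !pvm_nr // => e.
have sp C : measurable C -> '[E C x | x] = (ri (E C x) x)%:C.
  by move=> mC; apply: selfadj_inner_real; exact: pvm_adj.
by rewrite innerDl !sp // e rmorphD.
Qed.

Lemma pvmC A x : measurable A -> E (~` A) x = x - E A x.
Proof.
move=> mA; have := @pvmU A (~` A) x mA (measurableC mA).
rewrite setUv pvm_setT disj_set2E setICr eqxx => /(_ isT) e.
by apply/eqP; rewrite eq_sym subr_eq addrC; apply/eqP.
Qed.

Lemma pvm_subI A B x : measurable A -> measurable B -> A `<=` B ->
  E B (E A x) = E A x.
Proof. by move=> mA mB AB; rewrite -pvmI // setIidr. Qed.

Lemma pvm_disj A B x : measurable A -> measurable B -> A `&` B = set0 ->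
  E A (E B x) = 0.
Proof. by move=> mA mB AB; rewrite -pvmI // AB pvm_set0. Qed.

Lemma pvm_at_fin x : fin_num_fun (pvm_at E x).
Proof. by move=> A mA; rewrite pvm_atE. Qed.

Lemma pvm_at_restr A B x y : measurable A -> measurable B -> B `<=` A ->
  E A x = E A y -> pvm_at E x B = pvm_at E y B.
Proof.
move=> mA mB BA e; rewrite !pvm_atE.
have h z : E B z = E B (E A z) by rewrite -pvmI // setIidl.
by rewrite (h x) (h y) e.
Qed.

Lemma pvm_atZ c x A : measurable A -> `|c| = 1 ->
  pvm_at E (c *: x) A = pvm_at E x A.
Proof. by move=> mA c1; rewrite !pvm_atE pvmZ // nrZ c1 mul1r. Qed.

Lemma pvm_at_bound x A : measurable A -> (pvm_at E x A < +oo)%E.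
Proof. by move=> mA; rewrite pvm_atE ltry. Qed.

End Pvm.

HB.instance Definition _ (R : realType) (H : hilbertSpace R) (E : pvm H) (x : H) :=
  @Measure_isFinite.Build _ (measurableTypeR R) R (pvm_at E x) (pvm_at_fin E x).

(** * The domain of a spectral integral and integrability on it *)

Section SquareInt.
Context (R : realType) (H : hilbertSpace R) (E : pvm H).
Local Notation T := (measurableTypeR R).
Implicit Types (x y z : H) (c w : R[i]) (A B : set T).

Definition measurable_cfun (g : R -> R[i]) : Prop :=
  measurable_fun [set: T] ((@complex.Re R \o g) : T -> R) /\
  measurable_fun [set: T] ((@complex.Im R \o g) : T -> R).

Context (g : R -> R[i]) (mg : measurable_cfun g).

Let sq t : R := (Re `|g t|) ^+ 2.

Lemma sq_normE t : sq t = Re (g t) ^+ 2 + Im (g t) ^+ 2.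
Proof.
rewrite /sq normc_def /= sqr_sqrtr //; by rewrite addr_ge0 ?sqr_ge0.
Qed.

Lemma measurable_sq_norm : measurable_fun [set: T] (fun t : T => (Re `|g t| ^+ 2)%:E).
Proof.
apply/measurable_EFinP; rewrite (_ : (fun t : T => Re `|g t| ^+ 2) = fun t : T => (Re (g t) ^+ 2 + Im (g t) ^+ 2)).
  by apply: measurable_funD; apply: measurable_funX; case: mg.
by apply/funext => t; rewrite -sq_normE.
Qed.

Lemma square_int_meas x y :
  (forall A, measurable A -> (pvm_at E x A = pvm_at E y A)%E) ->
  square_int E g x -> square_int E g y.
Proof.
move=> h; rewrite /square_int (eq_measure_integral (pvm_at E y)) //.
by move=> A mA _; exact: h.
Qed.

Lemma square_intZ c x : `|c| = 1 -> square_int E g x -> square_int E g (c *: x).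
Proof.
move=> c1; apply: square_int_meas => A mA; apply/esym; exact: pvm_atZ.
Qed.

(** The integral for x is at most the one for the sum of two measures, and that sum is rearranged:
    by Pythagoras for E A x and its complement, or by the parallelogram identity for x + y. *)
Lemma square_int_le x y x' y' :
  (forall A, measurable A ->
    (pvm_at E x A + pvm_at E y A = pvm_at E x' A + pvm_at E y' A)%E) ->
  square_int E g x' -> square_int E g y' -> square_int E g x.
Proof.
rewrite /square_int => h sx' sy'.
have sq0 (t : T) : setT t -> (0 <= (sq t)%:E)%E by rewrite lee_fin sqr_ge0.
have := ge0_integral_measure_add (pvm_at E x) (pvm_at E y) measurableT sq0 measurable_sq_norm.
have -> : (\int[measure_add (pvm_at E x) (pvm_at E y)]_(t in [set: T]) (sq t)%:E =
    \int[measure_add (pvm_at E x') (pvm_at E y')]_(t in [set: T]) (sq t)%:E)%E.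
  apply: eq_measure_integral => A mA _.
  by rewrite [LHS]measure_addE [RHS]measure_addE; exact: h.
rewrite (ge0_integral_measure_add (pvm_at E x') (pvm_at E y') measurableT sq0 measurable_sq_norm).
move=> e; apply: (@le_lt_trans _ _ (\int[pvm_at E x]_t (sq t)%:E + \int[pvm_at E y]_t (sq t)%:E)%E).
  by rewrite leeDl // integral_ge0.
by rewrite -e lte_add_pinfty.
Qed.

Lemma square_int_pvm A x : measurable A -> square_int E g x ->
  square_int E g (E A x).
Proof.
move=> mA sx; apply: (@square_int_le _ (E (~` A) x) x 0) => //.
- move=> B mB; rewrite !pvm_atE (pvm0 E mB) nr0 expr0n /= adde0 -EFinD.
  congr (_%:E); rewrite (pvmC E _ mA) pvmB //.
  rewrite nr_sqrB.
  suff -> : ri (E B x) (E B (E A x)) = nr (E B (E A x)) ^+ 2 by ring.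
  rewrite (pvm_comm E _ mB mA) riC (pvm_nr E) //.
- rewrite /square_int (eq_measure_integral mzero) ?integral_measure_zero //.
  by move=> B mB _; rewrite /= /mzero pvm_atE pvm0 // nr0 expr0n.
Qed.

Lemma square_intD x y : square_int E g x -> square_int E g y ->
  square_int E g (x + y).
Proof.
move=> sx sy.
(* The factor 2 of the parallelogram identity is absorbed by a dilation, twice the measure of z
   being the measure of sqrt 2 z. *)
have s2 z : square_int E g z -> square_int E g ((Num.sqrt 2)%:C *: z).
  move=> sz; apply: (@square_int_le _ 0 z z) => // A mA.
  rewrite !pvm_atE (pvm0 E mA) nr0 expr0n /= adde0 -EFinD pvmZ // nrZr exprMn.
  by rewrite ger0_norm ?sqrtr_ge0 // sqr_sqrtr //; congr (_%:E); ring.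
apply: (@square_int_le _ (x - y) _ _ _ (s2 _ sx) (s2 _ sy)) => A mA.
rewrite !pvm_atE -!EFinD pvmD // pvmB // !pvmZ // !nrZr !exprMn nr_sqrD nr_sqrB.
by rewrite ger0_norm ?sqrtr_ge0 // sqr_sqrtr //; congr (_%:E); ring.
Qed.

(** The measure is finite and |g| <= 1 + |g|^2, so square-integrability gives integrability; w
    serves to select a phase. *)
Lemma Re_integrable w x : square_int E g x ->
  (pvm_at E x).-integrable [set: T] (EFin \o (fun t : T => Re (w * g t))).
Proof.
move=> sx.
have e t : Re (w * g t) = Re w * Re (g t) - Im w * Im (g t).
  by case: w => a b; case: (g t).
have mRe : measurable_fun [set: T] (fun t : T => Re (w * g t)).
  rewrite (_ : (fun t : T => _) = (fun t : T => Re w * Re (g t) - Im w * Im (g t))); last first.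
    by apply/funext => t; rewrite e.
  by apply: measurable_funB; apply: measurable_funM => //; case: mg.
pose K := `|Re w| + `|Im w|.
apply: (@le_integrable _ _ _ _ _ measurableT _ (fun t : T => (K + K * sq t)%:E)).
- exact/measurable_EFinP.
- move=> t _ /=; rewrite lee_fin e sq_normE.
  rewrite [leRHS]ger0_norm; last by rewrite addr_ge0 ?mulr_ge0 ?addr_ge0 ?sqr_ge0.
  apply: le_trans (ler_normB _ _) _; rewrite !normrM /K.
  rewrite -(real_normK (num_real (Re (g t)))) -(real_normK (num_real (Im (g t)))).
  have := normr_ge0 (Re w); have := normr_ge0 (Im w).
  have := sqr_ge0 (`|Re (g t)| - 1); have := sqr_ge0 (`|Im (g t)| - 1).
  set a := `|Re w|; set b := `|Im w|; set u := `|Re (g t)|; set v := `|Im (g t)|.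
  move=> h1 h2 b0 a0.
  have : a * u <= a * (1 + u ^+ 2 + v ^+ 2).
    by rewrite ler_wpM2l //; have := sqr_ge0 v; have := sqr_ge0 u; lra.
  have : b * v <= b * (1 + u ^+ 2 + v ^+ 2).
    by rewrite ler_wpM2l //; have := sqr_ge0 v; have := sqr_ge0 u; lra.
  by lra.
- rewrite (_ : (fun t : T => _) = (cst K%:E \+ (fun t : T => K%:E * (sq t)%:E))%E) //.
  apply: integrableD => //; first exact: finite_measure_integrable_cst.
  apply: integrableZl => //; apply/integrableP; split; first exact: measurable_sq_norm.
  by under eq_integral do rewrite gee0_abs ?lee_fin ?sqr_ge0 //.
Qed.

Definition cint_on (mu : {measure set T -> \bar R}) A : R[i] :=
  (\int[mu]_(t in A) Re (g t)) +i* (\int[mu]_(t in A) Im (g t)).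

Lemma Re_intg x : square_int E g x ->
  (pvm_at E x).-integrable [set: T] (EFin \o (fun t : T => Re (g t))).
Proof.
move=> /(Re_integrable 1); rewrite (_ : (fun t : T => _) = (fun t : T => Re (g t))) //.
by apply/funext => t; rewrite mul1r.
Qed.

Lemma Im_intg x : square_int E g x ->
  (pvm_at E x).-integrable [set: T] (EFin \o (fun t : T => Im (g t))).
Proof.
move=> /(Re_integrable (- 'i%C)); rewrite (_ : (fun t : T => _) = (fun t : T => Im (g t))) //.
by apply/funext => t; case: (g t) => a b /=; ring.
Qed.

Lemma cint_split x A : measurable A -> square_int E g x ->
  cintegral (pvm_at E x) g = cint_on (pvm_at E x) A + cint_on (pvm_at E x) (~` A).
Proof.
move=> mA sx; rewrite /cintegral /cint_on -(setUv A).
have d : [disjoint A & ~` A] by rewrite disj_set2E setICr.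
have mAc := measurableC mA.
rewrite !Rintegral_setU ?setUv //; [exact: Im_intg|exact: Re_intg].
Qed.

Lemma cint_on_eq x y A : measurable A -> E A x = E A y ->
  cint_on (pvm_at E x) A = cint_on (pvm_at E y) A.
Proof.
move=> mA e; rewrite /cint_on /Rintegral.
rewrite (eq_measure_integral (pvm_at E y)).
  rewrite [in X in _ +i* X](eq_measure_integral (pvm_at E y)) //.
  by move=> B mB BA; exact: pvm_at_restr e.
by move=> B mB BA; exact: pvm_at_restr e.
Qed.

End SquareInt.

(** * The quadratic form of a spectral integral *)

Section SpectralIntegral.
Context (R : realType) (H : hilbertSpace R) (E : pvm H).
Local Notation T := (measurableTypeR R).
Implicit Types (x y z : H) (c w : R[i]) (A B : set T).
Context (g : R -> R[i]) (mg : measurable_cfun g).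

Lemma norm_iX k : `|('i%C : R[i]) ^+ k| = 1.
Proof. by rewrite normrX normc_def /= expr0n expr1n add0r sqrtr1 expr1n. Qed.

Lemma Rint_add x y x' y' (u : T -> R) :
  (forall A, measurable A ->
    (pvm_at E x A + pvm_at E y A = pvm_at E x' A + pvm_at E y' A)%E) ->
  measurable_fun [set: T] u ->
  (pvm_at E x).-integrable [set: T] (EFin \o u) ->
  (pvm_at E y).-integrable [set: T] (EFin \o u) ->
  (pvm_at E x').-integrable [set: T] (EFin \o u) ->
  (pvm_at E y').-integrable [set: T] (EFin \o u) ->
  \int[pvm_at E x]_t u t + \int[pvm_at E y]_t u t =
  \int[pvm_at E x']_t u t + \int[pvm_at E y']_t u t.
Proof.
move=> h mu ix iy ix' iy'.
have fin z : (pvm_at E z).-integrable [set: T] (EFin \o u) ->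
  (\int[pvm_at E z]_t (u t)%:E \is a fin_num)%E by exact: integrable_fin_num.
rewrite /Rintegral -(fineD (fin _ ix) (fin _ iy)) -(fineD (fin _ ix') (fin _ iy')).
congr fine.
rewrite -(integral_measure_add measurableT ix iy).
rewrite -(integral_measure_add measurableT ix' iy').
apply: eq_measure_integral => A mA _.
by rewrite [LHS]measure_addE [RHS]measure_addE; exact: h.
Qed.

Lemma cint_add x y x' y' :
  (forall A, measurable A ->
    (pvm_at E x A + pvm_at E y A = pvm_at E x' A + pvm_at E y' A)%E) ->
  square_int E g x -> square_int E g y ->
  square_int E g x' -> square_int E g y' ->
  cintegral (pvm_at E x) g + cintegral (pvm_at E y) g =
  cintegral (pvm_at E x') g + cintegral (pvm_at E y') g.
Proof.
move=> h sx sy sx' sy'; case: mg => m1 m2; rewrite /cintegral.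
have e1 := Rint_add h m1 (Re_intg mg sx) (Re_intg mg sy) (Re_intg mg sx') (Re_intg mg sy').
have e2 := Rint_add h m2 (Im_intg mg sx) (Im_intg mg sy) (Im_intg mg sx') (Im_intg mg sy').
by apply/eqP; rewrite eq_complex /= e1 e2 !eqxx.
Qed.

Lemma square_int0 : square_int E g 0.
Proof.
rewrite /square_int (eq_measure_integral mzero) ?integral_measure_zero //.
by move=> B mB _; rewrite /= /mzero pvm_atE pvm0 // nr0 expr0n.
Qed.

Lemma cint0 : cintegral (pvm_at E 0) g = 0.
Proof.
have h (u : T -> \bar R) : (\int[pvm_at E (0%R : H)]_t u t = 0)%E.
  rewrite (eq_measure_integral mzero) ?integral_measure_zero //.
  by move=> B mB _; rewrite /= /mzero pvm_atE pvm0 // nr0 expr0n.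
by rewrite /cintegral /Rintegral !h.
Qed.

Lemma square_intZr (r : R) x : square_int E g x -> square_int E g (r%:C *: x).
Proof.
move=> sx; rewrite /square_int.
have r0 : 0 <= r ^+ 2 by exact: sqr_ge0.
rewrite (eq_measure_integral (mscale (NngNum r0) (pvm_at E x))); last first.
  move=> A mA _; rewrite /= /mscale /= !pvm_atE pvmZ // nrZr exprMn real_normK //.
  exact: num_real.
rewrite ge0_integral_mscale //=.
- by rewrite lte_mul_pinfty // ?lee_fin // sqr_ge0.
- exact: measurable_sq_norm.
- by move=> t _; rewrite lee_fin sqr_ge0.
Qed.

Lemma cint_sqrt2 x : square_int E g x ->
  cintegral (pvm_at E ((Num.sqrt 2)%:C *: x)) g = 2 * cintegral (pvm_at E x) g.
Proof.
move=> sx; have := @cint_add ((Num.sqrt 2)%:C *: x) 0 x x.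
rewrite cint0 addr0 => -> //; first by rewrite mulr2n mulrDl !mul1r.
- move=> A mA; rewrite !pvm_atE -!EFinD pvmZ // pvm0 // nr0 nrZr exprMn.
  by rewrite ger0_norm ?sqrtr_ge0 // sqr_sqrtr //; congr (_%:E); ring.
- exact: square_intZr.
- exact: square_int0.
Qed.

Lemma sum_i4 (G : R[i] -> R[i]) :
  \sum_(k < 4) 'i%C ^+ k * G ('i%C ^+ k) =
  G 1 + 'i%C * G 'i%C - G (- 1) - 'i%C * G (- 'i%C).
Proof.
have i3 : ('i%C : R[i]) ^+ 3 = - 'i%C by rewrite exprS sqr_i mulrN1.
rewrite 4!big_ord_recr big_ord0 /= add0r.
by rewrite i3 sqr_i expr0 expr1 mul1r mulN1r mulNr.
Qed.

Lemma sum_i4_cst (d : R[i]) : \sum_(k < 4) ('i%C : R[i]) ^+ k * d = 0.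
Proof. by rewrite (sum_i4 (fun=> d)); ring. Qed.

(** Polarisation on the diagonal: the terms of index 0 and 2 come from 4 times the measure of x and
    from 0, while those of index 1 and 3 have the same measure and opposite coefficients. *)
Lemma SI_quad x y : spectral_integral E g (x, y) ->
  '[y | x] = cintegral (pvm_at E x) g.
Proof.
move=> [/= sx /(_ x sx)] ->.
rewrite (sum_i4 (fun d => cintegral (pvm_at E (x + d *: x)) g)).
have -> : x + 1 *: x = (Num.sqrt 2)%:C *: ((Num.sqrt 2)%:C *: x).
  rewrite scalerA -rmorphM /= -expr2 sqr_sqrtr // -{1}[x]scale1r -scalerDl.
  by congr (_ *: _); rewrite -[1 in LHS]/(1%:C) -rmorphD /=; congr (_%:C); ring.
rewrite !cint_sqrt2 //; last exact: square_intZr.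
rewrite scaleN1r subrr cint0.
have <- : cintegral (pvm_at E (x + 'i%C *: x)) g =
          cintegral (pvm_at E (x + (- 'i%C) *: x)) g.
  have si c : `|c| = 1 -> square_int E g (x + c *: x).
    by move=> c1; apply: square_intD => //; apply: square_intZ.
  have e A : measurable A -> pvm_at E (x + 'i%C *: x) A =
      pvm_at E (x + (- 'i%C) *: x) A.
    move=> mA; rewrite !pvm_atE -{1 3}[x]scale1r -!scalerDl !pvmZ // !nrZ.
    by rewrite !normc_def /= !(addr0, add0r, subr0, oppr0, sqrrN).
  rewrite /cintegral /Rintegral.
  by congr (fine _ +i* fine _); apply: eq_measure_integral => A mA _; exact: e.
by field.
Qed.

Lemma cint_onZ c x A : measurable A -> `|c| = 1 ->
  cint_on g (pvm_at E (c *: x)) A = cint_on g (pvm_at E x) A.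
Proof.
move=> mA c1; rewrite /cint_on /Rintegral.
by congr (fine _ +i* fine _); apply: eq_measure_integral => B mB _; exact: pvm_atZ.
Qed.

(** Each integral splits over A and its complement. On A both polarisation sums see E A x + i^k E A
    z; off A the integrals do not depend on k, and the sum of the i^k cancels them. *)
Lemma SI_comm A x y : measurable A -> spectral_integral E g (x, y) ->
  spectral_integral E g (E A x, E A y).
Proof.
move=> mA [/= sx hy]; split=> /= [|z sz]; first exact: square_int_pvm.
have mAc := measurableC mA.
have sAx := square_int_pvm mg mA sx; have sAz := square_int_pvm mg mA sz.
rewrite pvm_adj // hy //; congr (_ * _).
set c1 := cint_on g (pvm_at E x) (~` A); set c2 := cint_on g (pvm_at E z) (~` A).
pose G (k : 'I_4) := cint_on g (pvm_at E (x + 'i%C ^+ k *: z)) A.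
transitivity (\sum_(k < 4) ('i%C ^+ k * G k + 'i%C ^+ k * c1)).
  apply: eq_bigr => k _; rewrite -mulrDr; congr (_ * _).
  rewrite (cint_split mg mA); last by apply: square_intD => //; apply: square_intZ => //; exact: norm_iX.
  congr (_ + _); apply: cint_on_eq => //; first by rewrite !pvmD // !pvmZ // pvmK.
  by rewrite !pvmD // !pvmZ // (pvm_disj E _ mAc mA) ?setICl // scaler0 addr0.
transitivity (\sum_(k < 4) ('i%C ^+ k * G k + 'i%C ^+ k * c2)).
  by rewrite !big_split /= !sum_i4_cst.
apply: eq_bigr => k _; rewrite -mulrDr; congr (_ * _).
rewrite (cint_split mg mA); last by apply: square_intD => //; apply: square_intZ => //; exact: norm_iX.
congr (_ + _); first by apply: cint_on_eq => //; rewrite !pvmD // pvmK.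
rewrite /c2 -(cint_onZ _ mAc (norm_iX k)); apply: cint_on_eq => //.
by rewrite !pvmD // (pvm_disj E _ mAc mA) ?setICl // add0r.
Qed.

Lemma SI_Re w x y : spectral_integral E g (x, y) ->
  Re (w * '[y | x]) = \int[pvm_at E x]_t Re (w * g t).
Proof.
move=> xy; have sx := xy.1; rewrite (SI_quad xy) /cintegral /=.
have -> : (fun t => Re (w * g t)) = (fun t : T => Re w * Re (g t) - Im w * Im (g t)).
  by apply/funext => t; case: w => a b; case: (g t).
have iR := Re_intg mg sx; have iI := Im_intg mg sx.
rewrite RintegralB //; first last.
- by have := integrableZl measurableT (Im w) iI.
- by have := integrableZl measurableT (Re w) iR.
by rewrite !RintegralZl //; case: w.
Qed.

(** E A x = x makes the complement of A null for the measure of x; the rest is monotonicity of the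
    integral. *)
Lemma SI_ge w (k : R) A x y : measurable A -> spectral_integral E g (x, y) ->
  E A x = x -> (forall t, A t -> k <= Re (w * g t)) ->
  k * nr x ^+ 2 <= Re (w * '[y | x]).
Proof.
move=> mA xy Ax hk; rewrite (SI_Re w xy).
have mAc := measurableC mA; have iw := Re_integrable mg w xy.1.
rewrite -(setUv A) Rintegral_setU ?setUv //; last by rewrite disj_set2E setICr.
have -> : \int[pvm_at E x]_(t in ~` A) Re (w * g t) = 0.
  rewrite /Rintegral (eq_measure_integral mzero) ?integral_measure_zero //.
  move=> B mB BA; rewrite /= /mzero pvm_atE -{1}Ax pvm_disj ?nr0 ?expr0n //.
  by apply/disjoints_subset.
rewrite addr0; apply: le_trans (_ : \int[pvm_at E x]_(t in A) k <= _).
  by rewrite Rintegral_cst //= -[Re `|E A x|]/(nr (E A x)) Ax.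
apply: le_Rintegral => //; first exact: finite_measure_integrable_cst.
exact: integrableS iw.
Qed.

End SpectralIntegral.

(** * The spectral measure of a self-adjoint operator *)

Lemma measurable_dist_le (R : realType) (c r : R) :
  measurable ([set t | `|t - c| <= r] : set (measurableTypeR R)).
Proof.
rewrite (_ : [set _ | _] = `[c - r, c + r]%classic); first exact: measurable_itv.
by apply/seteqP; split => t; rewrite /= in_itv /= ler_distl.
Qed.

Lemma measurable_norm_le (R : realType) (r : R) :
  measurable ([set t | `|t| <= r] : set (measurableTypeR R)).
Proof.
rewrite (_ : [set _ | _] = `[- r, r]%classic); first exact: measurable_itv.
by apply/seteqP; split => t; rewrite /= in_itv /= ler_norml.
Qed.

Section SelfAdjoint.
Context (R : realType) (H : hilbertSpace R) (D : set (H * H)).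
Context (D_sa : selfadjoint_op D).
Local Notation T := (measurableTypeR R).
Implicit Types (x y z v : H) (c d r : R) (A B : set T).

Lemma sa_lin (a : R[i]) x y x' y' : D (x, y) -> D (x', y') ->
  D (a *: x + x', a *: y + y').
Proof. by move=> h h'; have [[lD _ _] _] := D_sa; exact: lD a _ _ h h'. Qed.

Lemma sa_fun x y z : D (x, y) -> D (x, z) -> y = z.
Proof. by have [[_ fD _] _] := D_sa; exact: fD. Qed.

Lemma sa_adj x y : (forall z w : H, D (z, w) -> '[w | x] = '[z | y]) -> D (x, y).
Proof. by move=> h; have [_ <-] := D_sa; case=> z w; exact: h. Qed.

Lemma sa_sym x y x' y' : D (x, y) -> D (x', y') -> '[y | x'] = '[x | y'].
Proof. by move=> h; have [_ e] := D_sa; rewrite -{1}e => /(_ _ h). Qed.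

Lemma sa_dense x (e : R) : 0 < e -> exists z w : H, D (z, w) /\ nr (x - z) < e.
Proof.
have [[_ _ dD] _] := D_sa; move: dD => /dense_nr h e0.
by have [z [[z' w] /= zw <-] hz] := h x e e0; exists z', w.
Qed.

Lemma sa_0 : D (0, 0).
Proof.
have [z [w [zw _]]] := sa_dense 0 ltr01.
by have := sa_lin (- 1) zw zw; rewrite !scaleN1r !addNr.
Qed.

Lemma sa_scale (a : R[i]) x y : D (x, y) -> D (a *: x, a *: y).
Proof. by move=> h; have := sa_lin a h sa_0; rewrite !addr0. Qed.

Lemma sa_add x y x' y' : D (x, y) -> D (x', y') -> D (x + x', y + y').
Proof. by move=> h h'; have := sa_lin 1 h h'; rewrite !scale1r. Qed.

Lemma sa_sub x y x' y' : D (x, y) -> D (x', y') -> D (x - x', y - y').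
Proof. by move=> h h'; rewrite -(scaleN1r x') -(scaleN1r y'); apply: sa_add => //; exact: sa_scale. Qed.

Lemma sa_closed : closed D.
Proof.
move=> [x y] cl; apply: sa_adj => z w zw.
apply/eqP; rewrite -subr_eq0 -normr_eq0.
have -> : `|'[w | x] - '[z | y]| = (Re `|'[w | x] - '[z | y]|)%:C.
  by rewrite RRe_real // ger0_real.
rewrite (_ : Re _ = 0) //; apply/eqP; rewrite eq_le; apply/andP; split; last first.
  by have := normr_ge0 ('[w | x] - '[z | y]); rewrite lecE => /andP[].
apply: (@ler_eps _ _ _ (nr w + nr z)) => e e0; rewrite add0r.
have [[x' y'] Dxy [/= hx hy]] := closure_nr2 cl e0.
have -> : '[w | x] - '[z | y] = '[w | x - x'] - '[z | y - y'].
  by rewrite !innerBr (sa_sym zw Dxy); ring.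
have : Re `|'[w | x - x'] - '[z | y - y']| <= Re `|'[w | x - x']| + Re `|'[z | y - y']|.
  have := ler_normB '[w | x - x'] '[z | y - y'].
  by rewrite lecE => /andP[_]; rewrite raddfD.
move=> /le_trans; apply; rewrite mulrDr.
apply: lerD; apply: le_trans (inner_le _ _) _; rewrite mulrC ler_wpM2r ?nr_ge0 //; exact: ltW.
Qed.

Context (E : pvm H) (hE : is_spectral_measure D E).

Let idc (t : R) : R[i] := t%:C.

Lemma measurable_idc : measurable_cfun idc.
Proof. by split; [exact: measurable_id|exact: measurable_cst]. Qed.

Lemma sa_comm A x y : measurable A -> D (x, y) -> D (E A x, E A y).
Proof. by rewrite -hE => mA; apply: SI_comm => //; exact: measurable_idc. Qed.

(** Here and below, v with D (x, c x + v) stands for (D - c) x, so that no graph of D - c has to be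
    formed. *)
Lemma sa_range A x c v : measurable A -> D (x, c%:C *: x + v) -> E A x = x -> E A v = v.
Proof.
move=> mA xv Ax; have := sa_comm mA xv; rewrite Ax => /sa_fun /(_ xv).
by rewrite pvmD // pvmZ // Ax => /addrI.
Qed.

Lemma sa_ge A c k x v : measurable A -> D (x, c%:C *: x + v) -> E A x = x ->
  (forall t, A t -> k <= t - c) -> k * nr x ^+ 2 <= ri v x.
Proof.
move=> mA; rewrite -hE => xv Ax hk.
have := SI_ge measurable_idc (w := 1) (k := k + c) mA xv Ax.
rewrite mul1r -[Re '[_ | _]]/(ri _ _) riDl riZl -nr_sqr => h.
suff : (k + c) * nr x ^+ 2 <= c * nr x ^+ 2 + ri v x by lra.
by apply: h => t /hk; rewrite mul1r /= lerBrDr.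
Qed.

Lemma sa_le A c k x v : measurable A -> D (x, c%:C *: x + v) -> E A x = x ->
  (forall t, A t -> t - c <= k) -> ri v x <= k * nr x ^+ 2.
Proof.
move=> mA; rewrite -hE => xv Ax hk.
have := SI_ge measurable_idc (w := - 1) (k := - (k + c)) mA xv Ax.
rewrite mulN1r -innerNl -[Re '[_ | _]]/(ri _ _) riNl riDl riZl -nr_sqr => h.
suff : - (k + c) * nr x ^+ 2 <= - (c * nr x ^+ 2 + ri v x) by lra.
by apply: h => t /hk; rewrite mulN1r /= lerN2 lerBlDr.
Qed.

(** The form of D - c lies between - r and r on the range of E A. Subtracting its values at x + z'
    and x - z', with z' = E A z, gives 4 ri v z' <= 2 r (|x|^2 + |z'|^2); rescaling z and density of
    the domain turn this into ri v z <= r |x| |z| for all z, and z = v concludes. *)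
Lemma sa_bound A c r x v : measurable A -> D (x, c%:C *: x + v) -> E A x = x ->
  (forall t, A t -> `|t - c| <= r) -> 0 <= r -> nr v <= r * nr x.
Proof.
move=> mA xv Ax hr r0; have Av := sa_range mA xv Ax.
have [x0|x0] := eqVneq x 0.
  have : v = 0.
    by move: xv; rewrite x0 scaler0 add0r => /sa_fun; apply; exact: sa_0.
  by move=> ->; rewrite x0 !nr0 mulr0.
have nx := nr_gt0 x0.
have h1 z w : D (z, w) -> 2 * ri v z <= r * (nr x ^+ 2 + nr z ^+ 2).
  move=> zw; have zw' := sa_comm mA zw.
  pose z' := E A z.
  have Az' : E A z' = z' by rewrite pvmK.
  have [v' {}zw'] : exists v', D (z', c%:C *: z' + v').
    by exists (E A w - c%:C *: z'); rewrite addrC subrK.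
  have hp : D (x + z', c%:C *: (x + z') + (v + v')).
    by rewrite scalerDr addrACA; exact: sa_add.
  have hm : D (x - z', c%:C *: (x - z') + (v - v')).
    by rewrite scalerBr addrACA -opprD; exact: sa_sub.
  have := @sa_le A c r _ _ mA hp; rewrite pvmD // Ax Az' => /(_ erefl).
  have := @sa_ge A c (- r) _ _ mA hm; rewrite pvmB // Ax Az' => /(_ erefl).
  have e : ri v z' = ri v' x.
    have := congr1 (@complex.Re R) (sa_sym xv zw').
    rewrite -![Re '[_ | _]]/(ri _ _) riDl riDr riZl riZr => /addrI ->.
    exact: riC.
  have -> : ri v z = ri v z' by rewrite -{1}Av /ri pvm_adj.
  rewrite !nr_sqrB !nr_sqrD !riDl !riDr !riNl !riNr -e (riC v' z') (riC v z').
  move=> h2 h3.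
  have : nr z' ^+ 2 <= nr z ^+ 2 by rewrite ler_pXn2r ?nnegrE ?nr_ge0 ?pvm_nr_le.
  move=> /(ler_wpM2l r0).
  have /h2 {h2} : forall t, A t -> - r <= t - c.
    by move=> t /hr; rewrite ler_norml => /andP[].
  have /h3 {h3} : forall t, A t -> t - c <= r.
    by move=> t /hr; rewrite ler_norml => /andP[].
  by rewrite (riC z' v); lra.
have h2 z w : D (z, w) -> ri v z <= r * nr x * nr z.
  move=> zw; have [->|z0] := eqVneq z 0; first by rewrite ri0r nr0 mulr0.
  have nz := nr_gt0 z0.
  (* At equal norms of x and z the mean of the two squares is the product |x| |z|. *)
  have := h1 _ _ (sa_scale (nr x / nr z)%:C zw).
  rewrite riZr nrZr ger0_norm ?divr_ge0 ?nr_ge0 // divfK ?gt_eqF //.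
  move=> h; have {h} : nr x * ri v z / nr z <= r * nr x ^+ 2 by lra.
  rewrite ler_pdivrMr // => h; rewrite -(ler_pM2l nx).
  by apply: le_trans h _; rewrite le_eqVlt; apply/orP; left; apply/eqP; ring.
have h3 z : ri v z <= r * nr x * nr z.
  apply: (@ler_eps _ _ _ (r * nr x + nr v)) => e e0.
  have [z' [w [zw hz]]] := sa_dense z e0.
  have := h2 _ _ zw; have := ri_le v (z - z').
  have : nr z' <= nr z + nr (z - z').
    by rewrite -{1}(subKr z z') (le_trans (nrD _ _)) // nrN.
  rewrite riBr => g1 g2 g3.
  have : r * nr x * nr z' <= r * nr x * (nr z + nr (z - z')).
    by rewrite ler_wpM2l // mulr_ge0 ?nr_ge0.
  have : r * nr x * nr (z - z') <= r * nr x * e.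
    by rewrite ler_wpM2l ?mulr_ge0 ?nr_ge0 // ltW.
  have : nr v * nr (z - z') <= nr v * e by rewrite ler_wpM2l ?nr_ge0 // ltW.
  by lra.
have [->|v0] := eqVneq v 0; first by rewrite nr0 mulr_ge0 ?nr_ge0.
by have := h3 v; rewrite -nr_sqr expr2 ler_pM2r // nr_gt0.
Qed.

(** The functional z -> <D z, x> equals <E A D z, x>, which [sa_bound] bounds by (|c| + r) |x| |z|;
    self-adjointness then puts x in the domain, the Riesz vector being D x. *)
Lemma sa_dom A c r x : measurable A -> E A x = x ->
  (forall t, A t -> `|t - c| <= r) -> 0 <= r ->
  exists v, D (x, c%:C *: x + v).
Proof.
move=> mA Ax hr r0.
have [| | |y hy] := @riesz_graph _ _
    (fun z e => exists w : H, D (z, w) /\ e = '[w | x]) ((`|c| + r) * nr x).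
- by exists 0; split; [exact: sa_0|rewrite inner0l].
- move=> a z e z' e' [w [zw ->]] [w' [zw' ->]]; exists (a *: w + w'); split.
    exact: sa_lin.
  by rewrite innerDl innerZl.
- move=> z e [w [zw ->]]; rewrite -Ax -pvm_adj //.
  apply: le_trans (inner_le _ _) _.
  rewrite mulrAC Ax ler_wpM2r ?nr_ge0 //.
  pose v := E A w - c%:C *: E A z.
  have zw' : D (E A z, c%:C *: E A z + v) by rewrite /v addrC subrK; exact: sa_comm.
  have := sa_bound mA zw' (pvmK E _ mA) hr r0.
  have -> : E A w = c%:C *: E A z + v by rewrite /v addrC subrK.
  move=> hv; apply: le_trans (nrD _ _) _; rewrite nrZr mulrDl.
  have hz := pvm_nr_le E z mA.
  by apply: lerD; [rewrite ler_wpM2l|apply: le_trans hv _; rewrite ler_wpM2l].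
- exists (y - c%:C *: x); rewrite addrC subrK; apply: sa_adj => z w zw.
  by apply: hy; exists w.
Qed.

(** Pairs v with the sign of D - c applied to x, a vector of the same norm as x: splitting the line
    at c makes the form of D - c definite on each side. *)
Lemma sa_lower A c d x v : measurable A -> D (x, c%:C *: x + v) -> E A x = x ->
  (forall t, A t -> d <= `|t - c|) -> d * nr x <= nr v.
Proof.
move=> mA xv Ax hd.
pose B : set T := `[c, +oo[%classic.
have mB : measurable B by exact: measurable_itv.
have mBc := measurableC mB.
have Bt t : B t = (c <= t) :> Prop by rewrite /B /= in_itv /= andbT.
have part C : measurable C -> D (E C x, c%:C *: E C x + E C v) /\
    E (A `&` C) (E C x) = E C x.
  move=> mC; split; first by have := sa_comm mC xv; rewrite pvmD // pvmZ.
  by rewrite pvmI // pvmK // pvm_comm // Ax.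
have [xvp Ap] := part _ mB; have [xvm Am] := part _ mBc.
have hp : d * nr (E B x) ^+ 2 <= ri (E B v) (E B x).
  apply: (sa_ge _ xvp Ap) => [|t []]; first exact: measurableI.
  by rewrite Bt => /hd h ct; rewrite ger0_norm ?subr_ge0 in h.
have hm : ri (E (~` B) v) (E (~` B) x) <= - d * nr (E (~` B) x) ^+ 2.
  apply: (sa_le _ xvm Am) => [|t [/hd h]]; first exact: measurableI.
  rewrite /setC /= -/(B t) Bt => /negP; rewrite -ltNge => tc.
  by rewrite ltr0_norm ?subr_lt0 // in h; lra.
have sp C : measurable C -> ri v (E C x) = ri (E C v) (E C x).
  by move=> mC; rewrite /ri pvm_adj // pvmK.
have nx : nr (E B x) ^+ 2 + nr (E (~` B) x) ^+ 2 = nr x ^+ 2.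
  by rewrite (pvmC E x mB) nr_sqrB (riC x) -pvm_nr //; ring.
have nx' : nr (E B x - E (~` B) x) = nr x.
  apply: (pexpIrn (n := 2)) => //; rewrite ?nnegrE ?nr_ge0 //.
  by rewrite nr_sqrB -nx /ri pvm_adj // pvm_disj ?setICr // inner0r mulr0 subr0.
have [->|x0] := eqVneq x 0; first by rewrite nr0 mulr0 nr_ge0.
rewrite -(ler_pM2r (nr_gt0 x0)) -mulrA -expr2 -nx -[in leRHS]nx'.
apply: le_trans (ri_le _ _); rewrite riBr !sp //.
by lra.
Qed.

(** Here y n plays (D - c)^n x. On G = {|t - c| >= d} with d > r the lower bound gives d^n |E G x|
    <= |E G (y n)| <= C r^n for all n, so E G x = 0. *)
Lemma sa_support (y : nat -> H) c r (C : R) :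
  (forall n, D (y n, c%:C *: y n + y n.+1)) -> 0 <= r ->
  (forall n, nr (y n) <= C * r ^+ n) ->
  E [set t : T | `|t - c| <= r] (y 0%N) = y 0%N.
Proof.
move=> hy r0 hC.
have mG (d : R) : measurable ([set t : T | d <= `|t - c|] : set T).
  rewrite (_ : [set _ | _] = (fun t : T => `|t - c|) @^-1` `[d, +oo[%classic).
    rewrite -[X in measurable X]setTI.
    have : measurable_fun [set: T] (fun t : T => `|t - c|).
      by apply: measurableT_comp => //; exact: measurable_funB.
    by apply => //; exact: measurable_itv.
  by apply/seteqP; split => t /=; rewrite in_itv /= andbT.
have G0 d : r < d -> E [set t : T | d <= `|t - c|] (y 0%N) = 0.
  move=> rd; set G : set T := [set t | _]; have d0 : 0 < d by apply: le_lt_trans rd.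
  have step n : d * nr (E G (y n)) <= nr (E G (y n.+1)).
    have h : D (E G (y n), c%:C *: E G (y n) + E G (y n.+1)).
      by have := sa_comm (mG d) (hy n); rewrite pvmD ?pvmZ //; exact: mG.
    by apply: (sa_lower (mG d) h) => //; apply: pvmK; exact: mG.
  have pow n : d ^+ n * nr (E G (y 0%N)) <= nr (E G (y n)).
    elim: n => [|n IH]; first by rewrite expr0 mul1r.
    rewrite exprS -mulrA; apply: le_trans (step n).
    by rewrite ler_pM2l.
  have q1 : `|r / d| < 1 by rewrite ger0_norm ?divr_ge0 ?(ltW d0) // ltr_pdivrMr // mul1r.
  have key n : nr (E G (y 0%N)) <= C * (r / d) ^+ n.
    rewrite expr_div_n mulrA ler_pdivlMr ?exprn_gt0 // mulrC.
    by apply: le_trans (pow n) _; apply: le_trans (hC n); apply: pvm_nr_le; exact: mG.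
  apply: nr_eq0; apply/eqP; rewrite eq_le nr_ge0 andbT.
  have cv : (fun n => C * (r / d) ^+ n) @ \oo --> C * 0.
    by apply: cvgMr; exact: cvg_expr.
  rewrite -[leRHS](mulr0 C) -(cvg_lim _ cv) //.
  apply: limr_ge; first by apply/cvg_ex; exists (C * 0).
  by apply: nearW => n; exact: key.
set A : set T := [set t | _].
have mA : measurable A by exact: measurable_dist_le.
suff h : pvm_at E (y 0%N) (~` A) = 0%E.
  move: h; rewrite pvm_atE => -[/eqP]; rewrite sqrf_eq0 => /eqP/nr_eq0.
  by rewrite pvmC // => /eqP; rewrite subr_eq0 => /eqP <-.
(* Countably many of these null sets, with d = r + 1 / (n + 1), exhaust the complement of A. *)
have -> : ~` A = \bigcup_n [set t : T | r + n.+1%:R^-1 <= `|t - c|].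
  apply/seteqP; split => t; rewrite /setC /A /=.
    move=> /negP; rewrite -ltNge -subr_gt0 => h.
    have [n _ hn] := near_infty_natSinv_lt (PosNum h).
    have {}hn : n.+1%:R^-1 < `|t - c| - r := hn n (leqnn n).
    by exists n => //; change (r + n.+1%:R^-1 <= `|t - c|); rewrite -lerBrDl ltW.
  move=> [n _ /=] h; apply/negP; rewrite -ltNge; apply: lt_le_trans h.
  by rewrite ltrDl invr_gt0.
apply/eqP; rewrite eq_le measure_ge0 andbT.
have h : (pvm_at E (y 0%N) (\bigcup_n [set t : T | (r + n.+1%:R^-1 <= `|t - c|)%R]) <=
    \sum_(n <oo) pvm_at E (y 0%N) [set t : T | (r + n.+1%:R^-1 <= `|t - c|)%R])%E.
  apply: measure_sigma_subadditive => //.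
  by apply: bigcup_measurable => n _; exact: mG.
apply: le_trans h _; rewrite eseries0 // => n _ _.
by rewrite /= pvm_atE G0 ?nr0 ?expr0n // ltrDl invr_gt0.
Qed.

End SelfAdjoint.

(** * Closed intervals as a generating class of the Borel sets *)

Section Generator.
Context (R : realType).
Local Notation T := (measurableTypeR R).

(** Apart from the empty set, these are the balls |t - c| <= r to which the support criterion
    applies, and they form a pi-system. *)
Definition closed_itvs : set (set T) :=
  [set A | exists a b : R, A = `[a, b]%classic].

Lemma setI_closed_itvs : setI_closed closed_itvs.
Proof.
move=> _ _ [a [b ->]] [a' [b' ->]]; exists (Num.max a a'), (Num.min b b').
apply/seteqP; split => t /=; rewrite !in_itv /= ge_max le_min.
  by move=> [/andP[-> ->] /andP[-> ->]].
by move=> /andP[/andP[-> ->] /andP[-> ->]].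
Qed.

Lemma measurable_closed_itvs : @measurable _ T = <<s closed_itvs >>.
Proof.
have e : @measurable _ T = @measurable _ (g_sigma_algebraType (@RGenOInfty.G R)).
  exact: RGenOInfty.measurableE.
apply/seteqP; split; last first.
  apply: smallest_sub; first exact: sigma_algebra_measurable.
  by move=> _ [a [b ->]]; exact: measurable_itv.
rewrite e; apply: smallest_sub; first exact: smallest_sigma_algebra.
move=> _ [x ->].
have -> : `]x, +oo[%classic = \bigcup_n (`[x + n.+1%:R^-1, x + n.+1%:R]%classic : set R).
  apply/seteqP; split => t /=; rewrite in_itv /= ?andbT.
    move=> xt; have tx : 0 < t - x by rewrite subr_gt0.
    have [n _ hn] := near_infty_natSinv_lt (PosNum tx).
    have [m hm] : exists m : nat, t - x <= m%:R.
      by exists (Num.bound (t - x)); exact: ltW (archi_boundP (ltW tx)).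
    exists (maxn n m) => //; rewrite /= in_itv /=; apply/andP; split.
      rewrite -lerBrDl; apply: ltW; apply: (hn (maxn n m)); exact: leq_maxl.
    rewrite -lerBlDl; apply: le_trans hm _; rewrite ler_nat.
    by rewrite (leq_trans (leq_maxr n m)).
  move=> [n _ /=]; rewrite in_itv /= => /andP[h _]; apply: lt_le_trans h.
  by rewrite ltrDl invr_gt0.
apply: (@bigcupT_measurable _ (g_sigma_algebraType closed_itvs)) => n.
by apply: sub_sigma_algebra; exists (x + n.+1%:R^-1), (x + n.+1%:R).
Qed.

Lemma pushforward_measure_ex (mu : {measure set T -> \bar R}) (phi : T -> T) :
  measurable_fun [set: T] phi ->
  exists nu : {measure set T -> \bar R}, (forall A, nu A = mu (phi @^-1` A)) /\
    forall u : T -> R, measurable_fun [set: T] u ->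
      mu.-integrable [set: T] (EFin \o (u \o phi)) ->
      \int[nu]_t u t = \int[mu]_t u (phi t).
Proof.
move=> mphi.
exists (@measure_function_pushforward__canonical__measure_function_Measure
  _ _ T T R mu phi mphi); split=> // u mu_ iu; rewrite /Rintegral; congr fine.
rewrite (@integral_pushforward _ _ T T R phi mphi mu setT (EFin \o u)) //.
exact/measurable_EFinP.
Qed.

Lemma finite_measure_eq_closed_itvs (m1 m2 : {measure set T -> \bar R}) :
  (forall a b : R, m1 `[a, b]%classic = m2 `[a, b]%classic) ->
  (forall a b : R, (m1 `[a, b]%classic < +oo)%E) ->
  forall A, measurable A -> m1 A = m2 A.
Proof.
move=> h fin A mA.
apply: (@measure_unique _ R T closed_itvs (fun n => `[- n%:R, n%:R]%classic)) => //.
- exact: measurable_closed_itvs.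
- exact: setI_closed_itvs.
- by move=> n; exists (- n%:R), n%:R.
- apply/seteqP; split => // t _; exists (Num.bound `|t|) => //=.
  by rewrite in_itv /= -ler_norml; exact: ltW (archi_boundP (normr_ge0 t)).
- by move=> _ [a [b ->]].
Qed.

End Generator.

Lemma sqr1_norm (R : realDomainType) (s : R) : s ^+ 2 = 1 -> `|s| = 1.
Proof.
by move=> /eqP; rewrite sqrf_eq1 => /orP[]/eqP->; rewrite ?normrN normr1.
Qed.

(** * Isometries that commute or anticommute with D *)

Section IntertwineIntervals.
Context (R : realType) (H : hilbertSpace R) (D : set (H * H)).
Context (D_sa : selfadjoint_op D) (E E' : pvm H).
Context (hE : is_spectral_measure D E) (hE' : is_spectral_measure D E').
Local Notation T := (measurableTypeR R).
Implicit Types (x y z v : H) (r s : R) (A B : set T).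

(** If y n = (D - c)^n x, then s^n V (y n) = (D - s c)^n (V x), and its norm is at most a constant
    times r^n, so the support criterion applies to V x. *)
Lemma intertwine_itv (V : H -> H) s c r x : bounded_op V -> s ^+ 2 = 1 ->
  (forall x y, D (x, y) -> D (V x, s%:C *: V y)) -> 0 <= r ->
  E [set t : T | `|t - c| <= r] x = x ->
  E' [set t : T | `|t - s * c| <= r] (V x) = V x.
Proof.
move=> /bounded_nr[lV [K K0 hK]] s2 hV r0 Ax.
set A := [set t : T | _] in Ax.
have mA : measurable A by exact: measurable_dist_le.
have bA t : A t -> `|t - c| <= r by [].
(* Off the range of E A the successor is a dummy 0; the iterates never leave that range. *)
have ex y : exists v, E A y = y -> D (y, c%:C *: y + v).
  have [Ay|Ay] := pselect (E A y = y); last by exists 0 => /Ay.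
  by have [v hv] := sa_dom D_sa hE mA Ay bA r0; exists v.
have [next hnext] := choice ex.
pose y n := iter n next x.
have Ay n : E A (y n) = y n.
  by elim: n => [//|n IH]; exact: (sa_range D_sa hE mA (hnext _ IH) IH).
have yy n : D (y n, c%:C *: y n + y n.+1) by exact: hnext.
have ny n : nr (y n) <= r ^+ n * nr x.
  elim: n => [|n IH]; first by rewrite expr0 mul1r.
  apply: le_trans (sa_bound D_sa hE mA (yy n) (Ay n) bA r0) _.
  by rewrite exprS -mulrA ler_wpM2l.
have s1 := sqr1_norm s2.
pose z n := (s ^+ n)%:C *: V (y n).
have -> : V x = z 0%N by rewrite /z expr0 scale1r.
apply: (sa_support hE' (y := z) (C := K * nr x)) => // [n|n].
  have := sa_scale D_sa (s ^+ n)%:C (hV _ _ (yy n)).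
  rewrite (linopD _ _ lV) (linopZ _ _ lV) !scalerDr !scalerA.
  rewrite /z -!rmorphM /=.
  have -> : s ^+ n * s * c = s * c * s ^+ n by ring.
  by rewrite -exprSr.
rewrite /z nrZr normrX s1 expr1n mul1r; apply: le_trans (hK _) _.
rewrite -mulrA ler_pM2l // mulrC; exact: ny.
Qed.

End IntertwineIntervals.

Section Intertwine.
Context (R : realType) (H : hilbertSpace R) (D : set (H * H)).
Context (D_sa : selfadjoint_op D) (E E' : pvm H).
Context (hE : is_spectral_measure D E) (hE' : is_spectral_measure D E').
Local Notation T := (measurableTypeR R).
Implicit Types (x y z v : H) (r s : R) (A B : set T).

(** Two spectral measures of D are allowed, so that V = id yields uniqueness. *)
Lemma intertwine_pvm (V W : H -> H) s A x : bounded_op V -> bounded_op W ->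
  is_adjoint V W -> cancel W V -> cancel V W -> s ^+ 2 = 1 ->
  (forall x y, D (x, y) -> D (V x, s%:C *: V y)) ->
  (forall x y, D (x, y) -> D (W x, s%:C *: W y)) ->
  measurable A ->
  E' ((fun t : T => s * t) @^-1` A) (V x) = V (E A x).
Proof.
move=> bV bW VW WK VK s2 hV hW mA.
have lV := bV.1; have lW := bW.1.
have ms : measurable_fun [set: T] ((fun t : T => s * t) : T -> T).
  exact: measurable_funM.
have mpre B : measurable B -> measurable ((fun t : T => s * t) @^-1` B).
  by move=> mB; rewrite -[X in measurable X]setTI; exact: ms.
have isoV y : nr (V y) = nr y.
  apply: (pexpIrn (n := 2)) => //; rewrite ?nnegrE ?nr_ge0 //.
  by rewrite !nr_sqr /ri VW VK.
(* V maps the range of E I into that of E' J; the same inclusion for W gives, by taking adjoints,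
   that V maps the kernel of E I into the kernel of E' J. *)
have itv c r y : 0 <= r -> E' [set t : T | `|t - s * c| <= r] (V y) =
    V (E [set t : T | `|t - c| <= r] y).
  move=> r0.
  have := measurable_dist_le c r; have := measurable_dist_le (s * c) r.
  set I := [set t : T | `|t - c| <= r]; set J := [set t : T | `|t - s * c| <= r].
  move=> mJ mI.
  rewrite -{1}(subrK (E I y) y) (linopD _ _ lV) pvmD //.
  rewrite (intertwine_itv D_sa hE hE' bV s2 hV r0 (pvmK E y mI)).
  suff -> : E' J (V (y - E I y)) = 0 by rewrite add0r.
  apply: inner_inj => z; rewrite inner0l pvm_adj // VW.
  have := intertwine_itv D_sa hE' hE bW s2 hW r0 (pvmK E' z mJ).
  rewrite mulrA -expr2 s2 mul1r -/I => <-.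
  by rewrite -pvm_adj // pvmB // pvmK // subrr inner0l.
have key y B : measurable B ->
    pvm_at E' (V y) ((fun t : T => s * t) @^-1` B) = pvm_at E y B.
  move=> mB.
  have [m1 [hm1 _]] := pushforward_measure_ex (pvm_at E' (V y)) ms.
  rewrite -(hm1 B); apply: (@finite_measure_eq_closed_itvs R m1 (pvm_at E y)) => //.
  - move=> a b; rewrite hm1.
    have [ab|ba] := leP a b; last first.
      rewrite (_ : `[a, b]%classic = set0) ?preimage_set0 ?measure0 //.
      by apply/seteqP; split => t //=; rewrite in_itv /= => /andP[at_ tb]; lra.
    have -> : `[a, b]%classic = [set t : T | `|t - (a + b) / 2| <= (b - a) / 2].
      apply/seteqP; split => t; rewrite /= in_itv /= ler_distl => /andP[h1 h2];
        apply/andP; split; lra.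
    have -> : (fun t : T => s * t) @^-1` [set t : T | `|t - (a + b) / 2| <= (b - a) / 2]
       = [set t : T | `|t - s * ((a + b) / 2)| <= (b - a) / 2].
      apply/funext => t; rewrite /preimage /=; congr (is_true (_ <= _)).
      have s1 := sqr1_norm s2.
      set q := (a + b) / 2.
      have -> : s * t - q = s * (t - s * q) by rewrite mulrBr mulrA -(expr2 s) s2 mul1r.
      by rewrite normrM s1 mul1r.
    change ((nr (E' [set t : T | `|t - s * ((a + b) / 2)| <= (b - a) / 2] (V y)) ^+ 2)%:E =
      (nr (E [set t : T | `|t - (a + b) / 2| <= (b - a) / 2] y) ^+ 2)%:E).
    by rewrite itv ?isoV // divr_ge0 // subr_ge0.
  - by move=> a b; rewrite hm1; apply: pvm_at_bound; apply: mpre; exact: measurable_itv.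
suff e : (fun y => W (E' ((fun t : T => s * t) @^-1` A) (V y))) = E A.
  by have /(congr1 V) := congr1 (@^~ x) e; rewrite WK.
apply: op_eq; last 1 first.
- move=> y; rewrite (adjointC VW).
  have := key y A mA; rewrite !pvm_atE !pvm_nr //; last exact: mpre.
  move=> [h].
  have mA' := mpre _ mA.
  rewrite (selfadj_inner_real _ (pvm_adj E mA)) -h.
  by rewrite -(selfadj_inner_real _ (pvm_adj E' mA')).
- by apply: linop_comp => //; apply: linop_comp => //; apply: pvm_lin; exact: mpre.
- exact: pvm_lin.
Qed.

End Intertwine.

(** * Von Neumann algebras and bounded functions of D *)

Section VonNeumann.
Context (R : realType) (H : hilbertSpace R) (N : set (H -> H)).
Context (hN : von_neumann N).
Implicit Types (x y z : H) (c : R[i]) (a b u v : H -> H).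

Lemma vn_bounded a : N a -> bounded_op a.
Proof. by case: hN => h _ _; exact: h. Qed.

Lemma vn_lin a : N a -> linear a.
Proof. by move=> /vn_bounded[]. Qed.

Lemma vn_adj a b : N a -> is_adjoint a b -> N b.
Proof.
by case: hN => _ h _ Na ab; have [b' ab' Nb'] := h _ Na; rewrite (adjoint_uniq ab ab').
Qed.

Lemma vn_bicomm a : bounded_op a ->
  (forall b, commutant N b -> forall x, a (b x) = b (a x)) -> N a.
Proof.
case: hN => _ _ e ba h; rewrite e; split => // b hb.
by apply/funext => x /=; exact: h.
Qed.

Lemma vn_comm a b x : N a -> commutant N b -> a (b x) = b (a x).
Proof. by move=> Na [_ /(_ _ Na) h]; have /= -> := congr1 (@^~ x) h. Qed.

Lemma vn_id : N id.
Proof. by apply: vn_bicomm => //; exact: bounded_id. Qed.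

Lemma vn_comp a b : N a -> N b -> N (a \o b).
Proof.
move=> Na Nb; apply: vn_bicomm => [|c hc x /=].
  by apply: bounded_comp; exact: vn_bounded.
by rewrite (vn_comm _ Nb hc) (vn_comm _ Na hc).
Qed.

Lemma vn_add a b : N a -> N b -> N (fun x => a x + b x).
Proof.
move=> Na Nb; apply: vn_bicomm => [|c hc x /=].
  by apply: bounded_add; exact: vn_bounded.
by rewrite (vn_comm _ Nb hc) (vn_comm _ Na hc) (linopD _ _ hc.1.1).
Qed.

Lemma vn_scale a c : N a -> N (fun x => c *: a x).
Proof.
move=> Na; apply: vn_bicomm => [|b hb x /=].
  by apply: bounded_scale; exact: vn_bounded.
by rewrite (vn_comm _ Na hb) (linopZ _ _ hb.1.1).
Qed.

Lemma vn_sub a b : N a -> N b -> N (fun x => a x - b x).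
Proof.
move=> Na Nb; have := vn_add Na (vn_scale (-1) Nb).
by rewrite (_ : (fun x => _) = (fun x => a x - b x)) //; apply/funext => x; rewrite scaleN1r.
Qed.

(** The bridge from affiliation, which speaks of unitaries of the commutant only, to the bicommutant
    condition. *)
Lemma vn_unitary a : bounded_op a ->
  (forall u, commutant N u -> unitary u -> forall x, a (u x) = u (a x)) -> N a.
Proof.
move=> ba h; apply: vn_bicomm => // b hb x.
case: hN => Nb Nadj _.
exact: (comm_commutant Nb Nadj ba.1 h hb).
Qed.

Lemma unitary_inv u : commutant N u -> unitary u ->
  exists v, [/\ is_adjoint u v, cancel v u, cancel u v, commutant N v & unitary v].
Proof.
move=> [bu cu] [_ [v [uv e1 e2]]].
have vK : cancel v u by move=> x; have /= := congr1 (@^~ x) e1.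
have uK : cancel u v by move=> x; have /= := congr1 (@^~ x) e2.
have bv := adjoint_bounded bu uv.
exists v; split => //; last by split => //; exists u; split => //; exact: adjointC.
split => // b Nb; apply/funext => x /=.
apply: (can_inj uK); rewrite vK.
by have /= -> := congr1 (@^~ (v x)) (cu _ Nb); rewrite vK.
Qed.

Lemma affiliated_pvm (D : set (H * H)) (E : pvm H) A : selfadjoint_op D ->
  affiliated N D -> is_spectral_measure D E -> measurable A -> N (E A).
Proof.
move=> D_sa aff hE mA; apply: vn_unitary; first exact: pvm_bounded.
move=> u cu uu x.
have [v [uv vK uK cv vv]] := unitary_inv cu uu.
have h1 w : commutant N w -> unitary w ->
    forall x y, D (x, y) -> D (w x, (1 : R)%:C *: w y).
  by move=> cw uw y z yz; rewrite scale1r; exact: aff.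
have := intertwine_pvm D_sa hE hE (s := 1) x cu.1 cv.1 uv vK uK (expr1n _ _)
   (h1 _ cu uu) (h1 _ cv vv) mA.
rewrite (_ : _ @^-1` A = A) //.
by apply/funext => t; rewrite /preimage /= mul1r.
Qed.

End VonNeumann.

Section ContinuousMeasurable.
Context (R : realType).

Lemma continuous_cfun (f : R -> R[i]) : continuous (f : R -> R[i]^o) ->
  continuous ((@complex.Re R \o f) : R -> R) /\ continuous ((@complex.Im R \o f) : R -> R).
Proof.
move=> cf; split=> t; apply/cvgrPdist_lt => e e0;
  have /cvgrPdist_lt/(_ e%:C) := cf t; rewrite ltcR => /(_ e0);
  apply: filterS => s /=; rewrite normc_def ltcR; apply: le_lt_trans;
  rewrite -sqrtr_sqr ler_sqrt ?addr_ge0 ?sqr_ge0 //; case: (f t) (f s) => [a b] [c d] /=;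
  by rewrite ?lerDl ?lerDr sqr_ge0.
Qed.

Lemma continuous_measurable_cfun (f : R -> R[i]) : continuous (f : R -> R[i]^o) ->
  measurable_cfun f.
Proof.
by move=> /continuous_cfun[c1 c2]; split; exact: continuous_measurable_fun.
Qed.

End ContinuousMeasurable.

(** * Bounded functions of D: commutation, normality, eigenvectors *)

Section BoundedCalculus.
Context (R : realType) (H : hilbertSpace R) (E : pvm H).
Local Notation T := (measurableTypeR R).
Context (f : R -> R[i]) (mf : measurable_cfun f) (h : H -> H).
Context (bh : bounded_op h) (hh : forall x, spectral_integral E f (x, h x)).
Implicit Types (x y z : H) (w c : R[i]) (A B : set T).

Lemma calc_comm A x : measurable A -> E A (h x) = h (E A x).
Proof.
move=> mA; have [/= s1 h1] := SI_comm mf mA (hh x); have [/= s2 h2] := hh (E A x).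
by apply: inner_inj => z; rewrite h1 ?h2 //; have [] := hh z.
Qed.

(** The map t -> s t carries the measure of V y to that of y and leaves f invariant, so the
    quadratic forms of W h V and of h coincide. *)
Lemma calc_intertwine (V W : H -> H) (s : R) : bounded_op V -> bounded_op W ->
  is_adjoint V W -> cancel W V -> (forall t, f (s * t) = f t) ->
  (forall A x, measurable A -> E ((fun t : T => s * t) @^-1` A) (V x) = V (E A x)) ->
  (forall x, nr (V x) = nr x) -> forall x, h (V x) = V (h x).
Proof.
move=> bV bW VW WK fs EV isoV x.
have ms : measurable_fun [set: T] ((fun t : T => s * t) : T -> T).
  exact: measurable_funM.
suff e : (fun y => W (h (V y))) = h.
  by have /(congr1 V) := congr1 (@^~ x) e; rewrite WK.
apply: op_eq => [||y].
- by apply: linop_comp => //; [exact: bW.1|apply: linop_comp; [exact: bh.1|exact: bV.1]].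
- exact: bh.1.
rewrite (adjointC VW) (SI_quad mf (hh _)) (SI_quad mf (hh _)).
have [m1 [hm1 int1]] := pushforward_measure_ex (pvm_at E (V y)) ms.
have push (u : R -> R) : measurable_fun [set: T] (u : T -> R) ->
    (forall t, u (s * t) = u t) ->
    (pvm_at E (V y)).-integrable [set: T] (EFin \o (u : T -> R)) ->
    \int[pvm_at E (V y)]_t u t = \int[pvm_at E y]_t u t.
  move=> mu us iu.
  transitivity (\int[m1]_t u t).
    rewrite int1 //; first by apply: eq_Rintegral => t _; rewrite us.
    by rewrite (_ : u \o _ = u) //; apply/funext => t /=; rewrite us.
  rewrite /Rintegral; congr fine; apply: eq_measure_integral => A mA _.
  rewrite hm1.
  change ((nr (E ((fun t : T => (s * t)%R) @^-1` A) (V y)) ^+ 2)%:E = (nr (E A y) ^+ 2)%:E).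
  by rewrite EV // isoV.
case: mf => mR mI.
have sq := (hh (V y)).1.
rewrite /cintegral; congr (_ +i* _); apply: push => //.
- by move=> t; rewrite fs.
- exact: Re_intg.
- by move=> t; rewrite fs.
- exact: Im_intg.
Qed.

(** h commutes with each unitary commuting with all E A, since such a unitary preserves the
    measures; the Cayley argument extends this to the whole commutant of the E A, to which the
    adjoint k belongs. *)
Lemma calc_normal (k : H -> H) : is_adjoint h k -> forall x, h (k x) = k (h x).
Proof.
move=> hk x.
pose S : set (H -> H) := [set a | exists2 A, measurable A & a = E A].
have Sb : S `<=` @bounded_op R H by move=> _ [A mA ->]; exact: pvm_bounded.
have Sadj a : S a -> exists2 b, is_adjoint a b & S b.
  by move=> [A mA ->]; exists (E A); [exact: pvm_adj|exists A].
apply: (comm_commutant Sb Sadj bh.1) => [u [bu cu] [_ [v [uv e1 e2]]] y|].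
  have vK : cancel v u by move=> z; have /= := congr1 (@^~ z) e1.
  have uK : cancel u v by move=> z; have /= := congr1 (@^~ z) e2.
  apply: (@calc_intertwine u v 1) => //.
  - exact: adjoint_bounded uv.
  - by move=> t; rewrite mul1r.
  - move=> A z mA; rewrite (_ : _ @^-1` A = A).
      by have /= -> := congr1 (@^~ z) (cu (E A) (ex_intro2 _ _ A mA erefl)).
    by apply/funext => t; rewrite /preimage /= mul1r.
  - move=> z; apply: (pexpIrn (n := 2)) => //; rewrite ?nnegrE ?nr_ge0 //.
    by rewrite !nr_sqr /ri uv uK.
split; first exact: adjoint_bounded hk.
move=> _ [A mA ->]; apply: (@adjoint_uniq _ _ (E A \o h)).
  by apply: adjoint_comp => //; exact: pvm_adj.
have -> : E A \o h = h \o E A by apply/funext => y /=; exact: calc_comm.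
by apply: adjoint_comp => //; exact: pvm_adj.
Qed.

Lemma calc_nr_adj (k : H -> H) x : is_adjoint h k -> nr (k x) = nr (h x).
Proof.
move=> hk; apply: (pexpIrn (n := 2)) => //; rewrite ?nnegrE ?nr_ge0 //.
by rewrite !nr_sqr /ri -hk calc_normal // (adjointC hk).
Qed.

(** On the range of E {t0} the lower bound holds for w and for - w, hence is an equality; w = 1 and
    w = - i give the two parts of the form. *)
Lemma calc_eigen (t0 : R) x : measurable [set t0] -> E [set t0] x = x -> h x = f t0 *: x.
Proof.
move=> mt Ex.
suff e : (fun y => E [set t0] (h (E [set t0] y))) = (fun y => f t0 *: E [set t0] y).
  have := congr1 (@^~ x) e.
  by rewrite /= Ex calc_comm // Ex.
have lE := pvm_lin E mt.
apply: op_eq => [||y].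
- by apply: linop_comp => //; apply: linop_comp => //; exact: bh.1.
- exact: linop_scale.
rewrite pvm_adj // innerZl; set z := E [set t0] y.
have zz : E [set t0] z = z by rewrite pvmK.
have -> : '[z | y] = '[z | z] by rewrite -{1}zz pvm_adj.
have key w : Re (w * '[h z | z]) = Re (w * f t0) * nr z ^+ 2.
  apply/eqP; rewrite eq_le; apply/andP; split.
    rewrite -lerN2 -raddfN -!mulNr.
    have := SI_ge mf (w := - w) (k := - Re (w * f t0)) mt (hh z) zz.
    by rewrite -raddfN; apply=> t ->; rewrite mulNr.
  by apply: (SI_ge mf mt (hh z) zz) => t ->.
rewrite inner_nr.
have := key 1; have := key (- 'i%C); rewrite !mul1r.
case: '[h z | z] => a b; case: (f t0) => c d /= k1 k2.
by apply/eqP; rewrite eq_complex /=; apply/andP; split; apply/eqP; lra.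
Qed.

End BoundedCalculus.

(** * Traces *)

Section Projections.
Context (R : realType) (H : hilbertSpace R).
Implicit Types (x y z : H) (c : R[i]) (r : R) (a b p q : H -> H).

Lemma orthoprojK p x : orthoproj p -> p (p x) = p x.
Proof. by case=> _ h _; have /= := congr1 (@^~ x) h. Qed.

Lemma orthoproj_inner p x : orthoproj p -> '[p x | x] = '[p x | p x].
Proof. by move=> pp; have [_ _ h] := pp; rewrite [RHS]h orthoprojK // h. Qed.

Lemma orthoproj_ri p x : orthoproj p -> ri (p x) x = nr (p x) ^+ 2.
Proof. by move=> pp; rewrite nr_sqr /ri orthoproj_inner. Qed.

Lemma orthoproj_nr p x : orthoproj p -> nr (p x) <= nr x.
Proof.
move=> pp; have [h|h] := eqVneq (p x) 0; first by rewrite h nr0 nr_ge0.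
by rewrite -(ler_pM2l (nr_gt0 h)) -expr2 -orthoproj_ri // ri_le.
Qed.

Lemma orthoproj_positive p : orthoproj p -> positive_op p.
Proof.
move=> pp; split=> [|x]; first by case: pp.
by rewrite orthoproj_inner // inner_nr ler0c sqr_ge0.
Qed.

Lemma orthoproj_perp p : orthoproj p -> orthoproj (perp p).
Proof.
move=> pp; have [bp _ ap] := pp; split.
- have := bounded_add (@bounded_id R H) (bounded_scale (-1) bp).
  by rewrite (_ : (fun x => _) = perp p) //; apply/funext => x; rewrite scaleN1r.
- apply/funext => x; rewrite /perp /= (linopB _ _ bp.1) orthoprojK // subrr.
  by rewrite subr0.
- by move=> x y; rewrite /perp innerBl innerBr ap.
Qed.

Lemma orthoproj_comp p q : orthoproj p -> orthoproj q ->
  (forall x, p (q x) = q (p x)) -> orthoproj (p \o q).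
Proof.
move=> pp qq pq; have [bp _ ap] := pp; have [bq _ aq] := qq; split.
- exact: bounded_comp.
- by apply/funext => x /=; rewrite -pq (orthoprojK _ qq) orthoprojK.
- by move=> x y /=; rewrite ap aq pq.
Qed.

Lemma orthoproj_range p x : orthoproj p -> range p x <-> p x = x.
Proof.
by move=> pp; split=> [[y _ <-]|<-]; [rewrite orthoprojK|exists x].
Qed.

Lemma orthoproj_range_inj p q : orthoproj p -> orthoproj q -> range p = range q -> p = q.
Proof.
move=> pp qq e; have [_ _ ap] := pp; have [_ _ aq] := qq.
have qp x : q (p x) = p x.
  by apply/(orthoproj_range _ qq); rewrite -e; exists x.
have pq x : p (q x) = q x.
  by apply/(orthoproj_range _ pp); rewrite e; exists x.
apply/funext => x; apply: inner_inj => y.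
by rewrite -qp aq ap pq -aq.
Qed.

Lemma proj_onto_eq p (V : set H) : orthoproj p -> range p = V -> proj_onto V = p.
Proof.
move=> pp e; rewrite /proj_onto; case: xgetP => [q _ [qq eq_]|/(_ p)].
  by apply: orthoproj_range_inj; rewrite // e.
by move=> []; split.
Qed.

Lemma positive_add p q : positive_op p -> positive_op q -> positive_op (fun x => p x + q x).
Proof.
move=> [bp hp] [bq hq]; split; first exact: bounded_add.
by move=> x; rewrite innerDl addr_ge0.
Qed.

Lemma positive_scale r p : 0 <= r -> positive_op p -> positive_op (fun x => r%:C *: p x).
Proof.
move=> r0 [bp hp]; split; first exact: bounded_scale.
by move=> x; rewrite innerZl mulr_ge0 // ler0c.
Qed.

Lemma positive_comp_proj p q : positive_op p -> orthoproj q ->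
  (forall x, p (q x) = q (p x)) -> positive_op (q \o p).
Proof.
move=> [bp hp] qq pq; have [bq _ aq] := qq; split; first exact: bounded_comp.
by move=> x /=; rewrite -(orthoprojK _ qq) aq -pq.
Qed.

Lemma comp_proj_le p q : positive_op p -> orthoproj q ->
  (forall x, p (q x) = q (p x)) -> op_le (q \o p) p.
Proof.
move=> pp qq pq x /=; rewrite -subr_ge0 -innerBl.
have [] := positive_comp_proj pp (orthoproj_perp qq) _.
  by move=> y; rewrite /perp (linopB _ _ pp.1.1) pq.
by move=> _ /(_ x).
Qed.

End Projections.

(** * The trace and its linear extension *)

Section TraceFacts.
Context (R : realType) (H : hilbertSpace R) (N : set (H -> H)).
Context (tau : (H -> H) -> \bar R).
Context (hN : von_neumann N) (htau : is_trace N tau).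
Implicit Types (x y z : H) (c : R[i]) (r : R) (a b p q : H -> H).

Lemma tau_ge0 a : pos_cone N a -> (0 <= tau a)%E.
Proof. by case: htau => h _ _ _; exact: h. Qed.

Lemma tau_add a b : pos_cone N a -> pos_cone N b ->
  tau (fun x => a x + b x) = (tau a + tau b)%E.
Proof. by case: htau => _ h _ _; exact: h. Qed.

Lemma tau_scale r a : 0 <= r -> pos_cone N a ->
  tau (fun x => r%:C *: a x) = (r%:E * tau a)%E.
Proof. by case: htau => _ _ h _; exact: h. Qed.

Lemma tau_comm a b : N a -> is_adjoint a b -> tau (b \o a) = tau (a \o b).
Proof. by case: htau => _ _ _; apply. Qed.

Lemma pos_cone_add a b : pos_cone N a -> pos_cone N b -> pos_cone N (fun x => a x + b x).
Proof. by move=> [Na pa] [Nb pb]; split; [exact: vn_add|exact: positive_add]. Qed.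

Lemma pos_cone_scale r a : 0 <= r -> pos_cone N a -> pos_cone N (fun x => r%:C *: a x).
Proof. by move=> r0 [Na pa]; split; [exact: vn_scale|exact: positive_scale]. Qed.

Lemma pos_cone0 : pos_cone N (fun=> 0).
Proof.
have -> : (fun=> 0) = (fun x : H => (0 : R)%:C *: id x).
  by apply/funext => x; rewrite scale0r.
apply: pos_cone_scale => //; split; first exact: vn_id.
by split=> [|x]; [exact: bounded_id|rewrite inner_nr ler0c sqr_ge0].
Qed.

Lemma tau0 : tau (fun=> 0) = 0%E.
Proof.
have := tau_scale (lexx 0) pos_cone0; rewrite mul0e => <-.
by congr tau; apply/funext => x; rewrite scaler0.
Qed.

Lemma pos_cone_proj p : N p -> orthoproj p -> pos_cone N p.
Proof. by move=> Np pp; split=> //; exact: orthoproj_positive. Qed.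

Lemma tau_mono a b : pos_cone N a -> pos_cone N b -> op_le a b -> (tau a <= tau b)%E.
Proof.
move=> [Na pa] [Nb pb] ab.
have hd : pos_cone N (fun x => b x - a x).
  have Nd := vn_sub hN Nb Na; split=> //; split; first exact: vn_bounded Nd.
  by move=> x; rewrite innerBl subr_ge0.
have -> : b = (fun x => a x + (b x - a x)) by apply/funext => x; rewrite addrC subrK.
by rewrite tau_add // leeDl // tau_ge0.
Qed.

Lemma fin_cone_le a b : pos_cone N a -> fin_cone N tau b -> op_le a b -> fin_cone N tau a.
Proof.
move=> pa [pb fb] ab; split=> //.
by apply: le_lt_trans fb; exact: tau_mono.
Qed.

Lemma fin_tauE a : fin_cone N tau a -> tau a = (fine (tau a))%:E.
Proof. by move=> [pa fa]; rewrite fineK // ge0_fin_numE // tau_ge0. Qed.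

Lemma fin_cone_add a b : fin_cone N tau a -> fin_cone N tau b ->
  fin_cone N tau (fun x => a x + b x).
Proof.
move=> [pa fa] [pb fb]; split; first exact: pos_cone_add.
by rewrite tau_add // lte_add_pinfty.
Qed.

Lemma fine_tau_add a b : fin_cone N tau a -> fin_cone N tau b ->
  fine (tau (fun x => a x + b x)) = fine (tau a) + fine (tau b).
Proof.
move=> fa fb; rewrite tau_add ?fineD //; [by rewrite fin_tauE|by rewrite fin_tauE|exact: fa.1|exact: fb.1].
Qed.

Lemma fin_cone_scale r a : 0 <= r -> fin_cone N tau a ->
  fin_cone N tau (fun x => r%:C *: a x).
Proof.
move=> r0 fa; split; first exact: pos_cone_scale r0 fa.1.
by rewrite (tau_scale r0 fa.1) (fin_tauE fa) -EFinM ltry.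
Qed.

Lemma fine_tau_scale r a : 0 <= r -> fin_cone N tau a ->
  fine (tau (fun x => r%:C *: a x)) = r * fine (tau a).
Proof. by move=> r0 fa; rewrite (tau_scale r0 fa.1) (fin_tauE fa). Qed.

Lemma fin_cone0 : fin_cone N tau (fun=> 0).
Proof. by split; [exact: pos_cone0|rewrite tau0 ltry]. Qed.

(** The relation from which [tr] chooses a value; linearity and uniqueness are proved at this level,
    and [has_trace_tr] passes to [tr]. *)
Definition has_trace a c : Prop := exists a0 a1 a2 a3,
  [/\ [/\ fin_cone N tau a0, fin_cone N tau a1,
          fin_cone N tau a2 & fin_cone N tau a3],
      a = (fun x => a0 x - a1 x + 'i%C *: (a2 x - a3 x)) &
      c = (fine (tau a0) - fine (tau a1)) +i*
          (fine (tau a2) - fine (tau a3))].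

(** Quadratic forms separate the real and imaginary parts. An equality s - t = u - v of positive
    operators is then rewritten as s + v = u + t, to which additivity of [tau] on the cone
    applies. *)
Lemma has_trace_uniq a c c' : has_trace a c -> has_trace a c' -> c = c'.
Proof.
move=> [a0 [a1 [a2 [a3 [[f0 f1 f2 f3] -> ->]]]]].
move=> [b0 [b1 [b2 [b3 [[g0 g1 g2 g3] e ->]]]]].
have q x : (ri (a0 x) x - ri (a1 x) x) +i* (ri (a2 x) x - ri (a3 x) x) =
           (ri (b0 x) x - ri (b1 x) x) +i* (ri (b2 x) x - ri (b3 x) x).
  have := congr1 (fun g => '[g x | x]) e.
  rewrite !innerDl !innerNl !innerZl !innerDl !innerNl.
  rewrite !positive_ri; [|exact: g3.1.2|exact: g2.1.2|exact: g1.1.2|exact: g0.1.2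
    |exact: f3.1.2|exact: f2.1.2|exact: f1.1.2|exact: f0.1.2].
  by move=> [h1 h2]; apply/eqP; rewrite eq_complex /=; apply/andP; split; apply/eqP; lra.
have key s t u v : fin_cone N tau s -> fin_cone N tau t -> fin_cone N tau u ->
    fin_cone N tau v -> (forall x, ri (s x) x - ri (t x) x = ri (u x) x - ri (v x) x) ->
    fine (tau s) - fine (tau t) = fine (tau u) - fine (tau v).
  move=> fs ft fu fv h.
  have : (fun x => s x + v x) = (fun x => u x + t x).
    apply: positive_op_eq.
    - by apply: positive_add; [exact: fs.1.2|exact: fv.1.2].
    - by apply: positive_add; [exact: fu.1.2|exact: ft.1.2].
    - by move=> x; rewrite !riDl; have := h x; lra.
  move=> /(congr1 (fun g => fine (tau g))); rewrite !fine_tau_add //; lra.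
apply/eqP; rewrite eq_complex /=; apply/andP; split; apply/eqP; apply: key => // x.
  by have [] := q x.
by have [] := q x.
Qed.

Lemma has_trace_tr a c : has_trace a c -> tr N tau a = c.
Proof.
move=> h; rewrite /tr; case: xgetP => [d _ hd|/(_ c) /(_ h) //].
exact: has_trace_uniq hd h.
Qed.

Lemma has_trace_fin a : fin_cone N tau a -> has_trace a (fine (tau a))%:C.
Proof.
move=> fa; exists a, (fun=> 0), (fun=> 0), (fun=> 0); split.
- by split=> //; exact: fin_cone0.
- by apply/funext => x; rewrite !subr0 scaler0 addr0.
- by rewrite tau0 /= !subr0.
Qed.

Lemma has_trace_add a b c d : has_trace a c -> has_trace b d ->
  has_trace (fun x => a x + b x) (c + d).
Proof.
move=> [a0 [a1 [a2 [a3 [[f0 f1 f2 f3] -> ->]]]]].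
move=> [b0 [b1 [b2 [b3 [[g0 g1 g2 g3] -> ->]]]]].
exists (fun x => a0 x + b0 x), (fun x => a1 x + b1 x),
  (fun x => a2 x + b2 x), (fun x => a3 x + b3 x); split.
- by split; exact: fin_cone_add.
- apply/funext => x; rewrite addrACA -scalerDr; congr (_ + _ *: _).
    by rewrite opprD addrACA.
  by rewrite opprD addrACA.
- by rewrite !fine_tau_add //; apply/eqP; rewrite eq_complex /=; apply/andP; split; apply/eqP; ring.
Qed.

(** Multiplication by i permutes the four positive parts; applied twice it gives negation. *)
Lemma has_trace_i a c : has_trace a c -> has_trace (fun x => 'i%C *: a x) ('i%C * c).
Proof.
move=> [a0 [a1 [a2 [a3 [[f0 f1 f2 f3] -> ->]]]]].
exists a3, a2, a0, a1; split => //.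
  apply/funext => x; rewrite scalerDr scalerA -expr2 sqr_i scaleN1r opprB.
  by rewrite addrC.
by apply/eqP; rewrite eq_complex /=; apply/andP; split; apply/eqP; ring.
Qed.

Lemma has_trace_opp a c : has_trace a c -> has_trace (fun x => - a x) (- c).
Proof.
move=> /has_trace_i/has_trace_i; rewrite mulrA -expr2 sqr_i mulN1r.
rewrite (_ : (fun x => _) = (fun x => - a x)) //.
by apply/funext => x; rewrite scalerA -expr2 sqr_i scaleN1r.
Qed.

Lemma has_trace_real r a c : has_trace a c -> has_trace (fun x => r%:C *: a x) (r%:C * c).
Proof.
wlog r0 : r a c / 0 <= r.
  move=> h; have [r0|r0] := leP 0 r; first exact: h.
  move=> /has_trace_opp h2.
  have r0' : 0 <= - r by rewrite oppr_ge0 ltW.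
  have := h (- r) _ _ r0' h2.
  have -> : (- r)%:C * - c = r%:C * c by rewrite -mulrNN opprK -rmorphN opprK.
  rewrite (_ : (fun x => _) = (fun x => r%:C *: a x)) //.
  by apply/funext => x; rewrite rmorphN scaleNr scalerN opprK.
move=> [a0 [a1 [a2 [a3 [[f0 f1 f2 f3] -> ->]]]]].
exists (fun x => r%:C *: a0 x), (fun x => r%:C *: a1 x),
  (fun x => r%:C *: a2 x), (fun x => r%:C *: a3 x); split.
- by split; exact: fin_cone_scale.
- apply/funext => x; rewrite scalerDr scalerBr; congr (_ + _).
  by rewrite scalerA mulrC -scalerA scalerBr.
- by rewrite !fine_tau_scale //; apply/eqP; rewrite eq_complex /=; apply/andP; split; apply/eqP; ring.
Qed.

Lemma has_trace_scale d a c : has_trace a c -> has_trace (fun x => d *: a x) (d * c).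
Proof.
move=> h; have := has_trace_add (has_trace_real (Re d) h)
  (has_trace_i (has_trace_real (Im d) h)).
rewrite (_ : _ + _ = d * c).
  rewrite (_ : (fun x => _) = (fun x => d *: a x)) //.
  by apply/funext => x; rewrite scalerA -scalerDl -complexE.
by rewrite mulrA -mulrDl -complexE.
Qed.

Lemma has_trace_sub a b c d : has_trace a c -> has_trace b d ->
  has_trace (fun x => a x - b x) (c - d).
Proof. by move=> ha /has_trace_opp hb; exact: has_trace_add ha hb. Qed.

End TraceFacts.

(** * Step functions of D and normality of the trace *)

Section SimpleOperators.
Context (R : realType) (H : hilbertSpace R) (N : set (H -> H)).
Context (tau : (H -> H) -> \bar R) (hN : von_neumann N) (htau : fns_trace N tau).
Context (E : pvm H) (EN : forall A, measurable A -> N (E A)).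
Local Notation T := (measurableTypeR R).
Implicit Types (x y z : H) (c r : R) (A B : set T) (Q p : H -> H) (l : seq (R * set T)).

Let tr_tau : is_trace N tau. Proof. by case: htau. Qed.

Definition simple_op Q l : H -> H :=
  fun x => \sum_(k <- l) (k.1)%:C *: E k.2 (Q x).

(** Written with [-1 * t] to agree with [intertwine_pvm] at s = -1. *)
Definition even_set A : Prop := (fun t : T => -1 * t) @^-1` A = A.

Definition admissible l : Prop :=
  forall k, List.In k l -> [/\ 0 <= k.1, measurable k.2 & even_set k.2].

Lemma admissible_cons k l : admissible (k :: l) ->
  [/\ 0 <= k.1, measurable k.2, even_set k.2 & admissible l].
Proof.
move=> h; have [h1 h2 h3] := h k (or_introl erefl); split=> // k' k'l.
by apply: h; right.
Qed.

(** Commutation is asked for symmetric sets only, because gamma exchanges E A and E (- A). *)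
Definition commuting_proj Q : Prop :=
  [/\ N Q, orthoproj Q & forall A x, measurable A -> even_set A -> E A (Q x) = Q (E A x)].

Lemma pvm_comp_proj Q A : commuting_proj Q -> measurable A -> even_set A -> orthoproj (E A \o Q).
Proof.
move=> [_ qq hQ] mA eA; apply: orthoproj_comp => //; first exact: pvm_proj.
by move=> x; exact: hQ.
Qed.

Lemma pvm_comp_cone Q A : commuting_proj Q -> measurable A -> even_set A -> pos_cone N (E A \o Q).
Proof.
move=> hQ mA eA; apply: pos_cone_proj; last exact: pvm_comp_proj.
by apply: vn_comp => //; [exact: EN|case: hQ].
Qed.

Lemma simple_op_cons Q k l :
  simple_op Q (k :: l) = (fun x => (k.1)%:C *: (E k.2 \o Q) x + simple_op Q l x).
Proof. by apply/funext => x; rewrite /simple_op big_cons. Qed.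

Lemma simple_op_cone Q l : commuting_proj Q -> admissible l -> pos_cone N (simple_op Q l).
Proof.
move=> hQ; elim: l => [_|k l IH /admissible_cons[k0 mk ek hl]].
  rewrite (_ : simple_op Q [::] = fun=> 0); first exact: pos_cone0.
  by apply/funext => x; rewrite /simple_op big_nil.
rewrite simple_op_cons; apply: pos_cone_add => //; last exact: IH.
by apply: pos_cone_scale => //; exact: pvm_comp_cone.
Qed.

Lemma tau_simple_op Q l : commuting_proj Q -> admissible l ->
  tau (simple_op Q l) = (\sum_(k <- l) (k.1)%:E * tau (E k.2 \o Q))%E.
Proof.
move=> hQ; elim: l => [_|k l IH /admissible_cons[k0 mk ek hl]].
  rewrite big_nil (_ : simple_op Q [::] = fun=> 0); first exact: (tau0 hN tr_tau).
  by apply/funext => x; rewrite /simple_op big_nil.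
rewrite simple_op_cons big_cons (tau_add tr_tau); first 1 last.
- by apply: pos_cone_scale => //; exact: pvm_comp_cone.
- exact: simple_op_cone.
by rewrite IH // (tau_scale tr_tau k0 (pvm_comp_cone hQ mk ek)).
Qed.

Lemma ri_simple_op Q l x : commuting_proj Q -> admissible l ->
  ri (simple_op Q l x) x = \sum_(k <- l) k.1 * nr (E k.2 (Q x)) ^+ 2.
Proof.
move=> hQ; elim: l => [_|k l IH /admissible_cons[k0 mk ek hl]].
  by rewrite /simple_op !big_nil ri0l.
rewrite simple_op_cons big_cons riDl IH // riZl; congr (_ * _ + _).
by rewrite (orthoproj_ri x (pvm_comp_proj hQ mk ek)).
Qed.

Lemma integral_simple (mu : {measure set T -> \bar R}) B l : measurable B ->
  admissible l -> (forall k, List.In k l -> k.2 `<=` B) ->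
  (\int[mu]_(t in B) (\sum_(k <- l) (k.1 * \1_(k.2) t))%R%:E =
   \sum_(k <- l) (k.1)%:E * mu k.2)%E.
Proof.
move=> mB; elim: l => [_ _|k l IH /admissible_cons[k0 mk ek hl] hB].
  under eq_integral do rewrite big_nil.
  by rewrite big_nil integral0.
rewrite big_cons -IH //; last by move=> k' h; apply: hB; right.
have msum l' : admissible l' ->
    measurable_fun B (fun t : T => (\sum_(k <- l') k.1 * \1_(k.2) t)%R%:E).
  elim: l' => [_|k' l' IH' /admissible_cons[k0' mk' ek' hl']].
    by under eq_fun do rewrite big_nil; exact: measurable_cst.
  under eq_fun do rewrite big_cons EFinD.
  apply: emeasurable_funD; last exact: IH'.
  apply/measurable_EFinP; apply: measurable_funM; [exact: measurable_cst|exact: measurable_indic].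
under eq_integral do rewrite big_cons EFinD.
rewrite ge0_integralD //=.
- congr (_ + _)%E; under eq_integral do rewrite EFinM.
  rewrite ge0_integralZl //=.
  + by rewrite integral_indic // setIidl //; apply: hB; left.
  + by apply/measurable_EFinP; exact: measurable_indic.
- by move=> t _; rewrite lee_fin mulr_ge0.
- apply/measurable_EFinP; apply: measurable_funM; [exact: measurable_cst|exact: measurable_indic].
- move=> t _; rewrite lee_fin.
  elim: l hl {IH hB} => [_|k' l' IH' /admissible_cons[k0' mk' ek' hl']]; first by rewrite big_nil.
  by rewrite big_cons addr_ge0 ?mulr_ge0 //; exact: IH'.
- exact: msum.
Qed.

(** The dyadic approximation [approx] unfolded into pairs of a coefficient and a set, so that [tau]
    can be evaluated term by term; the last entry is the truncation at height n. *)
Definition dyadic_list B (u : T -> R) n : seq (R * set T) :=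
  [seq (k%:R * 2 ^- n, dyadic_approx B (EFin \o u) n k) | k <- index_iota 0 (n * 2 ^ n)] ++
  [:: (n%:R, integer_approx B (EFin \o u) n)].

Lemma dyadic_listE B u n t :
  \sum_(k <- dyadic_list B u n) (k.1 * \1_(k.2) t) = approx B (EFin \o u) n t.
Proof.
by rewrite /dyadic_list big_cat big_map big_seq1 /= /approx big_mkord.
Qed.

Lemma dyadic_list_cases B u n (Pr : R * set T -> Prop) :
  (forall k, Pr (k%:R * 2 ^- n, dyadic_approx B (EFin \o u) n k)) ->
  Pr (n%:R, integer_approx B (EFin \o u) n) ->
  forall k, List.In k (dyadic_list B u n) -> Pr k.
Proof.
move=> h1 h2 k; rewrite /dyadic_list.
elim: (index_iota 0 (n * 2 ^ n)) => [|i s IH] /=; first by case=> [<-|[]].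
by case=> [<-|hk]; [exact: h1|exact: IH].
Qed.

(** The sets are level sets of u within B, or empty, and inherit the symmetry of u and B. *)
Lemma dyadic_list_admissible B u n : measurable B -> measurable_fun B u ->
  even_set B -> (forall t, u (-1 * t) = u t) -> admissible (dyadic_list B u n).
Proof.
move=> mB /measurable_EFinP mu eB eu.
have even_sep (C : set \bar R) :
    even_set (B `&` [set t | C (u t)%:E]).
  rewrite /even_set preimage_setI eB; congr (_ `&` _).
  by apply/funext => t; rewrite /preimage /= eu.
apply: dyadic_list_cases => [k|] /=; split.
- by rewrite mulr_ge0 // invr_ge0 exprn_ge0.
- rewrite /dyadic_approx; case: ifPn => [kn|_]//.
  rewrite (_ : [set x | _] = (EFin \o u) @^-1` (EFin @` [set` @dyadic_itv R n k])).
    by apply: mu => //; apply/measurable_image_EFin; exact: measurable_itv.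
  by apply/seteqP; split=> t /=; rewrite inE.
- rewrite /dyadic_approx; case: ifPn => [kn|_]; last by rewrite /even_set preimage_set0.
  exact: (even_sep [set y | y \in EFin @` [set` @dyadic_itv R n k]]).
- by [].
- rewrite /integer_approx.
  rewrite (_ : [set x | _] = (EFin \o u) @^-1` `[n%:R%:E, +oo[%classic).
    by apply: mu => //; exact: emeasurable_itv.
  by apply/seteqP; split=> t; rewrite /= in_itv /= andbT.
- exact: (even_sep [set y | (n%:R%:E <= y)%E]).
Qed.

Lemma dyadic_list_sub B u n k : List.In k (dyadic_list B u n) -> k.2 `<=` B.
Proof.
move: k; apply: dyadic_list_cases => [k|] /=.
  by rewrite /dyadic_approx; case: ifPn => _ //; exact: subIsetl.
exact: subIsetl.
Qed.

(* By normality, since the dyadic step functions increase to u. *)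
Lemma tau_sup_simple_op Q p B (u : T -> R) : commuting_proj Q -> pos_cone N p ->
  (forall x, p (Q x) = Q (p x)) -> measurable B -> measurable_fun B u ->
  even_set B -> (forall t, u (-1 * t) = u t) -> (forall t, B t -> 0 <= u t) ->
  (forall x, (\int[pvm_at E x]_(t in B) (u t)%:E = (ri (p x) x)%:E)%E) ->
  tau (Q \o p) = ereal_sup (range (fun n => tau (simple_op Q (dyadic_list B u n)))).
Proof.
move=> hQ [Np pp] pQ mB mu eB eu u0 hp; have [NQ qq _] := hQ.
have mu' : measurable_fun B (EFin \o u) by exact/measurable_EFinP.
pose s n := simple_op Q (dyadic_list B u n).
have adm n : admissible (dyadic_list B u n) by exact: dyadic_list_admissible.
have sub n k : List.In k (dyadic_list B u n) -> k.2 `<=` B by exact: dyadic_list_sub.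
have sc n : pos_cone N (s n) by exact: simple_op_cone.
have u0' t : B t -> (0 <= (EFin \o u) t)%E by move=> Bt; rewrite lee_fin u0.
have mapp n : measurable_fun B (fun t => (approx B (EFin \o u) n t)%:E).
  under eq_fun do rewrite -dyadic_listE.
  apply/measurable_EFinP; move: (adm n); elim: (dyadic_list B u n) => [_|k l IH].
    by under eq_fun do rewrite big_nil; exact: measurable_cst.
  move=> /admissible_cons[k0 mk ek hl]; under eq_fun do rewrite big_cons.
  by apply: measurable_funD; [apply: measurable_funM; [exact: measurable_cst|exact: measurable_indic]|exact: IH].
have app0 n t : (0 <= (approx B (EFin \o u) n t)%:E)%E.
  rewrite lee_fin -dyadic_listE; move: (adm n).
  elim: (dyadic_list B u n) => [_|k l IH /admissible_cons[k0 mk ek hl]].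
    by rewrite big_nil.
  by rewrite big_cons addr_ge0 ?mulr_ge0 //; exact: IH.
have ris n x : (ri (s n x) x)%:E =
    (\int[pvm_at E (Q x)]_(t in B) (approx B (EFin \o u) n t)%:E)%E.
  under eq_integral do rewrite -dyadic_listE.
  rewrite integral_simple //; last by move=> k; exact: sub.
  rewrite ri_simple_op // -sumEFin; apply: eq_bigr => k _.
  by rewrite EFinM.
(* The form of Q p at x is that of p at Q x, Q being a projection that commutes with p. *)
have rip x : (ri ((Q \o p) x) x)%:E = (\int[pvm_at E (Q x)]_(t in B) (u t)%:E)%E.
  rewrite hp pQ /=; congr (_%:E); have [_ _ aQ] := qq.
  by rewrite /ri -[in LHS](orthoprojK _ qq) aQ.
have Qpc : pos_cone N (Q \o p).
  by split; [exact: vn_comp|exact: positive_comp_proj].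
have ndapp n m t : (n <= m)%N ->
    ((approx B (EFin \o u) n t)%:E <= (approx B (EFin \o u) m t)%:E)%E.
  by move=> nm; rewrite lee_fin; have /lefP := nd_approx B (EFin \o u) nm; exact.
have [_ _ nrm _] := htau.
have -> : range (fun n => tau (simple_op Q (dyadic_list B u n))) = [set tau b | b in range s].
  apply/seteqP; split=> [_ [n _ <-]|_ [_ [n _ <-] <-]]; last by exists n.
  by exists (s n) => //; exists n.
apply: nrm.
- by move=> _ [n _ <-].
- split; first by exists (s 0%N), 0%N.
  move=> _ _ [n _ <-] [m _ <-]; exists (s (maxn n m)); split; first by exists (maxn n m).
    apply/op_leP; [exact: (sc _).2|exact: (sc _).2|move=> x].
    rewrite -lee_fin !ris; apply: ge0_le_integral => // t _.
    by apply: ndapp; exact: leq_maxl.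
  apply/op_leP; [exact: (sc _).2|exact: (sc _).2|move=> x].
  rewrite -lee_fin !ris; apply: ge0_le_integral => // t _.
  by apply: ndapp; exact: leq_maxr.
- split=> //.
    move=> _ [n _ <-]; apply/op_leP; [exact: (sc _).2|exact: Qpc.2|move=> x].
    rewrite -lee_fin ris rip; apply: ge0_le_integral => // t Bt.
    exact: (le_approx n u0' Bt).
  move=> c [Nc pc] hc; apply/op_leP; [exact: Qpc.2|exact: pc|move=> x].
  rewrite -lee_fin rip.
  (* Leastness: an upper bound dominates the forms of all the steps, hence their limit, which
     monotone convergence identifies with the form of Q p. *)
  have cv := cvg_monotone_convergence (mu := pvm_at E (Q x)) mB mapp
    (fun n t _ => app0 n t) (fun t _ n m nm => ndapp n m t nm).
  have e : (\int[pvm_at E (Q x)]_(t in B) (u t)%:E =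
     \int[pvm_at E (Q x)]_(t in B) (limn (fun n => (approx B (EFin \o u) n t)%:E)))%E.
    apply: eq_integral => t; rewrite inE => Bt.
    by apply/esym/cvg_lim => //; exact: (ecvg_approx u0' Bt).
  rewrite e -(cvg_lim _ cv) //; apply: lime_le; first by apply/cvg_ex; eexists; exact: cv.
  apply: nearW => n; rewrite -ris lee_fin.
  by have /op_leP := hc (s n) (ex_intro2 _ _ n I erefl); apply => //; exact: (sc n).2.
Qed.

End SimpleOperators.

(** * The grading *)

Section Graded.
Context (R : realType) (H : hilbertSpace R) (N : set (H -> H)).
Context (tau : (H -> H) -> \bar R) (hN : von_neumann N) (htau : fns_trace N tau).
Context (E : pvm H) (EN : forall A, measurable A -> N (E A)).
Local Notation T := (measurableTypeR R).
Context (gamma : H -> H) (gN : N gamma) (gK : involutive gamma).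
Context (gsa : is_adjoint gamma gamma).
Context (gE : forall (A : set T) x, measurable A ->
  E ((fun t : T => -1 * t) @^-1` A) (gamma x) = gamma (E A x)).
Implicit Types (x y z : H) (r : R) (A B : set T).

Let tr_tau : is_trace N tau. Proof. by case: htau. Qed.
Local Notation P := (grading_proj gamma).
Let bg : bounded_op gamma. Proof. exact: vn_bounded gN. Qed.

Lemma half_scale x : 2%:R^-1 *: (x + x) = x :> H.
Proof.
rewrite -{1 2}[x]scale1r -scalerDl scalerA (_ : 1 + 1 = 2%:R) //.
by rewrite mulVf ?scale1r // pnatr_eq0.
Qed.

Lemma gradingE x : P x = 2%:R^-1 *: (gamma x + x).
Proof. by []. Qed.

Lemma perp_gradingE x : perp P x = 2%:R^-1 *: (x - gamma x).
Proof.
by rewrite /perp gradingE -{1}(half_scale x) -scalerBr opprD addrACA subrr addr0 addrC.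
Qed.

Lemma gamma_split x : gamma x = P x - perp P x.
Proof.
by rewrite gradingE perp_gradingE -scalerBr opprB addrACA subrr addr0 half_scale.
Qed.

Lemma gamma_grading x : gamma (P x) = P x.
Proof. by rewrite !gradingE (linopZ _ _ bg.1) (linopD _ _ bg.1) gK addrC. Qed.

Lemma grading_fix x : gamma x = x -> P x = x.
Proof. by move=> h; rewrite gradingE h half_scale. Qed.

Lemma orthoproj_grading : orthoproj P.
Proof.
split.
- by apply: bounded_scale; apply: bounded_add => //; exact: bounded_id.
- by apply/funext => x /=; exact/grading_fix/gamma_grading.
- move=> x y; rewrite !gradingE innerZl innerZr innerDl innerDr gsa.
  by rewrite fmorphV rmorph_nat.
Qed.

Lemma vn_grading : N P.
Proof. by apply: vn_scale => //; apply: vn_add => //; exact: vn_id. Qed.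

Lemma orthoproj_perp_grading : orthoproj (perp P).
Proof. exact/orthoproj_perp/orthoproj_grading. Qed.

Lemma vn_perp_grading : N (perp P).
Proof. by apply: (vn_sub hN _ vn_grading); exact: vn_id. Qed.

Lemma grading_comm (a : H -> H) x : linear a -> a (gamma x) = gamma (a x) ->
  a (P x) = P (a x).
Proof. by move=> la e; rewrite !gradingE (linopZ _ _ la) (linopD _ _ la) e. Qed.

Lemma perp_grading_comm (a : H -> H) x : linear a -> a (gamma x) = gamma (a x) ->
  a (perp P x) = perp P (a x).
Proof. by move=> la e; rewrite /perp (linopB _ _ la) grading_comm. Qed.

Lemma pvm_gamma A x : measurable A -> even_set A -> E A (gamma x) = gamma (E A x).
Proof. by move=> mA eA; rewrite -[in LHS]eA gE. Qed.

Lemma commuting_grading : commuting_proj N E P.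
Proof.
split; [exact: vn_grading|exact: orthoproj_grading|move=> A x mA eA].
by apply: grading_comm; [exact: pvm_lin|exact: pvm_gamma].
Qed.

Lemma commuting_perp_grading : commuting_proj N E (perp P).
Proof.
split; [exact: vn_perp_grading|exact: orthoproj_perp_grading|move=> A x mA eA].
by apply: perp_grading_comm; [exact: pvm_lin|exact: pvm_gamma].
Qed.

(* The sign U of D anticommutes with gamma, hence intertwines the projections
   E A P and E A P^perp, whose traces are then tau (a^* a) and tau (a a^* ) for
   a = U P E A. *)
Lemma tau_pvm_balanced A : measurable A -> even_set A -> ~ A 0 ->
  tau (E A \o P) = tau (E A \o perp P).
Proof.
move=> mA eA A0.
pose Bp : set T := `]0, +oo[%classic.
pose Bm : set T := `]-oo, 0[%classic.
have mBp : measurable Bp by exact: measurable_itv.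
have mBm : measurable Bm by exact: measurable_itv.
have ep : (fun t : T => -1 * t) @^-1` Bp = Bm.
  by apply/seteqP; split => t; rewrite /Bp /Bm /= !in_itv /= andbT mulN1r oppr_gt0.
have em : (fun t : T => -1 * t) @^-1` Bm = Bp.
  by apply/seteqP; split => t; rewrite /Bp /Bm /= !in_itv /= andbT mulN1r oppr_lt0.
have dpm : Bp `&` Bm = set0.
  by apply/seteqP; split => t //; rewrite /Bp /Bm /= !in_itv /= andbT => -[]; lra.
have dmp : Bm `&` Bp = set0 by rewrite setIC.
pose U x := E Bp x - E Bm x.
have NU : N U by apply: vn_sub => //; exact: EN.
have lU : linear U by exact: vn_lin NU.
have aU : is_adjoint U U by move=> x y; rewrite innerBl innerBr !pvm_adj.
have Ug x : U (gamma x) = - gamma (U x).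
  rewrite /U (linopB _ _ bg.1) opprB -(gE _ mBp) -(gE _ mBm) ep em.
  by [].
have UP x : U (P x) = perp P (U x).
  by rewrite gradingE perp_gradingE (linopZ _ _ lU) (linopD _ _ lU) Ug addrC.
have UPp x : U (perp P x) = P (U x).
  by rewrite gradingE perp_gradingE (linopZ _ _ lU) (linopB _ _ lU) Ug opprK addrC.
have UE x : U (E A x) = E A (U x).
  by rewrite /U pvmB // !(pvm_comm E _ mA).
have UU x : U (U (E A x)) = E A x.
  rewrite {2}/U (_ : U _ = E Bp (E A x) + E Bm (E A x)).
    have sub : A `<=` Bp `|` Bm.
      move=> t At; have t0 : t != 0 by apply/eqP => t0; apply: A0; rewrite -t0.
      rewrite /Bp /Bm /= !in_itv /= andbT.
      by case: (ltgtP t 0) t0 => // h _; [right|left].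
    rewrite -pvmU //; last by rewrite disj_set2E dpm.
    by apply: pvm_subI => //; exact: measurableU.
  rewrite /U !pvmB // !pvmK // (pvm_disj E _ mBp mBm dpm) (pvm_disj E _ mBm mBp dmp).
  by rewrite subr0 sub0r opprK.
have [_ _ cP] := commuting_grading; have [_ pP aP] := orthoproj_grading.
have [_ _ cPp] := commuting_perp_grading.
pose a := U \o (P \o E A); pose a' := (E A \o P) \o U.
have Na : N a.
  by apply: vn_comp => //; apply: vn_comp => //; [exact: vn_grading|exact: EN].
have aa' : is_adjoint a a'.
  apply: adjoint_comp => //; apply: adjoint_comp => //; exact: pvm_adj.
have PP x : P (P x) = P x by exact: orthoprojK orthoproj_grading.
have := tau_comm tr_tau Na aa'.
have -> : a' \o a = E A \o P.
  apply/funext => x; rewrite /a /a' /= -cP // UU -cP // PP.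
  exact: pvmK.
have -> : a \o a' = E A \o perp P.
  apply/funext => x; rewrite /a /a' /= pvmK //.
  by rewrite -cP // PP UE UP cPp // -!UE UU cPp.
by [].
Qed.

(** Both sides are suprema over the same dyadic lists, whose sets lie in B and so miss 0;
    [tau_pvm_balanced] matches them term by term. *)
Lemma tau_balanced (p : H -> H) B (u : T -> R) : pos_cone N p ->
  (forall x, p (gamma x) = gamma (p x)) -> measurable B -> measurable_fun B u ->
  even_set B -> ~ B 0 -> (forall t, u (-1 * t) = u t) -> (forall t, B t -> 0 <= u t) ->
  (forall x, (\int[pvm_at E x]_(t in B) (u t)%:E = (ri (p x) x)%:E)%E) ->
  tau (P \o p) = tau (perp P \o p).
Proof.
move=> pp pg mB mu eB B0 eu u0 hp; have lp := vn_lin hN pp.1.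
rewrite (tau_sup_simple_op hN htau EN commuting_grading pp _ mB mu eB eu u0 hp);
  last by move=> x; exact: grading_comm.
rewrite (tau_sup_simple_op hN htau EN commuting_perp_grading pp _ mB mu eB eu u0 hp);
  last by move=> x; exact: perp_grading_comm.
suff e n : tau (simple_op E P (dyadic_list B u n)) =
    tau (simple_op E (perp P) (dyadic_list B u n)).
  by rewrite (_ : (fun n => _) = fun n => tau (simple_op E (perp P) (dyadic_list B u n))) //;
    apply/funext => n.
have adm : admissible (dyadic_list B u n) by exact: dyadic_list_admissible.
have sub k : List.In k (dyadic_list B u n) -> k.2 `<=` B by exact: dyadic_list_sub.
rewrite (tau_simple_op hN htau EN commuting_grading adm).
rewrite (tau_simple_op hN htau EN commuting_perp_grading adm).
move: adm sub; elim: (dyadic_list B u n) => [|k l IH]; first by rewrite !big_nil.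
move=> /admissible_cons[k0 mk ek hl] sub; rewrite !big_cons IH //; last first.
  by move=> k' h; apply: sub; right.
congr (_ * _ + _)%E; apply: tau_pvm_balanced => // k20.
by apply: B0; apply: (sub k) => //; left.
Qed.

Context (f : R -> R[i]) (mf : measurable_cfun f) (fe : forall t, f (-1 * t) = f t).
Context (h : H -> H) (Nh : N h) (hh : forall x, spectral_integral E f (x, h x)).
Context (b : H -> H) (bf : fin_cone N tau b) (hb : forall x, nr (b x) = nr (h x)).

Let bh : bounded_op h. Proof. exact: vn_bounded Nh. Qed.

Lemma calc_gamma x : h (gamma x) = gamma (h x).
Proof.
apply: (calc_intertwine mf bh hh bg bg gsa gK fe) => [A y mA|y]; first exact: gE.
by apply: (pexpIrn (n := 2)) => //; rewrite ?nnegrE ?nr_ge0 // !nr_sqr /ri gsa gK.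
Qed.

(** With z = E A x, k |z|^2 <= Re (w <h z, z>) <= |h z| |z|; as h z = E A (h x), this gives |k E A
    x| <= |b x|, and monotonicity of the square root yields k E A <= b. *)
Lemma pvm_fin_cone A w (k : R) : measurable A -> 0 < k -> Re `|w| = 1 ->
  (forall t, A t -> k <= Re (w * f t)) -> fin_cone N tau (E A).
Proof.
move=> mA k0 w1 hk; have pA := pvm_proj E mA.
have cA : pos_cone N (E A) by apply: pos_cone_proj => //; exact: EN.
have kA : pos_cone N (fun x => k%:C *: E A x) by apply: pos_cone_scale => //; exact: ltW.
have ki : fin_cone N tau (fun x => k%:C *: E A x).
  apply: (fin_cone_le hN tr_tau kA bf).
  apply: op_monotone_sqrt; [exact: kA.2|exact: bf.1.2|move=> x].
  rewrite hb nrZr gtr0_norm //.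
  apply: le_trans (_ : nr (E A (h x)) <= _); last exact: pvm_nr_le.
  rewrite (calc_comm mf hh) //; set z := E A x.
  have [->|z0] := eqVneq z 0; first by rewrite nr0 mulr0 nr_ge0.
  rewrite -(ler_pM2r (nr_gt0 z0)) -mulrA -expr2.
  apply: le_trans (SI_ge mf mA (hh z) (pvmK E x mA) hk) _.
  rewrite -innerZl; apply: le_trans (ri_le _ _) _.
  by rewrite nrZ w1 mul1r.
have -> : E A = (fun x => (k^-1)%:C *: (k%:C *: E A x)).
  by apply/funext => x; rewrite scalerA -rmorphM /= mulVf ?scale1r // gt_eqF.
by apply: (fin_cone_scale hN tr_tau _ ki); rewrite invr_ge0 ltW.
Qed.

Context (k : H -> H) (hk : is_adjoint h k).

(* The real part of w f(D). *)
Definition calc_part (w : R[i]) : H -> H :=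
  fun x => 2%:R^-1 *: (w *: h x + w^*%C *: k x).

Let Nk : N k. Proof. exact: vn_adj Nh hk. Qed.

Lemma vn_calc_part w : N (calc_part w).
Proof. by apply: vn_scale => //; apply: vn_add => //; exact: vn_scale. Qed.

Lemma calc_part_comm w (a : H -> H) x : linear a -> (forall x, a (h x) = h (a x)) ->
  (forall x, a (k x) = k (a x)) -> a (calc_part w x) = calc_part w (a x).
Proof.
move=> la ah ak; rewrite /calc_part (linopZ _ _ la) (linopD _ _ la) !(linopZ _ _ la).
by rewrite ah ak.
Qed.

Lemma adj_gamma x : gamma (k x) = k (gamma x).
Proof.
have e : gamma \o k = k \o gamma.
  apply: (@adjoint_uniq _ _ (h \o gamma)); first exact: adjoint_comp.
  have -> : h \o gamma = gamma \o h by apply/funext => y /=; exact: calc_gamma.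
  exact: adjoint_comp.
by have /= := congr1 (@^~ x) e.
Qed.


Lemma calc_part_inner w x : '[calc_part w x | x] = (Re (w * '[h x | x]))%:C.
Proof.
rewrite /calc_part innerZl innerDl !innerZl.
have -> : '[k x | x] = '[h x | x]^*%C by rewrite (adjointC hk) innerC.
by rewrite ReJ_add rmorphM /= mulrC.
Qed.

(** The adjoint term is controlled by normality, |k x| = |h x|. *)
Lemma nr_calc_part w x : Re `|w| = 1 -> nr (calc_part w x) <= nr (h x).
Proof.
move=> w1; rewrite /calc_part nrZ.
have -> : Re `|2%:R^-1 : R[i]| = 2^-1 :> R.
  by rewrite ger0_norm ?invr_ge0 ?ler0n // -(rmorph_nat (real_complex R)) -fmorphV.
rewrite mulrC ler_pdivrMr //; apply: le_trans (nrD _ _) _.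
have w1' : Re `|w^*%C| = 1 by rewrite normcJ.
by rewrite !nrZ w1 w1' (calc_nr_adj mf bh hh) //; lra.
Qed.

Lemma pvm_adj_comm B x : measurable B -> E B (k x) = k (E B x).
Proof.
move=> mB; apply: (congr1 (@^~ x) (_ : E B \o k = k \o E B)).
apply: (@adjoint_uniq _ _ (h \o E B)); first by apply: adjoint_comp => //; exact: pvm_adj.
have -> : h \o E B = E B \o h by apply/funext => y' /=; rewrite (calc_comm mf hh).
by apply: adjoint_comp => //; exact: pvm_adj.
Qed.

(** The form at x is that of the real part of w h at E B x, whose spectral measure is the one of x
    restricted to B. *)
Lemma calc_part_integral w B x : measurable B ->
  (\int[pvm_at E x]_(t in B) (Re (w * f t))%:E =
   (ri ((E B \o calc_part w) x) x)%:E)%E.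
Proof.
move=> mB; have mBc := measurableC mB.
have lE := pvm_lin E mB.
pose z := E B x.
have -> : ri ((E B \o calc_part w) x) x = Re (w * '[h z | z]).
  have lk := vn_lin hN (vn_calc_part w).
  have e : E B (calc_part w x) = calc_part w z.
    apply: calc_part_comm => [|y|y] //; first exact: (calc_comm mf hh y mB).
    exact: pvm_adj_comm.
  rewrite /= -(pvmK E (calc_part w x) mB) /ri pvm_adj // e -/z calc_part_inner.
  by [].
have iz := Re_integrable mf w (hh z).1.
rewrite (SI_Re mf w (hh z)) /Rintegral.
rewrite fineK; last exact: integrable_fin_num.
rewrite -[in RHS](setUv B) integral_setU //; first last.
- by rewrite disj_set2E setICr.
- by rewrite setUv; exact: measurable_int iz.
have -> : (\int[pvm_at E z]_(t in ~` B) (Re (w * f t))%:E = 0)%E.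
  rewrite (eq_measure_integral mzero) ?integral_measure_zero //.
  move=> A mA AB; rewrite /= /mzero pvm_atE /z pvm_disj ?nr0 ?expr0n //.
  by apply/disjoints_subset.
rewrite adde0; apply: eq_measure_integral => A mA AB.
by apply: (pvm_at_restr mB mA AB); rewrite /z pvmK.
Qed.

Lemma calc_part_gamma w B x : measurable B -> even_set B ->
  (E B \o calc_part w) (gamma x) = gamma ((E B \o calc_part w) x).
Proof.
move=> mB eB /=; rewrite -pvm_gamma //; congr (E B _); apply/esym.
apply: calc_part_comm => [|y|y]; first exact: bg.1.
- by rewrite calc_gamma.
- exact: adj_gamma.
Qed.

Lemma comp_proj_fin_cone p q : fin_cone N tau p -> N q -> orthoproj q ->
  (forall x, p (q x) = q (p x)) -> fin_cone N tau (q \o p).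
Proof.
move=> fp Nq qq pq; apply: (fin_cone_le hN tr_tau _ fp).
  by split; [exact: vn_comp fp.1.1|exact: positive_comp_proj fp.1.2 qq pq].
exact: comp_proj_le fp.1.2 qq pq.
Qed.

(** gamma p = P p - P^perp p is a difference of two positive operators dominated by p. *)
Lemma has_trace_gamma p : fin_cone N tau p -> (forall x, p (gamma x) = gamma (p x)) ->
  has_trace N tau (gamma \o p)
    (fine (tau (P \o p)) - fine (tau (perp P \o p)))%:C.
Proof.
move=> fp pg; have lp := vn_lin hN fp.1.1.
have hP : fin_cone N tau (P \o p).
  apply: comp_proj_fin_cone => //; [exact: vn_grading|exact: orthoproj_grading|].
  by move=> x; exact: grading_comm.
have hPp : fin_cone N tau (perp P \o p).
  apply: comp_proj_fin_cone => //; [exact: vn_perp_grading|exact: orthoproj_perp_grading|].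
  by move=> x; exact: perp_grading_comm.
have := has_trace_sub hN tr_tau (has_trace_fin hN tr_tau hP) (has_trace_fin hN tr_tau hPp).
rewrite -rmorphB /= (_ : (fun x => _) = gamma \o p) //.
by apply/funext => x /=; rewrite gamma_split.
Qed.

(** The sign condition makes this part of f(D) positive, and it is dominated by b; its traces under
    P and P^perp are therefore finite, and they balance. *)
Lemma has_trace_part w B : Re `|w| = 1 -> measurable B -> even_set B -> ~ B 0 ->
  (forall t, B t -> 0 <= Re (w * f t)) ->
  has_trace N tau (gamma \o (E B \o calc_part w)) 0.
Proof.
move=> w1 mB eB B0 pos; set p := E B \o calc_part w.
have Np : N p by apply: vn_comp => //; [exact: EN|exact: vn_calc_part].
have pE x : p x = calc_part w (E B x).
  apply: calc_part_comm => [|y|y]; first exact: pvm_lin.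
    exact: (calc_comm mf hh y mB).
  exact: pvm_adj_comm.
have pinner x : '[p x | x] = (Re (w * '[h (E B x) | E B x]))%:C.
  by rewrite /p /= -(pvmK E (calc_part w x) mB) pvm_adj // -[E B (calc_part w x)]/(p x) pE calc_part_inner.
have pp : positive_op p.
  split; first exact: vn_bounded Np.
  move=> x; rewrite pinner ler0c.
  have := SI_ge mf (k := 0) mB (hh (E B x)) (pvmK E x mB) pos.
  by rewrite mul0r.
have pc : pos_cone N p by [].
have fp : fin_cone N tau p.
  apply: (fin_cone_le hN tr_tau pc bf); apply: op_monotone_sqrt => //.
    exact: bf.1.2.
  move=> x; rewrite hb /p /=; apply: le_trans (pvm_nr_le E _ mB) _.
  exact: nr_calc_part.
have pg x : p (gamma x) = gamma (p x) by exact: calc_part_gamma.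
have mu : measurable_fun B ((fun t : T => Re (w * f t)) : T -> R).
  apply: measurable_funTS; apply/measurable_EFinP.
  exact: measurable_int (Re_integrable mf w (hh 0).1).
have e := tau_balanced pc pg mB mu eB B0 _ pos (fun x => calc_part_integral w x mB).
have := has_trace_gamma fp pg; rewrite e ?subrr //.
by move=> t; rewrite fe.
Qed.

Lemma even_set_preimage (C : set R[i]) : even_set ([set t : T | C (f t)] `\ 0).
Proof.
rewrite /even_set; apply/seteqP; split=> t [/= h1 h2]; split => //=.
- by rewrite -fe.
- by move=> t0; apply: h2; rewrite t0 mulr0.
- by rewrite fe.
- by move=> t0; apply: h2; apply/eqP; move/eqP: t0; rewrite mulN1r oppr_eq0.
Qed.

Lemma even_set0 : even_set [set 0 : T].
Proof.
apply/seteqP; split=> t /=; last by move=> ->; rewrite mulr0.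
by move/eqP; rewrite mulN1r oppr_eq0 => /eqP.
Qed.

Context (f0 : f 0 != 0).

Lemma pvm0_fin_cone : fin_cone N tau (E [set 0]).
Proof.
have [w w1 hw] := unit_phase (f 0).
apply: (@pvm_fin_cone _ w (Re `|f 0|)) => //.
  have : 0 < `|f 0| by rewrite normr_gt0.
  by rewrite ltcE => /andP[].
by move=> t ->; rewrite hw.
Qed.

(** Off 0, the real and the imaginary part of f(D) are each cut along the sign of the corresponding
    part of f into a difference of two positive operators, to which [has_trace_part] applies. *)
Lemma has_trace_gamma_calc : has_trace N tau (gamma \o h)
  (f 0 * (fine (tau (P \o E [set 0])) - fine (tau (perp P \o E [set 0])))%:C).
Proof.
have m0 : measurable [set 0 : T] by exact: measurable_set1.
have t0 : has_trace N tau (fun x => f 0 *: gamma (E [set 0] x)) _ :=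
  has_trace_scale hN tr_tau (f 0) (has_trace_gamma pvm0_fin_cone
    (fun x => pvm_gamma x m0 even_set0)).
(* Sign sets of Re (w f) with 0 removed; on [B' w] it is the part for - w that is positive. *)
pose B w : set T := [set t : T | 0 <= Re (w * f t)] `\ 0.
pose B' w : set T := [set t : T | Re (w * f t) < 0] `\ 0.
have mRe w : measurable_fun [set: T] (fun t : T => Re (w * f t)).
  apply/measurable_EFinP; exact: measurable_int (Re_integrable mf w (hh 0).1).
have mB w : measurable (B w).
  apply: measurableD => //; rewrite -[X in measurable X]setTI.
  rewrite (_ : [set t | _] = (fun t : T => Re (w * f t)) @^-1` `[0, +oo[%classic).
    by apply: mRe => //; exact: measurable_itv.
  by apply/seteqP; split => t /=; rewrite in_itv /= andbT.
have mB' w : measurable (B' w).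
  apply: measurableD => //; rewrite -[X in measurable X]setTI.
  rewrite (_ : [set t | _] = (fun t : T => Re (w * f t)) @^-1` `]-oo, 0[%classic).
    by apply: mRe => //; exact: measurable_itv.
  by apply/seteqP; split => t /=; rewrite in_itv /=.
have eB w : even_set (B w) by exact: (even_set_preimage [set c | 0 <= Re (w * c)]).
have eB' w : even_set (B' w) by exact: (even_set_preimage [set c | Re (w * c) < 0]).
have hB w : Re `|w| = 1 -> has_trace N tau (gamma \o (E (B w) \o calc_part w)) 0.
  by move=> w1; apply: has_trace_part => //; [case=> _; exact|move=> t []].
have hB' w : Re `|w| = 1 -> has_trace N tau (gamma \o (E (B' w) \o calc_part (- w))) 0.
  move=> w1; apply: has_trace_part => //; [by rewrite normrN|by case=> _; exact|].
  move=> t [/= h1 _]; rewrite mulNr raddfN oppr_ge0; exact: ltW.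
have split w x : E (~` [set 0]) (calc_part w x) =
    E (B w) (calc_part w x) - E (B' w) (calc_part (- w) x).
  have -> : calc_part (- w) x = - calc_part w x.
    by rewrite /calc_part rmorphN !scaleNr -opprD scalerN.
  rewrite (linopN _ (pvm_lin E (mB' w))) opprK -pvmU //.
    congr (E _ _); apply/seteqP; split=> t.
      by move=> h0; have [h1|h1] := leP 0 (Re (w * f t)); [left|right].
    by move=> [[]|[]].
  rewrite disj_set2E; apply/eqP/seteqP; split=> t // -[[/= h1 _] [/= h2 _]].
  by move: (le_lt_trans h1 h2); rewrite ltxx.
have part w : Re `|w| = 1 ->
    has_trace N tau (fun x => gamma (E (~` [set 0]) (calc_part w x))) 0.
  move=> w1; have := has_trace_sub hN tr_tau (hB _ w1) (hB' _ w1).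
  rewrite subr0 (_ : (fun x => _) = fun x => gamma (E (~` [set 0]) (calc_part w x))) //.
  by apply/funext => x /=; rewrite split (linopB _ _ bg.1).
have n1 : Re `|1 : R[i]| = 1 by rewrite normr1.
have ni : Re `|- 'i%C : R[i]| = 1 by rewrite normrN Re_norm_i.
have h1 := has_trace_add hN tr_tau t0
  (has_trace_add hN tr_tau (part _ n1) (has_trace_i (part _ ni))).
move: h1; rewrite mulr0 !addr0.
rewrite (_ : (fun x => _) = gamma \o h) //.
apply/funext => x /=.
(* The imaginary part of f is the real part of - i f. *)
have hx : h x = calc_part 1 x + 'i%C *: calc_part (- 'i%C) x.
  rewrite /calc_part conj_Ni opprK rmorph1 !scale1r.
  have -> : 'i%C *: (2%:R^-1 *: (- 'i%C *: h x + 'i%C *: k x)) = 2%:R^-1 *: (h x - k x).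
    rewrite scalerA mulrC -scalerA; congr (_ *: _).
    by rewrite scalerDr !scalerA mulrN -expr2 sqr_i opprK scale1r scaleN1r.
  by rewrite -scalerDr addrACA subrr addr0 half_scale.
have mc := measurableC m0.
rewrite -(linopZ _ _ bg.1) -(linopZ _ _ bg.1) -!(linopD _ _ bg.1); congr (gamma _).
rewrite -(pvmZ E 'i%C _ mc) -(pvmD E _ _ mc) -hx pvmC // (calc_comm mf hh) //.
have -> : h (E [set 0] x) = f 0 *: E [set 0] x.
  by apply: (calc_eigen mf bh hh (t0 := 0)) => //; exact: pvmK.
by rewrite addrC subrK.
Qed.

End Graded.

(** * The Fredholm property and the index *)

Section SpectralUniqueness.
Context (R : realType) (H : hilbertSpace R) (D : set (H * H)).
Context (D_sa : selfadjoint_op D).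
Local Notation T := (measurableTypeR R).
Implicit Types (E : pvm H) (A : set T) (x : H).

Lemma spectral_measure_uniq E E' A x : is_spectral_measure D E ->
  is_spectral_measure D E' -> measurable A -> E' A x = E A x.
Proof.
move=> hE hE' mA.
have hid y z : D (y, z) -> D (id y, (1 : R)%:C *: id z) by rewrite scale1r.
have idadj : is_adjoint (id : H -> H) id by [].
have := intertwine_pvm D_sa hE hE' (s := 1) x (@bounded_id R H) (@bounded_id R H)
  idadj (fun=> erefl) (fun=> erefl) (expr1n _ _) hid hid mA.
rewrite (_ : _ @^-1` A = A) //.
by apply/funext => t; rewrite /preimage /= mul1r.
Qed.

Lemma spectral_integral_eq E E' (g : R -> R[i]) (p : H * H) :
  (forall A x, measurable A -> E' A x = E A x) ->
  spectral_integral E g p -> spectral_integral E' g p.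
Proof.
move=> e.
have em x A : measurable A -> pvm_at E x A = pvm_at E' x A.
  by move=> mA; rewrite !pvm_atE e.
have es x : square_int E g x <-> square_int E' g x.
  rewrite /square_int (eq_measure_integral (pvm_at E' x)) //.
  by move=> A mA _; exact: em.
have ec x : cintegral (pvm_at E x) g = cintegral (pvm_at E' x) g.
  rewrite /cintegral /Rintegral.
  by congr (fine _ +i* fine _); apply: eq_measure_integral => A mA _; exact: em.
move=> [s1 h1]; split=> [|z sz]; first exact: (es _).1 s1.
rewrite (h1 z ((es z).2 sz)); congr (_ * _); apply: eq_bigr => k _.
by congr (_ * _); exact: ec.
Qed.

(** [fcalc] lets the spectral measure depend on the pair; uniqueness allows the one found at 0 to
    serve for every x. *)
Lemma fcalc_spectral (f : R -> R[i]) (h : H -> H) : fcalc D f = graph h ->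
  exists2 E, is_spectral_measure D E & forall x, spectral_integral E f (x, h x).
Proof.
move=> fDE.
have ex x : fcalc D f (x, h x) by rewrite fDE.
have [E hE _] := ex 0; exists E => // x.
have [E' hE' hx] := ex x.
by apply: spectral_integral_eq hx => A y mA; exact: spectral_measure_uniq.
Qed.

(** For a kernel vector the powers of D give x, 0, 0, ..., so the support criterion applies with c =
    r = 0; conversely D is bounded by 0 on the range of E {0}. *)
Lemma spectral_kernel E x : is_spectral_measure D E -> D (x, 0) <-> E [set 0] x = x.
Proof.
move=> hE; have m0 : measurable [set 0 : T] by exact: measurable_set1.
split=> [Dx|Ex].
  pose y n : H := if n is 0%N then x else 0.
  have := @sa_support R H D E hE y 0 0 (nr x) _ (lexx 0) _.
  have -> : [set t : T | `|t - 0| <= 0] = [set 0].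
    by apply/seteqP; split=> t /=; rewrite subr0 normr_le0 => /eqP.
  apply=> [[|n]|[|n]] /=.
  - by rewrite scale0r add0r.
  - by rewrite scaler0 addr0; exact: sa_0.
  (* At index 0 the bound nr x times 0^0 is nr x itself. *)
  - by rewrite expr0 mulr1.
  - by rewrite nr0 mulr_ge0 ?nr_ge0 // exprn_ge0.
have hb (t : T) : [set 0 : T] t -> `|t - 0| <= 0 by move=> ->; rewrite subrr normr0.
have [v hv] := sa_dom D_sa hE m0 Ex hb (lexx 0).
have := sa_bound D_sa hE m0 hv Ex hb (lexx 0).
rewrite mul0r => v0; have v00 : v = 0.
  by apply: nr_eq0; apply/eqP; rewrite eq_le v0 nr_ge0.
by move: hv; rewrite v00 scale0r addr0.
Qed.

(* Away from 0 the operator is bounded below, so that <w, y> = <D w, x> is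
   solvable in x by Riesz; selfadjointness then gives D x = y. *)
Lemma spectral_gap_onto E (d : R) y : is_spectral_measure D E -> 0 < d ->
  E [set t : T | `|t| <= d] y = 0 -> exists x, D (x, y).
Proof.
move=> hE d0 Ey.
pose A : set T := [set t | `|t| <= d].
have mA : measurable A by exact: measurable_norm_le.
have mAc := measurableC mA.
have yE : E (~` A) y = y by rewrite pvmC // [E A y]Ey subr0.
have [| | |x hx] := @riesz_graph _ _
    (fun w c => exists z : H, D (z, w) /\ c = '[z | y]) (d^-1 * nr y).
- by exists 0; split; [exact: sa_0|rewrite inner0l].
- move=> a w c w' c' [z [zw ->]] [z' [zw' ->]]; exists (a *: z + z'); split.
    exact: sa_lin.
  by rewrite innerDl innerZl.
- move=> w c [z [zw ->]]; rewrite -yE -pvm_adj //.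
  apply: le_trans (inner_le _ _) _.
  rewrite yE mulrAC ler_wpM2r ?nr_ge0 // ler_pdivlMl //.
  have zw' : D (E (~` A) z, (0 : R)%:C *: E (~` A) z + E (~` A) w).
    by rewrite scale0r add0r; exact: sa_comm.
  apply: le_trans (pvm_nr_le E w mAc).
  apply: (sa_lower hE mAc zw') => [|t /= /negP]; first exact: pvmK.
  by rewrite -ltNge subr0 => /ltW.
- exists x; apply: sa_adj => // z w zw.
  by apply/esym; apply: hx; exists z.
Qed.

End SpectralUniqueness.

(** * The operator D^+ and its Fredholm property *)

Section OddOperator.
Context (R : realType) (H : hilbertSpace R) (N : set (H -> H)).
Context (tau : (H -> H) -> \bar R) (hN : von_neumann N) (htau : fns_trace N tau).
Context (D : set (H * H)) (D_sa : selfadjoint_op D) (D_aff : affiliated N D).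
Context (E : pvm H) (hE : is_spectral_measure D E).
Local Notation T := (measurableTypeR R).
Context (gamma : H -> H) (gN : N gamma) (gK : involutive gamma).
Context (gsa : is_adjoint gamma gamma).
Context (gD : forall x y, D (x, y) -> D (gamma x, - gamma y)).
Implicit Types (x y z : H) (A : set T).

Local Notation P := (grading_proj gamma).
Let tr_tau : is_trace N tau. Proof. by case: htau. Qed.
Let bg : bounded_op gamma. Proof. exact: (vn_bounded hN gN). Qed.

Lemma odd_pvm A x : measurable A ->
  E ((fun t : T => -1 * t) @^-1` A) (gamma x) = gamma (E A x).
Proof.
move=> mA.
have h y z : D (y, z) -> D (gamma y, (-1 : R)%:C *: gamma z).
  by rewrite rmorphN1 scaleN1r; exact: gD.
by apply: (intertwine_pvm D_sa hE hE x bg bg gsa gK gK _ h h mA); rewrite sqrrN expr1n.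
Qed.

(** Half the sum of the pairs (gamma x, - gamma y) and (x, y) of the graph. *)
Lemma odd_swap x y : D (x, y) -> D (P x, perp P y).
Proof.
move=> xy; rewrite (gradingE gamma) (perp_gradingE gamma).
by apply: sa_scale => //; have := sa_add D_sa (gD xy) xy; rewrite [- _ + _]addrC.
Qed.

Lemma odd_perp x y : D (P x, y) -> perp P y = y.
Proof.
move=> xy; have := odd_swap xy.
rewrite (orthoprojK _ (orthoproj_grading hN gN gK gsa)) => xy'.
exact: (sa_fun D_sa xy' xy).
Qed.

(** D sends the range of P into that of [perp P]. The graph of D^+ thus becomes a preimage of that
    of D under a bounded map, from which closedness and affiliation are read off. *)
Lemma DplusE : Dplus gamma D = [set p | D (P p.1, p.2)].
Proof.
apply/seteqP; split=> -[x y] /=.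
  move=> [w [v /= ev vw] /= ey].
  have ev' : v = P x := ev; have ey' : y = perp P w := ey.
  by rewrite ev' in vw; rewrite ey' (odd_perp vw).
move=> xy; exists y; last by rewrite /graph /= (odd_perp xy).
by exists (P x).
Qed.

Lemma closed_Dplus : closed_op (Dplus gamma D).
Proof.
have pP := orthoproj_grading hN gN gK gsa; have [[lP _] _ _] := pP.
rewrite DplusE; split; first split.
- move=> c [x y] [x' y'] /= h h'; rewrite lP; exact: sa_lin.
- by move=> x y z /=; exact: sa_fun.
(* P preserves the domain of D by [odd_swap], so the domain of D^+ contains that of D. *)
- apply/dense_nr => x e e0; have [z [w [zw hz]]] := sa_dense D_sa x e0.
  by exists z => //; exists (z, perp P w) => //=; exact: odd_swap.
- move=> [x y] cl; rewrite /= ; apply: (sa_closed D_sa) => B.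
  move=> /nbhs_ballP[e /= /posC[-> e0] eB].
  have [[x' y'] /= Dxy [/= hx hy]] := closure_nr2 cl e0.
  exists (P x', y'); split=> //; apply: eB; split; rewrite -ball_normE /ball_ /= nrE ltcR //.
  by rewrite -linopB //; apply: le_lt_trans (orthoproj_nr _ pP) hx.
Qed.

Lemma affiliated_Dplus : affiliated N (Dplus gamma D).
Proof.
rewrite DplusE => u cu uu x y /= h.
rewrite (vn_comm x (vn_grading hN gN) cu); exact: D_aff.
Qed.

Lemma corner_Dplus : affiliated_corner N (perp P) P (Dplus gamma D).
Proof.
split; [exact: closed_Dplus|exact: affiliated_Dplus|].
have pP := orthoproj_grading hN gN gK gsa.
rewrite DplusE; apply/seteqP; split=> -[x y] /=.
  move=> xy; exists y; last by rewrite /graph /= (odd_perp xy).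
  by exists (P x) => //=; rewrite orthoprojK.
move=> [w [v ev vw] ey].
have ev' : v = P x := ev; have ey' : y = perp P w := ey.
by move: vw; rewrite ev' /= orthoprojK // => vw; rewrite ey' (odd_perp vw).
Qed.

Let m0 : measurable [set 0 : T]. Proof. exact: measurable_set1. Qed.

(** Stated for a general Q so as to serve both the kernel, with Q = P, and the cokernel, with Q =
    [perp P]. *)
Lemma kernel_proj (Q : H -> H) (V : set H) : commuting_proj N E Q ->
  (forall x, V x <-> D (x, 0) /\ Q x = x) -> proj_onto V = Q \o E [set 0].
Proof.
move=> [NQ qq cQ] hV; have pE := pvm_proj E m0.
have c0 x : E [set 0] (Q x) = Q (E [set 0] x) by apply: cQ => //; exact: even_set0.
have pp : orthoproj (Q \o E [set 0]) by apply: orthoproj_comp.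
apply: proj_onto_eq => //; apply/seteqP; split=> x.
  move=> /(orthoproj_range _ pp) /= e; apply/hV; split.
    apply/(spectral_kernel D_sa _ hE); rewrite -{1}e c0 pvmK //.
  by rewrite -{1}e orthoprojK.
move=> /hV[/(spectral_kernel D_sa _ hE) Ex Qx].
by apply/(orthoproj_range _ pp) => /=; rewrite Ex.
Qed.

Let cP := commuting_grading hN gN gK gsa odd_pvm.
Let cPp := commuting_perp_grading hN gN gK gsa odd_pvm.

Lemma ker_Dplus : ker_proj P (Dplus gamma D) = P \o E [set 0].
Proof.
have pP := orthoproj_grading hN gN gK gsa.
apply: kernel_proj => // x; rewrite DplusE; split.
  move=> [h /(orthoproj_range _ pP) Px]; split=> //.
  by have h' : D (P x, 0) := h; rewrite Px in h'.
by move=> [h Px]; split; [change (D (P x, 0)); rewrite Px|apply/(orthoproj_range _ pP)].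
Qed.

Lemma ker_Dplus_adj : ker_proj (perp P) (adjop (Dplus gamma D)) = perp P \o E [set 0].
Proof.
have pPp := orthoproj_perp_grading hN gN gK gsa; have [_ _ aPp] := pPp.
apply: kernel_proj => // x; rewrite DplusE; split.
  move=> [h /(orthoproj_range _ pPp) Px]; split=> //.
  (* As x is fixed by [perp P], testing on the pairs (z, perp P w) of D^+ amounts to testing on all
     pairs (z, w) of D. *)
  apply: (sa_adj D_sa) => z w zw; rewrite inner0r -Px -aPp.
  by have := h (z, perp P w) (odd_swap zw); rewrite /= inner0r.
move=> [h Px]; split; last exact/(orthoproj_range _ pPp).
move=> [z w] /= zw; rewrite inner0r.
by have := sa_sym D_sa zw h; rewrite inner0r.
Qed.

Lemma fredholm_Dplus (d : R) : 0 < d ->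
  (tau (E [set t : T | (`|t| <= d)%R]) < +oo)%E ->
  corner_fredholm N tau (perp P) P (Dplus gamma D).
Proof.
move=> d0 fd; pose A : set T := [set t | `|t| <= d].
have mA : measurable A by exact: measurable_norm_le.
have eA : even_set A.
  by apply/seteqP; split=> t; rewrite /A /= mulN1r normrN.
have EN B : measurable B -> N (E B) by exact: (affiliated_pvm hN D_sa D_aff hE).
have [NP pP hP] := cP; have [NPp pPp hPp] := cPp.
have fA : fin_cone N tau (E A).
  by split=> //; apply: pos_cone_proj; [exact: EN|exact: pvm_proj].
have f0 : fin_cone N tau (E [set 0]).
  apply: (fin_cone_le hN tr_tau _ fA).
    by apply: pos_cone_proj; [exact: EN|exact: pvm_proj].
  have sub : [set 0] `<=` A by move=> t ->; rewrite /A /= normr0 ltW.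
  have -> : E [set 0] = E [set 0] \o E A.
    by apply/funext => x /=; rewrite -pvmI // setIidl.
  apply: comp_proj_le; [exact/orthoproj_positive/pvm_proj|exact: pvm_proj|].
  by move=> x; exact: pvm_comm.
have fQ (Q : H -> H) B : commuting_proj N E Q -> measurable B -> even_set B ->
    fin_cone N tau (E B) -> fin_cone N tau (Q \o E B).
  move=> [NQ qq cQ] mB eB fB.
  by apply: (comp_proj_fin_cone hN htau fB NQ qq) => x; exact: cQ.
split=> //.
- exact: corner_Dplus.
- rewrite ker_Dplus ker_Dplus_adj; split.
    exact: (fQ _ _ cP m0 (even_set0 R) f0).2.
  exact: (fQ _ _ cPp m0 (even_set0 R) f0).2.
- have fAp := fQ _ _ cPp mA eA fA.
  (* A vector y of the remaining range satisfies E A y = 0, so the spectral gap gives z with D z =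
     y; projecting by [odd_swap] gives D (P z) = y, that is, D^+ z = y. *)
  exists (perp P \o E A); split.
  + exact: fAp.1.1.
  + apply: orthoproj_comp => //; first exact: pvm_proj.
    by move=> x; rewrite hPp.
  + have -> : perp P \o E A = E A \o perp P by apply/funext => x /=; rewrite hPp.
    apply: comp_proj_le; [exact: orthoproj_positive|exact: pvm_proj|].
    by move=> x; rewrite hPp.
  + exact: fAp.2.
  + move=> _ [x _ <-] /=; set y := _ - _.
    have Py : perp P y = y.
      by have [[lPp _] _ _] := pPp; rewrite /y (linopB _ _ lPp) !(orthoprojK _ pPp).
    have Ey : E A y = 0.
      by rewrite /y pvmB // !hPp // pvmK // subrr.
    have [z zy] := spectral_gap_onto D_sa hE d0 Ey.
    exists (z, y) => //; rewrite DplusE /=.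
    by have := odd_swap zy; rewrite Py.
Qed.

End OddOperator.

Section Neighbourhood.
Context (R : realType).

Lemma continuous_lower_bound (f : R -> R[i]) (w : R[i]) (k : R) :
  continuous (f : R -> R[i]^o) -> k < Re (w * f 0) ->
  exists2 d : R, 0 < d & forall t, `|t| <= d -> k <= Re (w * f t).
Proof.
move=> /continuous_cfun[c1 c2] kf.
pose u t : R := Re w * Re (f t) - Im w * Im (f t).
have ue t : Re (w * f t) = u t by rewrite /u; case: w {kf u} => a b; case: (f t).
have cu : continuous u.
  move=> t; apply: cvgB; apply: cvgM; try exact: cvg_cst; [exact: c1|exact: c2].
have e0 : 0 < u 0 - k by rewrite subr_gt0 -ue.
have /cvgrPdist_lt/(_ _ e0)/nbhs_ballP[d /= d0 hd] := cu 0.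
(* Halving passes from the open ball to a closed one. *)
exists (d / 2) => [|t td]; first by rewrite divr_gt0.
have /hd : ball 0 d t.
  by rewrite -ball_normE /ball_ /= sub0r normrN; apply: le_lt_trans td _; lra.
by rewrite ue => /(le_lt_trans (ler_norm _)); lra.
Qed.

End Neighbourhood.

Theorem theorem3p16 (R : realType) (H : hilbertSpace R)
    (N : set (H -> H)) (tau : (H -> H) -> \bar R)
    (D : set (H * H)) (gamma : H -> H) (f : R -> R[i]) (fD : H -> H)
    (hN : von_neumann N) (htau : fns_trace N tau)
    (D_sa : selfadjoint_op D) (D_aff : affiliated N D)
    (gammaN : N gamma) (gamma_unitary : unitary gamma)
    (gamma_sa : is_adjoint gamma gamma)
    (gammaD : anticommutes gamma D)
    (f_cont : continuous (f : R -> R[i]^o))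
    (f_even : forall t, f (- t) = f t)
    (f0 : f 0 != 0)
    (fDE : fcalc D f = graph fD) (fD_tc : trace_class N tau fD) :
  let P := grading_proj gamma in
  corner_fredholm N tau (perp P) P (Dplus gamma D) /\
  (corner_index tau (perp P) P (Dplus gamma D))%:C =
    (f 0)^-1 * tr N tau (gamma \o fD).
Proof.
move=> P.
(* The inverse of a unitary is its adjoint, here gamma itself. *)
have gK : involutive gamma.
  have [_ [v [gv e1 _]]] := gamma_unitary.
  rewrite -(adjoint_uniq gamma_sa gv) in e1 => x.
  by have /= := congr1 (@^~ x) e1.
have gD x y : D (x, y) -> D (gamma x, - gamma y).
  move=> xy.
  have : compop (graph gamma) D (x, gamma y) by exists y.
  by rewrite gammaD => -[w ew h]; rewrite -[gamma x](ew : w = gamma x).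
have [E hE hh] := fcalc_spectral D_sa fDE.
have [NfD [b [Nb [pb [c fc bb]] fb]]] := fD_tc.
have bf : fin_cone N tau b by [].
(* Both squares are the form at x of b b = c f(D), where c is the adjoint of f(D). *)
have hb x : nr (b x) = nr (fD x).
  apply: (pexpIrn (n := 2)) => //; rewrite ?nnegrE ?nr_ge0 // !nr_sqr /ri.
  have /= e := congr1 (@^~ x) bb.
  by rewrite -(positive_selfadj pb) e (adjointC fc).
have mf := continuous_measurable_cfun f_cont.
have fe t : f (-1 * t) = f t by rewrite mulN1r f_even.
have EN (A : set (measurableTypeR R)) : measurable A -> N (E A).
  exact: (affiliated_pvm hN D_sa D_aff hE).
have gE := odd_pvm hN D_sa hE gammaN gK gamma_sa gD.
have [w w1 hw] := unit_phase (f 0).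
have f00 : 0 < Re `|f 0| by have := normr_gt0 (f 0); rewrite f0 ltcE => /andP[].
(* The phase w makes w f(0) equal to |f(0)|; half of it leaves room for continuity. *)
have [d d0 hd] : exists2 d : R, 0 < d & forall t, `|t| <= d -> Re `|f 0| / 2 <= Re (w * f t).
  by apply: continuous_lower_bound => //; rewrite hw; lra.
have fred : corner_fredholm N tau (perp P) P (Dplus gamma D).
  apply: (fredholm_Dplus hN htau D_sa D_aff hE gammaN gK gamma_sa gD d0).
  have k0 : 0 < Re `|f 0| / 2 by lra.
  by have [] := pvm_fin_cone hN htau EN mf hh bf hb (measurable_norm_le d) k0 w1 hd.
split=> //.
have := has_trace_gamma_calc hN htau EN gammaN gK gamma_sa gE mf fe NfD hh bf hb fc f0.
have [tr_tau _ _ _] := htau; move=> /(has_trace_tr tr_tau) ->; rewrite mulKf // /corner_index.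
rewrite (ker_Dplus hN D_sa hE gammaN gK gamma_sa gD).
by rewrite (ker_Dplus_adj hN D_sa hE gammaN gK gamma_sa gD).
Qed.
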